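(* Consider $k$-class classification with linear predictors trained by gradient descent on the one-hot squared loss, with limiting solution $\widehat w_j=(\mathbf X^T\mathbf X+\lambda\mathbf I)^{-1}\mathbf X^T\mathbf y_j$ for $j=1,\dots,k$, and $\widehat f(x)=(\widehat w_1^Tx,\dots,\widehat w_k^Tx)$. Assume the training algorithm satisfies the hypothesis stability condition with constant $\beta=O(1)$. Then for any $\delta>0$, with probability at least $1-\delta$, $$\mathcal E_{\mathcal D}(\widehat f)\le\mathcal E_S(\widehat f)+(k-1)\Big(1-\frac{k}{k-1}\mathcal E_{\widetilde S}(\widehat f)\Big)+\Big(k+\sqrt k+\frac{m}{n\sqrt k}\Big)\sqrt{\frac{\log(4/\delta)}{2m}}+\sqrt{k(k-1)}\sqrt{\frac4\delta\Big(\frac1m+\frac{3\beta}{m+n}\Big)}.$$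
   Context: Setup: $\mathcal X=\mathbb R^d$, $\mathcal Y=\{1,\dots,k\}$, $\mathcal D$ a distribution on $\mathcal X\times\mathcal Y$. Clean data $S=\{(x_i,c_i)\}_{i=1}^n\sim\mathcal D^n$; randomly labeled data $\widetilde S=\{(x_i,c_i)\}_{i=n+1}^{n+m}$ drawn independently: for each point draw $(x,c^T)\sim\mathcal D$ and assign a label $c$ uniform on $\mathcal Y$ independently; $m<n$. $\mathbf X\in\mathbb R^{(n+m)\times d}$ has rows $x_i^T$; labels are one-hot encoded, $e_{c_i}\in\mathbb R^k$, and $\mathbf y_j\in\{0,1\}^{n+m}$ is the vector of $j$-th coordinates. The objective is $\mathcal L(w;\lambda)=\sum_i\|w^Tx_i-e_{c_i}\|_2^2+\lambda\sum_{j=1}^k\|w_j\|_2^2$ ($w=[w_1,\dots,w_k]$, $\lambda\ge0$), minimized by gradient descent from $0$ with step size $\eta\le1/(\|\mathbf X^T\mathbf X\|_{\mathrm{op}}+\lambda^2)$. The 0-1 error at $(x,c)$ is $\mathcal E(\widehat f(x),c)=\mathbb 1\{c\notin\arg\max_j\widehat w_j^Tx\}$; $\mathcal E_{\mathcal Q}$ is expected error under distribution $\mathcal Q$, $\mathcal E_T$ average error over a finite dataset $T$. Hypothesis stability with constant $\beta$: for training set $T$ of size $N$, $f=f(\mathcal A,T)$, $f_{(i)}=f(\mathcal A,T_{(i)})$ with $T_{(i)}$ being $T$ with its $i$-th point removed, for all $i$, $\mathbb E_{T,(x,y)\sim\mathcal D}[|\mathcal E(f(x),y)-\mathcal E(f_{(i)}(x),y)|]\le\beta/N$.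 *)

(* Defs.v *)
From HB Require Import structures.
From mathcomp Require Import all_boot all_order all_algebra.
From mathcomp Require Import all_classical all_reals all_analysis.
Set Implicit Arguments. Unset Strict Implicit. Unset Printing Implicit Defensive.
Import Order.TTheory GRing.Theory Num.Theory.
Local Open Scope classical_set_scope.
Local Open Scope ring_scope.

(* Moore--Penrose conditions (real case) and pseudo-inverse (= the inverse
   whenever A is invertible). *)
Definition penrose (R : realType) (p : nat) (A B : 'M[R]_p) : Prop :=
  [/\ A *m B *m A = A, B *m A *m B = B, (A *m B)^T = A *m B & (B *m A)^T = B *m A].

Definition pinv (R : realType) (p : nat) (A : 'M[R]_p) : 'M[R]_p :=
  xget 0 [set B | penrose A B].

(* Limiting GD solution of the regularized one-hot squared loss:
   w = (X^T X + lam I)^{-1} X^T Y, column j of Y being y_j. *)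
Definition trainW (R : realType) (N d k : nat) (lam : R)
    (X : 'M[R]_(N, d)) (Y : 'M[R]_(N, k)) : 'M[R]_(d, k) :=
  pinv (X^T *m X + lam%:M) *m (X^T *m Y).

Definition argmaxs (R : realType) (k : nat) (s : 'rV[R]_k) : {set 'I_k} :=
  [set j : 'I_k | [forall j' : 'I_k, s 0 j' <= s 0 j]].

Definition err01 (R : realType) (d k : nat) (w : 'M[R]_(d, k))
    (x : 'rV[R]_d) (c : 'I_k) : R :=
  (c \notin argmaxs (x *m w))%:R.

Definition onehot (R : realType) (N k : nat) (c : 'I_N -> 'I_k) : 'M[R]_(N, k) :=
  \matrix_(i < N, j < k) (j == c i)%:R.
Arguments onehot {R N k}.

Definition datamx (R : realType) (N d : nat) (x : 'I_N -> 'rV[R]_d) : 'M[R]_(N, d) :=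
  \matrix_(i < N, j < d) x i 0 j.

(* Combined training set: indices < n are the clean points S, the others
   the randomly labeled points S~. *)
Definition sfeat (R : realType) (Z Om : Type) (n m d : nat) (feat : Z -> 'rV[R]_d)
    (ZS : 'I_n -> Om -> Z) (ZT : 'I_m -> Om -> Z) (i : 'I_(n + m)) (om : Om) : 'rV[R]_d :=
  match fintype.split i with inl a => feat (ZS a om) | inr b => feat (ZT b om) end.

Definition slab (Z Om : Type) (n m k : nat) (lab : Z -> 'I_k)
    (ZS : 'I_n -> Om -> Z) (U : 'I_m -> Om -> 'I_k) (i : 'I_(n + m)) (om : Om) : 'I_k :=
  match fintype.split i with inl a => lab (ZS a om) | inr b => U b om end.

Definition What (R : realType) (Z Om : Type) (n m d k : nat) (lam : R)
    (feat : Z -> 'rV[R]_d) (lab : Z -> 'I_k)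
    (ZS : 'I_n -> Om -> Z) (ZT : 'I_m -> Om -> Z) (U : 'I_m -> Om -> 'I_k)
    (om : Om) : 'M[R]_(d, k) :=
  trainW lam (datamx (fun i => sfeat feat ZS ZT i om))
             (onehot (fun i => slab lab ZS U i om)).

Definition Wloo (R : realType) (Z Om : Type) (n m d k : nat) (lam : R)
    (feat : Z -> 'rV[R]_d) (lab : Z -> 'I_k)
    (ZS : 'I_n -> Om -> Z) (ZT : 'I_m -> Om -> Z) (U : 'I_m -> Om -> 'I_k)
    (i : 'I_(n + m)) (om : Om) : 'M[R]_(d, k) :=
  trainW lam (row' i (datamx (fun i => sfeat feat ZS ZT i om)))
             (row' i (onehot (fun i => slab lab ZS U i om))).

Definition errS (R : realType) (Z Om : Type) (n d k : nat) (w : 'M[R]_(d, k))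
    (feat : Z -> 'rV[R]_d) (lab : Z -> 'I_k) (ZS : 'I_n -> Om -> Z) (om : Om) : R :=
  n%:R^-1 * \sum_(a < n) err01 w (feat (ZS a om)) (lab (ZS a om)).

Definition errT (R : realType) (Z Om : Type) (m d k : nat) (w : 'M[R]_(d, k))
    (feat : Z -> 'rV[R]_d) (ZT : 'I_m -> Om -> Z) (U : 'I_m -> Om -> 'I_k) (om : Om) : R :=
  m%:R^-1 * \sum_(b < m) err01 w (feat (ZT b om)) (U b om).

(* Main.v *)
Require Import Defs.
From HB Require Import structures.
From mathcomp Require Import all_boot all_order all_algebra.
From mathcomp Require Import fingroup perm.
From mathcomp Require Import all_classical all_reals all_analysis.
From mathcomp Require Import measurable_realfun ring lra.
Set Implicit Arguments. Unset Strict Implicit. Unset Printing Implicit Defensive.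
Import Order.TTheory GRing.Theory Num.Theory.
Import numFieldNormedType.Exports.
Local Open Scope classical_set_scope.
Local Open Scope ring_scope.

(* Let t, u be the true and the random label of a random point, f the trained
   predictor, f_b the predictor trained without the random point b, and
   K0 = k / (k - 1). With the sampling fluctuation
     T1 = (1/n) #{clean points f gets right} - (k/m) #{b : u = t, f right on b},
   the quantity E_D - E_S + k E_S~ - (k - 1) is T1 + E_D minus (k/m) times the number
   of random points with u <> t on which f predicts u. Putting b back with a
   wrong label u only moves the scores of b towards u, so a point with u <> t
   that f_b misclassifies is either predicted u by f, or predicted neither u
   nor t. Hence the quantity is at most T1 + T3 + (K0/m) X with
     T3 = E_D - (1/m) sum_b K0 [u <> t] [f_b wrong on b]
     X  = #{u <> t, neither u nor t predicted} - (k - 2) #{u <> t, u predicted}.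
   - X has a Gaussian tail with the points fixed and the labels u uniform: for
     each pair of classes a deletion code, injective by the
     monotonicity of the least-squares smoother in the labels, bounds the
     moment generating function of the contribution of the pair; Jensen's
     inequality averages over the pairs.
   - T3 has a small second moment by hypothesis stability (two fresh points
     are exchanged with the left-out ones), and T1 because, once the offsets
     u - t are fixed, the clean points and the random points with u = t are
     exchangeable. *)

(** * The ridge learner and leave-one-out *)

(** The predictor depends on every random label, and changing one label can flip the predictions at
    many points, so a bounded-difference argument gives no useful tail for X. Independence is
    replaced by positivity: the change of scores between two labelings, paired with the change of
    labels, is nonnegative. The weight K0 is 1 / P(u <> t), so K0 [u <> t] has mean one. The factor
    k - 2 in X is chosen so that k - K0 (k - 2) = K0; it is also the number of pairs {u, j} with j
    outside {u, t}, which is why X splits over pairs of classes. Offsets are taken modulo k: u - t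
    is uniform and independent of the points, and a fresh point carrying a formal offset can take
    the place of a random one. The tail of X can exceed the logarithmic term of the bound when k >=
    3. The surplus is paid from the room that Chebyshev's inequality leaves under the last square
    root, through delta ln (4 / delta) <= 3/2. *)

Lemma rV_sqr_ge0 (R : realType) (p : nat) (v : 'rV[R]_p) : 0 <= (v *m v^T) 0 0.
Proof. by rewrite mxE; apply: sumr_ge0 => i _; rewrite mxE -expr2 sqr_ge0. Qed.

Lemma rV_sqr_eq0 (R : realType) (p : nat) (v : 'rV[R]_p) :
  (v *m v^T) 0 0 = 0 -> v = 0.
Proof.
rewrite mxE => /eqP; rewrite psumr_eq0; last first.
  by move=> i _; rewrite mxE -expr2 sqr_ge0.
move=> /allP h; apply/rowP => i; rewrite mxE.
have := h i (mem_index_enum i).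
by rewrite /= mxE -expr2 sqrf_eq0 => /eqP.
Qed.

Lemma gram_unitmx (R : realType) (r p : nat) (M : 'M[R]_(r, p)) :
  row_free M -> M *m M^T \in unitmx.
Proof.
move=> Mfree; rewrite -row_free_unit -kermx_eq0; apply/eqP/row_matrixP => i.
rewrite row0; set u := row i _.
have uK : u *m (M *m M^T) = 0.
  by rewrite -row_mul mulmx_ker row0.
have : u *m M = 0.
  apply: rV_sqr_eq0; rewrite trmx_mul mulmxA -(mulmxA u) uK mul0mx mxE //.
by move=> uM; apply: (row_free_inj Mfree); rewrite uM mul0mx.
Qed.

(** Full-rank factorization: for A = C Q with C of full column rank and Q of full row rank, the
    pseudo-inverse has this closed form. *)
Lemma penrose_factor (R : realType) (p r : nat) (C : 'M[R]_(p, r)) (Q : 'M[R]_(r, p)) :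
  C^T *m C \in unitmx -> Q *m Q^T \in unitmx ->
  penrose (C *m Q) (Q^T *m invmx (Q *m Q^T) *m (invmx (C^T *m C) *m C^T)).
Proof.
move=> uC uQ; set B := _ *m (_ *m C^T).
have AB : C *m Q *m B = C *m invmx (C^T *m C) *m C^T.
  by rewrite /B -!mulmxA (mulmxA Q) (mulmxA (Q *m Q^T)) mulmxV // mul1mx.
have BA : B *m (C *m Q) = Q^T *m invmx (Q *m Q^T) *m Q.
  by rewrite /B -!mulmxA (mulmxA C^T) (mulmxA (invmx (C^T *m C))) mulVmx // mul1mx.
split.
- by rewrite AB -!mulmxA (mulmxA C^T) (mulmxA (invmx (C^T *m C))) mulVmx // mul1mx.
- by rewrite BA /B -!mulmxA (mulmxA Q) (mulmxA (Q *m Q^T)) mulmxV // mul1mx.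
- by rewrite AB !trmx_mul trmxK trmx_inv trmx_mul trmxK mulmxA.
- by rewrite BA !trmx_mul trmxK trmx_inv trmx_mul trmxK mulmxA.
Qed.

Lemma penrose_exists (R : realType) (p : nat) (A : 'M[R]_p) :
  exists B, penrose A B.
Proof.
have uQ : row_base A *m (row_base A)^T \in unitmx.
  by apply: gram_unitmx; exact: row_base_free.
have uC : (col_base A)^T *m col_base A \in unitmx.
  rewrite -{2}[col_base A]trmxK; apply: gram_unitmx.
  by rewrite /row_free mxrank_tr; exact: col_base_full.
by have := penrose_factor uC uQ; rewrite mulmx_base => h; eexists; exact: h.
Qed.

Lemma pinvP (R : realType) (p : nat) (A : 'M[R]_p) : penrose A (Defs.pinv A).
Proof. by apply: (@xgetPex _ 0 (fun B => penrose A B)); exact: penrose_exists. Qed.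

Lemma penrose_uniq (R : realType) (p : nat) (A B C : 'M[R]_p) :
  penrose A B -> penrose A C -> B = C.
Proof.
move=> [b1 b2 b3 b4] [c1 c2 c3 c4].
have e1 : A *m B = A *m C.
  have h : A *m C *m (A *m B) = A *m B by rewrite mulmxA c1.
  by rewrite -b3 -h trmx_mul b3 c3 mulmxA b1.
have e2 : B *m A = C *m A.
  have h : B *m A *m (C *m A) = B *m A by rewrite -mulmxA (mulmxA A) c1.
  by rewrite -b4 -h trmx_mul b4 c4 -mulmxA (mulmxA A) b1.
by rewrite -b2 e2 -mulmxA e1 mulmxA c2.
Qed.

Lemma pinv_sym (R : realType) (p : nat) (A : 'M[R]_p) :
  A^T = A -> (Defs.pinv A)^T = Defs.pinv A.
Proof.
move=> As; have [b1 b2 b3 b4] := pinvP A; set B := Defs.pinv A in b1 b2 b3 b4 *.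
apply: (@penrose_uniq _ _ A); last by exact: pinvP.
have e1 : A *m B^T = B *m A by rewrite -{1}As -trmx_mul b4.
have e2 : B^T *m A = A *m B by rewrite -{1}As -trmx_mul b3.
split.
- by have /(congr1 trmx) := b1; rewrite !trmx_mul As mulmxA.
- by have /(congr1 trmx) := b2; rewrite !trmx_mul As mulmxA.
- by rewrite e1 b4.
- by rewrite e2 b3.
Qed.

Section Learner.
Variables (R : realType) (d k : nat) (lam : R) (T : finType).
Hypothesis lam_ge0 : 0 <= lam.
Implicit Types (x : T -> 'rV[R]_d) (c : T -> 'I_k) (S : {set T}).

Definition gram x S : 'M[R]_d := \sum_(i in S) (x i)^T *m x i.

Definition corr x c S : 'M[R]_(d, k) := \sum_(i in S) (x i)^T *m delta_mx 0 (c i).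

Definition rgram x S : 'M[R]_d := gram x S + lam%:M.

Definition learn x c S : 'M[R]_(d, k) := Defs.pinv (rgram x S) *m corr x c S.

Definition score x c S j : 'rV[R]_k := x j *m learn x c S.

Lemma rgram_sym x S : (rgram x S)^T = rgram x S.
Proof.
rewrite /rgram linearD /= tr_scalar_mx; congr (_ + _).
rewrite /gram linear_sum /=.
by apply: eq_bigr => i _; rewrite trmx_mul trmxK.
Qed.

Lemma rgramE x S (v : 'rV[R]_d) : (v *m rgram x S *m v^T) 0 0 =
  \sum_(i in S) ((x i *m v^T) 0 0) ^+ 2 + lam * (v *m v^T) 0 0.
Proof.
rewrite /rgram mulmxDr mulmxDl mxE; congr (_ + _); last first.
  by rewrite mul_mx_scalar -scalemxAl mxE.
rewrite /gram mulmx_sumr mulmx_suml summxE; apply: eq_bigr => i _.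
rewrite mulmxA -mulmxA mxE big_ord1 expr2; congr (_ * _).
rewrite -[v *m _]trmxK trmx_mul trmxK mxE //.
Qed.

Lemma rgram_ge0 x S (v : 'rV[R]_d) : 0 <= (v *m rgram x S *m v^T) 0 0.
Proof.
rewrite rgramE addr_ge0 //; first by apply: sumr_ge0 => i _; exact: sqr_ge0.
by rewrite mulr_ge0 // rV_sqr_ge0.
Qed.

(** The quadratic form of [rgramE] vanishes at [v], so each of its nonnegative terms does. *)
Lemma rgram_ker x S (v : 'rV[R]_d) i :
  v *m rgram x S = 0 -> i \in S -> x i *m v^T = 0.
Proof.
move=> v0 iS; have := rgramE x S v; rewrite v0 mul0mx mxE => /esym/eqP.
rewrite paddr_eq0 ?mulr_ge0 ?rV_sqr_ge0 //; last first.
  by apply: sumr_ge0 => j _; exact: sqr_ge0.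
case/andP; rewrite psumr_eq0 => [|j _]; last exact: sqr_ge0.
move=> /allP h _; apply/matrixP => a b; rewrite !ord1 [RHS]mxE.
by have := h i (mem_index_enum i); rewrite iS /= sqrf_eq0 => /eqP.
Qed.

Lemma rgram_comm x S :
  Defs.pinv (rgram x S) *m rgram x S = rgram x S *m Defs.pinv (rgram x S).
Proof.
have [_ _ b3 _] := pinvP (rgram x S).
by rewrite -b3 trmx_mul pinv_sym rgram_sym.
Qed.

(** Each training point lies in the row space of the regularized Gram matrix, on which the
    pseudo-inverse is a true inverse. The rows of A A^+ - 1 lie in the kernel of A, so they are
    orthogonal to the point. *)
Lemma rgram_proj x S i : i \in S ->
  x i *m Defs.pinv (rgram x S) *m rgram x S = x i.
Proof.
move=> iS; have [b1 _ b3 _] := pinvP (rgram x S).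
set M := rgram x S *m Defs.pinv (rgram x S) - 1%:M.
have MA : M *m rgram x S = 0 by rewrite mulmxBl b1 mul1mx subrr.
have MT : M^T = M by rewrite /M linearB /= b3 tr_scalar_mx.
suff xM : x i *m M^T = 0.
  apply/eqP; rewrite -subr_eq0 -mulmxA rgram_comm.
  by rewrite -{2}[x i]mulmx1 -mulmxBr -/M -MT xM.
apply: trmx_inj; rewrite trmx_mul trmxK trmx0.
apply/row_matrixP => j; rewrite row_mul row0.
apply: trmx_inj; rewrite trmx_mul trmxK trmx0.
by apply: (@rgram_ker x S) => //; rewrite -row_mul MA row0.
Qed.

(** Normal equations; by [rgram_proj] they survive [lam = 0] with a singular Gram matrix. *)
Lemma rgram_learn x c S : rgram x S *m learn x c S = corr x c S.
Proof.
rewrite /learn mulmxA /corr mulmx_sumr; apply: eq_bigr => i iS.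
rewrite mulmxA; congr (_ *m _); apply: trmx_inj.
by rewrite !trmx_mul trmxK pinv_sym ?rgram_sym // mulmxA rgram_proj.
Qed.

Lemma pinv_ge0 x S (v : 'rV[R]_d) : 0 <= (v *m Defs.pinv (rgram x S) *m v^T) 0 0.
Proof.
have [_ b2 _ _] := pinvP (rgram x S).
have := rgram_ge0 x S (v *m Defs.pinv (rgram x S)).
by rewrite trmx_mul pinv_sym ?rgram_sym // !mulmxA -(mulmxA v) -(mulmxA v) b2.
Qed.

Lemma corrE x c S r a : corr x c S r a = \sum_(i in S) x i 0 r * (a == c i)%:R.
Proof.
rewrite /corr summxE; apply: eq_bigr => i _.
by rewrite mxE big_ord1 !mxE eqxx /=.
Qed.

Lemma scoreE x c S j a : score x c S j 0 a =
  \sum_(i in S) (x j *m Defs.pinv (rgram x S) *m (x i)^T) 0 0 * (a == c i)%:R.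
Proof.
rewrite /score /learn mulmxA /corr mulmx_sumr summxE; apply: eq_bigr => i _.
by rewrite mulmxA mxE big_ord1 !mxE eqxx.
Qed.

(* Positive semidefiniteness of the smoothing matrix, tested on the difference
   of two labelings. *)
Lemma score_monotone x c c' S :
  0 <= \sum_(i in S) ((score x c S i 0 (c i) - score x c S i 0 (c' i))
                     - (score x c' S i 0 (c i) - score x c' S i 0 (c' i))).
Proof.
pose D := corr x c S - corr x c' S; pose B := Defs.pinv (rgram x S).
have -> : \sum_(i in S) ((score x c S i 0 (c i) - score x c S i 0 (c' i))
    - (score x c' S i 0 (c i) - score x c' S i 0 (c' i))) =
  \sum_a ((col a D)^T *m B *m ((col a D)^T)^T) 0 0.
  pose g i a : R := (x i *m B *m D) 0 a * ((a == c i)%:R - (a == c' i)%:R).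
  transitivity (\sum_(i in S) \sum_a g i a).
    apply: eq_bigr => i _.
    have e a b : \sum_a0 (x i *m B *m D) 0 a0 * ((a0 == a)%:R - (a0 == b)%:R)
      = (x i *m B *m D) 0 a - (x i *m B *m D) 0 b.
      rewrite -(eq_bigr _ (fun a0 _ => esym (mulrBr _ _ _))) sumrB.
      have e1 q : \sum_a0 (x i *m B *m D) 0 a0 * (a0 == q)%:R = (x i *m B *m D) 0 q.
        rewrite (bigD1 q) //= eqxx mulr1 big1 ?addr0 // => l /negbTE ->.
        by rewrite mulr0.
      by rewrite !e1.
    rewrite /g e /D mulmxBr /score /learn !mulmxA !mxE.
    ring.
  rewrite exchange_big /=; apply: eq_bigr => a _.
  rewrite trmxK.
  have -> : (col a D)^T *m B *m col a D = ((col a D)^T *m (B *m D)) *m delta_mx a 0.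
    by rewrite -!mulmxA; congr (_ *m (_ *m _)); rewrite colE.
  rewrite -colE mxE [RHS]mxE.
  under [RHS]eq_bigr => r _ do rewrite 2!mxE /D !mxE !corrE -sumrB mulr_suml.
  rewrite exchange_big /=; apply: eq_bigr => i _.
  rewrite /g -mulmxA mxE mulr_suml; apply: eq_bigr => r _.
  by rewrite -mulrBr mxE mulrAC.
by apply: sumr_ge0 => a _; exact: pinv_ge0.
Qed.

Lemma rgramD1 x S i : i \in S ->
  rgram x S = (x i)^T *m x i + rgram x (S :\ i).
Proof. by move=> iS; rewrite /rgram /gram (big_setD1 i) //= addrA. Qed.

(** Leave-one-out identity of least squares: [h] is the leverage of point [i], the diagonal entry of
    the smoothing matrix. *)
Lemma score_loo x c S i : i \in S -> exists2 h : R, 0 <= h <= 1 &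
  forall a, score x c S i 0 a =
    (1 - h) * score x c (S :\ i) i 0 a + h * (a == c i)%:R.
Proof.
move=> iS; pose B := Defs.pinv (rgram x S).
pose h := (x i *m B *m (x i)^T) 0 0.
have h0 : 0 <= h by exact: pinv_ge0.
(* B A B = B writes [h] as the quadratic form of A at x_i B, one term of which is h ^ 2. *)
have hh : h ^+ 2 <= h.
  have [_ b2 _ _] := pinvP (rgram x S).
  have := rgramE x S (x i *m B).
  have -> : x i *m B *m rgram x S *m (x i *m B)^T = x i *m B *m (x i)^T.
    by rewrite trmx_mul pinv_sym ?rgram_sym // !mulmxA -(mulmxA (x i)) -(mulmxA (x i)) b2.
  rewrite -/h (bigD1 i) //= => {2}->.
  have -> : (x i *m (x i *m B)^T) 0 0 = h.
    by rewrite /h -[x i *m _]trmxK trmx_mul trmxK mxE.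
  rewrite -addrA lerDl addr_ge0 //; first by apply: sumr_ge0 => j _; exact: sqr_ge0.
  by rewrite mulr_ge0 // rV_sqr_ge0.
exists h.
  rewrite h0 /= leNgt; apply/negP => h1; have := hh.
  by rewrite leNgt expr2 ltr_pMr ?h1 // (lt_trans _ h1).
move=> a.
(* Difference of the normal equations with and without [i]; multiplying by x_i B then isolates the
   two scores. *)
have e : rgram x S *m (learn x c S - learn x c (S :\ i)) =
    (x i)^T *m (delta_mx 0 (c i) - x i *m learn x c (S :\ i)).
  rewrite mulmxBr rgram_learn (rgramD1 _ iS) mulmxDl rgram_learn.
  by rewrite {1}/corr (big_setD1 i) //= -/(corr x c _) mulmxBr -[_ *m x i *m _]mulmxA
    opprD addrACA subrr addr0.
have := congr1 (mulmx (x i *m B)) e.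
rewrite mulmxA rgram_proj // mulmxA.
move=> /matrixP /(_ 0 a); rewrite mulmxBr -/(score x c S i) -/(score x c _ i).
rewrite [LHS]mxE [X in _ + X = _]mxE [RHS]mxE big_ord1 -/h => eqF.
rewrite -[LHS](subrK (score x c (S :\ i) i 0 a)) eqF.
by rewrite mxE [X in h * X]addrC !mxE eqxx /= ord1; ring.
Qed.

(* A label losing to another one on the left-out example keeps losing when the
   example is put back with a different label. *)
Lemma argmaxs_loo x c S i t : i \in S -> t != c i ->
  t \notin argmaxs (score x c (S :\ i) i) -> t \notin argmaxs (score x c S i).
Proof.
move=> iS tc; rewrite !inE !negb_forall => /existsP[a]; rewrite -ltNge => ta.
have [h /andP[h0 h1] hE] := score_loo x c iS.
(* At leverage 1 the score is the one-hot label itself, so [c i] beats [t]. Otherwise the label that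
   beat [t] before still does, as its score is scaled by 1 - h > 0 and can only gain. *)
move: h1; rewrite le_eqVlt => /orP[/eqP h1|h1].
  apply/existsP; exists (c i); rewrite -ltNge !hE h1 subrr !mul0r !add0r !mul1r.
  by rewrite eqxx (negbTE tc) ltr01.
apply/existsP; exists a; rewrite -ltNge !hE (negbTE tc) mulr0 addr0.
by rewrite ltr_wpDr ?mulr_ge0 // ltr_pM2l // subr_gt0.
Qed.

End Learner.

Lemma learn_inj (R : realType) (d k : nat) (lam : R) (T T' : finType) (s : T' -> T)
    (x : T -> 'rV[R]_d) (c : T -> 'I_k) (S : {set T'}) : injective s ->
  learn lam (x \o s) (c \o s) S = learn lam x c (s @: S)%SET.
Proof.
move=> sI; have H (V : nmodType) (F : T -> V) :
    \sum_(i in (s @: S)%SET) F i = \sum_(i in S) F (s i).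
  by rewrite big_imset //= => a b _ _; exact: sI.
by rewrite /learn /rgram /gram /corr !H.
Qed.

Lemma eq_learn (R : realType) (d k : nat) (lam : R) (T : finType)
    (x x' : T -> 'rV[R]_d) (c c' : T -> 'I_k) (S : {set T}) :
  {in S, x =1 x'} -> {in S, c =1 c'} -> learn lam x c S = learn lam x' c' S.
Proof.
move=> hx hc; rewrite /learn /rgram.
have -> : gram x S = gram x' S by apply: eq_bigr => i iS; rewrite hx.
by have -> : corr x c S = corr x' c' S by apply: eq_bigr => i iS; rewrite hx // hc.
Qed.

Lemma learn_trainW (R : realType) (d k N : nat) (lam : R)
    (x : 'I_N -> 'rV[R]_d) (c : 'I_N -> 'I_k) :
  trainW lam (datamx x) (onehot c) = learn lam x c [set: 'I_N]%SET.
Proof.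
rewrite /trainW /learn /rgram.
have -> : (datamx x)^T *m datamx x = gram x [set: 'I_N]%SET.
  apply/matrixP => a b; rewrite mxE summxE; apply: eq_big => [i|i _].
    by rewrite inE.
  by rewrite [RHS]mxE big_ord1 !mxE.
have -> // : (datamx x)^T *m onehot c = corr x c [set: 'I_N]%SET.
apply/matrixP => a b; rewrite mxE corrE; apply: eq_big => [i|i _].
  by rewrite inE.
by rewrite !mxE.
Qed.

Lemma learn_trainW_row' (R : realType) (d k N : nat) (lam : R)
    (x : 'I_N -> 'rV[R]_d) (c : 'I_N -> 'I_k) (i : 'I_N) :
  trainW lam (row' i (datamx x)) (row' i (onehot c)) = learn lam x c [set~ i]%SET.
Proof.
have H (F : 'I_N -> R) : \sum_(j < N.-1) F (lift i j) = \sum_(j in [set~ i]%SET) F j.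
  rewrite [RHS](reindex_omap (lift i) (unlift i)) /=.
    by apply: eq_bigl => j; rewrite liftK eqxx !inE eq_sym neq_lift.
  by move=> j; rewrite !inE; case: unliftP => [l ->|->] //; rewrite eqxx.
rewrite /trainW /learn /rgram.
have -> : (row' i (datamx x))^T *m row' i (datamx x) = gram x [set~ i]%SET.
  apply/matrixP => a b; rewrite mxE summxE -H; apply: eq_bigr => j _.
  by rewrite [RHS]mxE big_ord1 !mxE.
have -> // : (row' i (datamx x))^T *m row' i (onehot c) = corr x c [set~ i]%SET.
apply/matrixP => a b; rewrite mxE corrE -H; apply: eq_bigr => j _.
by rewrite !mxE.
Qed.

(** * Gaussian bound on the hyperbolic cosine *)

Lemma derive_ge0_ge0 (R : realType) (f df : R -> R) :
  (forall x : R, is_derive x 1 f (df x)) -> (forall x, 0 <= x -> 0 <= df x) ->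
  f 0 = 0 -> forall x, 0 <= x -> 0 <= f x.
Proof.
move=> fd df0 f0 x; rewrite le_eqVlt => /predU1P[<-|x0]; first by rewrite f0.
have [c] : exists2 c, c \in `]0, x[ & f x - f 0 = df c * (x - 0).
  apply: MVT => // z; apply: continuous_subspaceT => y.
  by apply: differentiable_continuous; apply/derivable1_diffP.
rewrite in_itv /= f0 !subr0 => /andP[c0 _] ->.
by rewrite mulr_ge0 ?df0 ?ltW.
Qed.

(** Two rounds of monotonicity from 0: [g] has derivative exp(-x^2/2) [psi], and [psi] has
    derivative x (exp x - exp(-x)). *)
Lemma coshR_le (R : realType) (x : R) : 0 <= x ->
  expR x + expR (- x) <= 2 * expR (x ^+ 2 / 2).
Proof.
pose psi (x : R) := (1 + x) * expR (- x) - (1 - x) * expR x.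
have psi_ge0 : forall y, 0 <= y -> 0 <= psi y.
  apply: (@derive_ge0_ge0 _ _ (fun y => y * (expR y - expR (- y)))).
  - move=> y.
    have -> : psi = ((cst 1 + id) * (expR \o -%R) - (cst 1 - id) * expR)%R by [].
    apply: is_derive_eq; rewrite /GRing.scale /= ?fctE /=; ring.
  - by move=> y y0; rewrite mulr_ge0 // subr_ge0 ler_expR; lra.
  - by rewrite /psi oppr0 expR0; ring.
pose g (x : R) := 2 - expR (- (x ^+ 2 / 2)) * (expR x + expR (- x)).
have g_ge0 : forall y, 0 <= y -> 0 <= g y.
  apply: (@derive_ge0_ge0 _ _ (fun y => expR (- (y ^+ 2 / 2)) * psi y)).
  - move=> y.
    have -> : g = (cst 2 - (expR \o -%R \o (2^-1 \*: (fun x => x ^+ 2))) * (expR + (expR \o -%R))).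
      by apply/funext => z; rewrite /g !fctE /= [_ / 2]mulrC.
    apply: is_derive_eq; rewrite /GRing.scale /= ?fctE /=.
    have -> : 2^-1 *: y ^+ 2 = y ^+ 2 / 2 :> R by rewrite mulrC.
    by rewrite /psi; field.
  - by move=> y y0; rewrite mulr_ge0 ?psi_ge0 ?expR_ge0.
  - by rewrite /g oppr0 expR0 expr0n /= mul0r oppr0 expR0; ring.
move=> x0; have := g_ge0 _ x0; rewrite /g subr_ge0 expRN.
by rewrite mulrC ler_pdivrMr ?expR_gt0.
Qed.

(** * Counting labelings with a large excess *)

Lemma in_argmaxs (R : realType) (k : nat) (s : 'rV[R]_k) (j : 'I_k) :
  reflect (forall l, s 0 l <= s 0 j) (j \in argmaxs s).
Proof. by rewrite inE; exact: forallP. Qed.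

Lemma notin_argmaxs (R : realType) (k : nat) (s : 'rV[R]_k) (j : 'I_k) :
  reflect (exists l, s 0 j < s 0 l) (j \notin argmaxs s).
Proof.
rewrite inE negb_forall; apply: (iffP existsP) => -[l h]; exists l.
  by rewrite ltNge.
by rewrite -ltNge.
Qed.

(** If [o] beats [i] in [s], the gap changes sign. If a third label [a] does, its score is common to
    both vectors, so the score of [i] must rise and, the sum being fixed, that of [o] must fall. *)
Lemma argmaxs_pair_lt (R : realType) (k : nat) (s s' : 'rV[R]_k) (i o : 'I_k) :
  s 0 i + s 0 o = s' 0 i + s' 0 o ->
  (forall a, a != i -> a != o -> s 0 a = s' 0 a) ->
  i \notin argmaxs s -> i \in argmaxs s' -> o \notin argmaxs s' ->
  s 0 i - s 0 o < s' 0 i - s' 0 o.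
Proof.
move=> sE aE /notin_argmaxs[a ia] /in_argmaxs im /notin_argmaxs[l ol].
have oi : s' 0 o < s' 0 i by rewrite (lt_le_trans ol).
have [ao|ao] := eqVneq a o; first by rewrite ao in ia; lra.
have ai : a != i by apply/eqP => ai; rewrite ai ltxx in ia.
by have := im a; rewrite -aE //; lra.
Qed.

Lemma mem_pair_sum (R : realType) (k : nat) (f : 'I_k -> R) (a c i o : 'I_k) :
  i != o -> i \in [:: a; c] -> o \in [:: a; c] -> f i + f o = f a + f c.
Proof.
rewrite !inE => io /orP[]/eqP ei /orP[]/eqP eo; rewrite ei eo in io *;
  by rewrite ?eqxx // in io; rewrite addrC.
Qed.

Lemma mem_pair_or (T : eqType) (a c i o l : T) :
  i != o -> i \in [:: a; c] -> o \in [:: a; c] -> l \in [:: a; c] ->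
  (l == i) || (l == o).
Proof.
by rewrite !inE => io /orP[]/eqP ei /orP[]/eqP eo /orP[]/eqP ->;
  rewrite ei eo ?eqxx ?orbT // in io *; rewrite eqxx in io.
Qed.

Lemma argmaxs_neq0 (R : realType) (k : nat) (s : 'rV[R]_k) (i : 'I_k) :
  exists a, a \in argmaxs s.
Proof.
case: (@arg_maxP _ R _ i predT (fun j => s 0 j) isT) => a _ h.
by exists a; apply/in_argmaxs => l; exact: h.
Qed.

Lemma jensen_expR (R : realType) (I : finType) (P : pred I) (a : I -> R) :
  (0 < #|P|)%N ->
  #|P|%:R * expR ((\sum_(i | P i) a i) / #|P|%:R) <= \sum_(i | P i) expR (a i).
Proof.
move=> P0; have P0' : 0 < #|P|%:R :> R by rewrite ltr0n.
set avg := _ / _.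
have -> : #|P|%:R * expR avg = \sum_(i | P i) expR avg * (1 + (a i - avg)).
  rewrite -mulr_sumr big_split /= sumrB !sumr_const -[avg *+ _]mulr_natr.
  by rewrite /avg divfK ?gt_eqF // subrr addr0 mulrC.
apply: ler_sum => i _.
have -> : expR (a i) = expR avg * expR (a i - avg) by rewrite -expRD addrC subrK.
by rewrite ler_pM2l ?expR_gt0 // expR_ge1Dx.
Qed.

Section Counting.
Variables (R : realType) (k : nat) (J : finType).
Variables (F : {ffun J -> 'I_k} -> J -> 'rV[R]_k) (t : J -> 'I_k).
Implicit Types (u : {ffun J -> 'I_k}) (b : J) (p : 'I_k * 'I_k).
(** Three traits of a linear smoother applied to one-hot labels: its matrix is positive
    semidefinite, the scores of a class depend only on which points carry that class, and the summed
    scores of two classes depend only on which points carry either of them. *)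
Hypothesis F_mono : forall u v : {ffun J -> 'I_k},
  0 <= \sum_b ((F u b 0 (u b) - F u b 0 (v b)) - (F v b 0 (u b) - F v b 0 (v b))).
Hypothesis F_class : forall (u v : {ffun J -> 'I_k}) a, (forall b, (u b == a) = (v b == a)) ->
  forall b, F u b 0 a = F v b 0 a.
Hypothesis F_pair : forall (u v : {ffun J -> 'I_k}) a c, a != c ->
  (forall b, (u b \in [:: a; c]) = (v b \in [:: a; c])) ->
  forall b, F u b 0 a + F u b 0 c = F v b 0 a + F v b 0 c.

Let right u b a := a \in argmaxs (F u b).

Definition active p u b := (u b \in [:: p.1; p.2]) && (t b \notin [:: p.1; p.2]).

(* The values a deleted label [u b] may leave behind: itself when it is
   misclassified, and the other label of the pair when that one wins. *)
Definition mark p u b i :=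
  if active p u b then
    [&& i \in [:: p.1; p.2], ~~ right u b (u b) & (i == u b) || right u b i]
  else i == u b.

Lemma mark_pair p u b i : mark p u b i ->
  (u b \in [:: p.1; p.2]) = (i \in [:: p.1; p.2]).
Proof.
rewrite /mark; case: ifP => [/andP[-> _] /and3P[-> //]|_ /eqP -> //].
Qed.

(** [v] is a code word for [u]: the boolean says whether the label at [b] was deleted, the first
    component is what is read there. *)
Definition compat p u (v : {ffun J -> 'I_k * bool}) :=
  [forall b, if (v b).2 then mark p u b (v b).1 else (v b).1 == u b].

(** Two labelings with a common code word differ only at deleted active points, and there only
    within the pair. Scores of other classes and pair sums therefore agree, [argmaxs_pair_lt] makes
    every differing point contribute negatively, and [F_mono] is violated unless there is none. *)
Lemma compat_inj p u u' v : p.1 != p.2 -> compat p u v -> compat p u' v -> u = u'.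
Proof.
move=> p12 /forallP h /forallP h'.
have hp b : (u b \in [:: p.1; p.2]) = (u' b \in [:: p.1; p.2]).
  have := h b; have := h' b; case: ifP => _ hb' hb.
    by rewrite (mark_pair hb) (mark_pair hb').
  by rewrite -(eqP hb) -(eqP hb').
have hact b : active p u b = active p u' b by rewrite /active hp.
have hdiff b : u b != u' b -> [&& (v b).2, active p u b & active p u' b].
  move=> ne; have := h b; have := h' b; case: ifP => _ hb' hb /=.
    case A : (active p u b) hb hb'; rewrite -hact A // /mark -hact A.
    by move=> /eqP hb /eqP hb'; rewrite -hb -hb' eqxx in ne.
  by rewrite -(eqP hb) -(eqP hb') eqxx in ne.
have hout a : a \notin [:: p.1; p.2] -> forall b, F u b 0 a = F u' b 0 a.
  move=> ap; apply: F_class => b; have [->//|ne] := eqVneq (u b) (u' b).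
  have /and3P[_ /andP[i1 _] /andP[i2 _]] := hdiff _ ne.
  by apply/eqP/eqP => e; move: ap; rewrite -e ?i1 ?i2.
have hsum := F_pair p12 hp.
have neg b : u b != u' b ->
   (F u b 0 (u b) - F u b 0 (u' b)) - (F u' b 0 (u b) - F u' b 0 (u' b)) < 0.
  move=> ne; have /and3P[vb2 A A'] := hdiff _ ne.
  have := h b; have := h' b; rewrite vb2 /mark A A'.
  set i := (v b).1 => /and3P[ip w' hi'] /and3P[_ w hi].
  have [ui u'i] : u b \in [:: p.1; p.2] /\ u' b \in [:: p.1; p.2].
    by case/andP: A; case/andP: A'.
  have hs : F u b 0 (u b) + F u b 0 (u' b) = F u' b 0 (u b) + F u' b 0 (u' b).
    by rewrite !(mem_pair_sum _ ne ui u'i) hsum.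
  have ho a : a != u b -> a != u' b -> F u b 0 a = F u' b 0 a.
    move=> au au'; apply: hout; apply/negP => ap.
    by have := mem_pair_or ne ui u'i ap; rewrite (negbTE au) (negbTE au').
  (* The value left behind is the label of one of the two labelings, so it wins under the other one,
     whose own label is wrong. *)
  have [iu|iu'] := orP (mem_pair_or ne ui u'i ip).
    move: hi'; rewrite (eqP iu) (negbTE ne) /= => hi'.
    by have := argmaxs_pair_lt hs ho w hi' w'; lra.
  move: hi; rewrite (eqP iu') eq_sym (negbTE ne) /= => hi.
  have hs' : F u' b 0 (u' b) + F u' b 0 (u b) = F u b 0 (u' b) + F u b 0 (u b).
    by rewrite addrC -hs addrC.
  have := argmaxs_pair_lt hs' _ w' hi w => H.
  suff : F u' b 0 (u' b) - F u' b 0 (u b) < F u b 0 (u' b) - F u b 0 (u b) by lra.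
  by apply: H => a au' au; rewrite ho.
apply/ffunP => b0; apply/eqP/negPn/negP => ne0.
have := F_mono u u'; rewrite leNgt => /negP; apply.
rewrite (bigD1 b0) //=.
have : \sum_(b | b != b0) ((F u b 0 (u b) - F u b 0 (u' b)) -
    (F u' b 0 (u b) - F u' b 0 (u' b))) <= 0.
  apply: sumr_le0 => b _; have [->|ne] := eqVneq (u b) (u' b); first by lra.
  exact/ltW/neg.
by have := neg _ ne0; lra.
Qed.

Definition pairmult p u b : nat := \sum_i (mark p u b i : nat).

(* Each label is kept with weight 1 - z or deleted with weight z; by
   [compat_inj] the marked configurations come from distinct labelings. *)
Lemma sum_pairmult_le p (z : R) : p.1 != p.2 -> 0 <= z <= 1 ->
  \sum_u \prod_b ((1 - z) + z * (pairmult p u b)%:R) <= (k ^ #|J|)%:R.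
Proof.
move=> p12 /andP[z0 z1].
pose w (i : 'I_k * bool) : R := if i.2 then z else 1 - z.
have w0 i : 0 <= w i by rewrite /w; case: ifP => _ //; rewrite subr_ge0.
pose ok u b (i : 'I_k * bool) := if i.2 then mark p u b i.1 else i.1 == u b.
have e u b : (1 - z) + z * (pairmult p u b)%:R = \sum_i (ok u b i)%:R * w i.
  rewrite (eq_bigr (fun i => (ok u b (i.1, i.2))%:R * w (i.1, i.2))) => [|[]//].
  rewrite -(pair_bigA _ (fun i j => (ok u b (i, j))%:R * w (i, j))) /=.
  rewrite /pairmult natr_sum mulr_sumr.
  under [RHS]eq_bigr => i _ do rewrite big_bool /ok /w /=.
  rewrite big_split /= addrC; congr (_ + _); last by apply: eq_bigr => i _; rewrite mulrC.
  by rewrite (bigD1 (u b)) //= eqxx mul1r big1 ?addr0 // => i /negbTE ->; rewrite mul0r.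
under eq_bigr => u _ do under eq_bigr => b _ do rewrite e.
under eq_bigr => u _ do rewrite bigA_distr_bigA /=.
rewrite exchange_big /=.
(* The total weight of all code words: at each point the [k] values each weigh (1 - z) + z = 1. *)
have -> : (k ^ #|J|)%:R = \sum_(v : {ffun J -> 'I_k * bool}) \prod_b w (v b).
  rewrite -(bigA_distr_bigA (fun _ => w)) /= prodr_const natrX; congr (_ ^+ _).
  rewrite (eq_bigr (fun i => w (i.1, i.2))) => [|[]//].
  rewrite -(pair_bigA _ (fun i j => w (i, j))) /=.
  under eq_bigr => i _ do rewrite big_bool /w /= addrC subrK.
  by rewrite sumr_const card_ord.
apply: ler_sum => v _.
under eq_bigr => u _ do rewrite big_split /=.
rewrite -mulr_suml ler_piMl ?prodr_ge0 //.
have okE u : \prod_b (ok u b (v b))%:R = (compat p u v)%:R :> R.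
  have [/forallP h|/forallPn[b hb]] := boolP (compat p u v).
    by rewrite big1 // => b _; have := h b; rewrite /ok => ->.
  by rewrite (bigD1 b) //= /ok (negbTE hb) mul0r.
under eq_bigr => u _ do rewrite okE.
have [u0 h0|h] := pickP (fun u => compat p u v); last first.
  by rewrite big1 // => u _; rewrite h.
rewrite (bigD1 u0) //= h0 big1 ?addr0 // => u /negP ne.
by case: (boolP (compat p u v)) => // hu; case: ne; rewrite (compat_inj p12 hu h0).
Qed.

(** A fixed choice among tied winners, so that a point where [u] and [t] both lose is charged to
    exactly one third class. The default is never reached, since some label always wins. *)
Definition top u b : 'I_k := odflt (u b) [pick a | right u b a].

Lemma topP u b : right u b (top u b).
Proof.
rewrite /top; case: pickP => [//|h] /=.
by have [a ha] := argmaxs_neq0 (F u b) (u b); have := h a; rewrite /right ha.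
Qed.

(** A lower bound for [pairmult] minus one. When [top] lies in the pair and [u b] loses, [top] is
    the other label and supplies a second mark. *)
Definition pairsgn p u b : R :=
  if ~~ active p u b then 0 else if right u b (u b) then -1 else
  (~~ right u b (t b) && (top u b \in [:: p.1; p.2]))%:R.

Lemma pairsgn_le p u b : 1 + pairsgn p u b <= (pairmult p u b)%:R.
Proof.
rewrite /pairsgn /pairmult.
have [A|A] /= := boolP (active p u b); last first.
  rewrite addr0 ler1n (bigD1 (u b)) //= /mark (negbTE A) eqxx //.
case: ifP => [_|/negbT w]; first by rewrite subrr ler0n.
have up : u b \in [:: p.1; p.2] by case/andP: A.
rewrite (bigD1 (u b)) //= {1}/mark A up w eqxx /= natrD lerD2l.
case: andP => [[_ tp]|_]; last by rewrite ler0n.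
have tu : top u b != u b by apply: contraNneq w => <-; exact: topP.
by rewrite ler1n (bigD1 (top u b)) //= /mark A tp w topP orbT.
Qed.

Definition wrong2 u b := [&& u b != t b, ~~ right u b (u b) & ~~ right u b (t b)].
Definition rightR u b := (u b != t b) && right u b (u b).

Lemma sum_pairs u b (g : 'I_k * 'I_k -> R) (h : 'I_k -> R) : u b != t b ->
  (forall p, ~~ active p u b -> g p = 0) ->
  (forall j, j != u b -> j != t b -> g (u b, j) = h j /\ g (j, u b) = h j) ->
  \sum_(p | p.1 != p.2) g p = 2 * \sum_(j | (j != u b) && (j != t b)) h j.
Proof.
move=> ut g0 gh.
have -> : \sum_(p | p.1 != p.2) g p = \sum_i \sum_(j | i != j) g (i, j).
  by rewrite pair_big_dep /=; apply: eq_bigr => -[].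
rewrite (bigD1 (u b)) //= mulr_natl mulr2n; congr (_ + _).
  rewrite (bigID (fun j => j == t b)) /= [X in X + _]big1 ?add0r; last first.
    move=> j /andP[_ /eqP ->]; apply: g0.
    by rewrite /active /= !inE !eqxx /= orbT.
  apply: eq_big => [j|j /andP[]]; first by rewrite eq_sym.
  by move=> ? ?; apply: (gh _ _ _).1 => //; rewrite eq_sym.
rewrite [RHS]big_mkcondr /=; apply: eq_bigr => i iu.
rewrite (bigD1 (u b)) //= [X in _ + X]big1 ?addr0; last first.
  move=> j /andP[_ ju]; apply: g0.
  by rewrite /active /= !inE ![u b == _]eq_sym (negbTE iu) (negbTE ju).
case: ifP => it; first by rewrite (gh _ _ _).2.
by move/negbFE/eqP: it => it; apply: g0; rewrite /active /= !inE it !eqxx /= andbF.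
Qed.

Lemma card_neq2 (i j : 'I_k) : i != j ->
  #|[pred l | (l != i) && (l != j)]| = (k - 2)%N.
Proof.
move=> ij; have := cardC [set i; j]%SET; rewrite card_ord cards2 ij /=.
move=> /(congr1 (subn^~ 2)); rewrite addKn => <-.
by apply: eq_card => l; rewrite !inE negb_or.
Qed.

(** Used with [phi] the identity, which gives twice the summand of [excess], and with [phi] the
    square, which gives its quadratic variation. *)
Lemma sum_pairsgn (phi : R -> R) u b : phi 0 = 0 ->
  \sum_(p | p.1 != p.2) phi (pairsgn p u b) =
  2 * (phi 1 * (wrong2 u b)%:R + phi (-1) * ((k - 2)%:R * (rightR u b)%:R)).
Proof.
move=> phi0; have [ut|ut] := eqVneq (u b) (t b).
  rewrite /wrong2 /rightR ut eqxx /= !mulr0 addr0 mulr0 big1 // => p _.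
  by rewrite /pairsgn /active ut andbN.
rewrite (@sum_pairs u b _ (fun j => phi (if right u b (u b) then -1 else
   (~~ right u b (t b) && (top u b == j))%:R)) ut).
- congr (2 * _); rewrite /wrong2 /rightR ut /=.
  case: (boolP (right u b (u b))) => w /=.
    by rewrite sumr_const card_neq2 // mulr1 mulr0 add0r mulr_natr.
  rewrite !mulr0 addr0 /=; case: (boolP (right u b (t b))) => wt /=.
    by rewrite big1 ?mulr0.
  have tu : top u b != u b by apply: contraNneq w => <-; exact: topP.
  have tt : top u b != t b by apply: contraNneq wt => <-; exact: topP.
  rewrite (bigD1 (top u b)) ?tu ?tt //= eqxx big1 ?addr0 ?mulr1 // => j /andP[_].
  by rewrite eq_sym => /negbTE ->.
- by move=> p A; rewrite /pairsgn A.
move=> j ju jt; rewrite /pairsgn.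
have A1 : active (u b, j) u b.
  by rewrite /active /= !inE eqxx /= negb_or ![t b == _]eq_sym ut jt.
have A2 : active (j, u b) u b.
  by rewrite /active /= !inE eqxx orbT /= negb_or ![t b == _]eq_sym ut jt.
rewrite A1 A2 /=; case: ifP => // /negbT w.
have tu : top u b != u b by apply: contraNneq w => <-; exact: topP.
by rewrite !inE (negbTE tu) orbF.
Qed.

(* The statistic X of the header. *)
Definition excess u : R :=
  \sum_b ((wrong2 u b)%:R - (k - 2)%:R * (rightR u b)%:R).

(** By [coshR_le], exp(l s - l^2/2) is at most exp(l s) / cosh l = 1 + s tanh l for s = 1 or -1. The
    deletion probability will be tanh l. *)
Lemma expR_sgn_le (l s : R) : 0 <= l -> [\/ s = 0, s = 1 | s = -1] ->
  expR (l * s - l ^+ 2 / 2 * s ^+ 2) <=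
  1 + (expR l - expR (- l)) / (expR l + expR (- l)) * s.
Proof.
move=> l0; have := coshR_le l0; set c := expR l + _ => cle.
have c0 : 0 < c by rewrite addr_gt0 ?expR_gt0.
have H (a : R) : expR (a - l ^+ 2 / 2) <= 2 * expR a / c.
  rewrite expRB ler_pdivrMr ?expR_gt0 // mulrAC ler_pdivlMr //.
  by rewrite [2 * _]mulrC -mulrA ler_pM2l ?expR_gt0.
case=> ->.
- by rewrite !mulr0 expr0n /= mulr0 subrr addr0 expR0.
- rewrite expr1n !mulr1 (le_trans (H l)) // le_eqVlt; apply/orP; left.
  by apply/eqP; rewrite /c; field; rewrite gt_eqF.
- rewrite sqrrN expr1n mulr1 !mulrN1 (le_trans (H (- l))) // le_eqVlt; apply/orP; left.
  by apply/eqP; rewrite /c; field; rewrite gt_eqF.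
Qed.

Lemma tanhR_itv (l : R) : 0 <= l ->
  0 <= (expR l - expR (- l)) / (expR l + expR (- l)) <= 1.
Proof.
move=> l0; have c0 : 0 < expR l + expR (- l) by rewrite addr_gt0 ?expR_gt0.
apply/andP; split.
  by rewrite divr_ge0 ?(ltW c0) // subr_ge0 ler_expR; lra.
by rewrite ler_pdivrMr // mul1r; have := expR_gt0 (- l); lra.
Qed.

Lemma pairsgn_cases p u b :
  [\/ pairsgn p u b = 0, pairsgn p u b = 1 | pairsgn p u b = -1].
Proof.
rewrite /pairsgn; case: ifP => _; first by constructor 1.
case: ifP => _; first by constructor 3.
by case: andP => _; [constructor 2|constructor 1].
Qed.

(** The mean over labelings of a compensated exponential is at most 1, as for a supermartingale,
    although no independence is available. *)
Lemma sum_expR_pairsgn p (l : R) : p.1 != p.2 -> 0 <= l ->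
  \sum_u expR (\sum_b (l * pairsgn p u b - l ^+ 2 / 2 * pairsgn p u b ^+ 2))
    <= (k ^ #|J|)%:R.
Proof.
move=> p12 l0; pose z := (expR l - expR (- l)) / (expR l + expR (- l)).
have z01 : 0 <= z <= 1 by exact: tanhR_itv.
apply: le_trans (sum_pairmult_le p12 z01).
apply: ler_sum => u _; rewrite expR_sum; apply: ler_prod => b _.
rewrite expR_ge0 /=; apply: le_trans (expR_sgn_le l0 (pairsgn_cases p u b)) _.
rewrite -/z -addrA; have := pairsgn_le p u b.
move: (pairsgn _ _ _) (pairmult _ _ _)%:R => s a.
by case/andP: z01 => *; nra.
Qed.

Lemma card_excess_le (x : R) : (2 < k)%N -> (0 < #|J|)%N -> 0 <= x ->
  #|[set u | x <= excess u]%SET|%:R <=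
  (k ^ #|J|)%:R * expR (- (x ^+ 2 / (2 * k%:R * (k%:R - 2) * #|J|%:R))).
Proof.
move=> k2 m0 x0; set m := #|J| in m0 *.
have k2' : 2 < k%:R :> R by rewrite ltr_nat.
have mR : 0 < m%:R :> R by rewrite ltr0n.
have kE : (k - 2)%:R = k%:R - 2 :> R by rewrite natrB // ltnW.
(* With W doubly wrong points and r points where [u] wins, W + r <= m and W >= (k - 2) r force W +
   (k - 2) r <= [n0]; equality needs W = (k - 2) r and W + r = m. *)
pose n0 : R := 2 * (k%:R - 2) * m%:R / (k%:R - 1).
have n0_gt0 : 0 < n0 by rewrite /n0 divr_gt0 ?mulr_gt0 //; lra.
(* Maximizes 2 l x - l^2 n0. The value x^2 / n0, divided by the k (k - 1) ordered pairs, is the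
   exponent of the statement. *)
pose l := x / n0.
have l0 : 0 <= l by rewrite divr_ge0 // ltW.
pose P := [pred p : 'I_k * 'I_k | p.1 != p.2].
have PE : #|P|%:R = k%:R * (k%:R - 1) :> R.
  have -> : #|P| = (k * k.-1)%N.
    rewrite -sum1_card -(pair_big_dep predT (fun i j => i != j) (fun i j => 1%N)) /=.
    rewrite (eq_bigr (fun _ => k.-1)) ?sum_nat_const ?card_ord // => i _.
    rewrite sum1_card; have := cardC1 i; rewrite card_ord => <-.
    by apply: eq_card => j; rewrite !inE eq_sym.
  by rewrite natrM -subn1 natrB // (ltn_trans _ k2).
have P0 : 0 < #|P|%:R :> R by rewrite PE mulr_gt0 //; lra.
pose a p u := \sum_b (l * pairsgn p u b - l ^+ 2 / 2 * pairsgn p u b ^+ 2).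
have tot : \sum_(p | P p) \sum_u expR (a p u) <= #|P|%:R * (k ^ m)%:R.
  rewrite mulr_natl -sumr_const; apply: ler_sum => p pP.
  exact: sum_expR_pairsgn.
have key u : x <= excess u ->
    #|P|%:R * expR (x ^+ 2 / (2 * k%:R * (k%:R - 2) * m%:R)) <= \sum_(p | P p) expR (a p u).
  move=> xu; apply: le_trans (jensen_expR (fun p => a p u) _); last first.
    by rewrite -(ltr0n R).
  rewrite ler_pM2l // ler_expR ler_pdivlMr //.
  have -> : \sum_(p | P p) a p u = 2 * l * excess u -
      l ^+ 2 * \sum_b ((wrong2 u b)%:R + (k - 2)%:R * (rightR u b)%:R).
    rewrite exchange_big /= /excess !mulr_sumr -sumrB; apply: eq_bigr => b _.
    rewrite sumrB -!mulr_sumr (@sum_pairsgn id) // (@sum_pairsgn (fun z => z ^+ 2)) ?expr0n //.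
    by field.
  have nle : \sum_b ((wrong2 u b)%:R + (k - 2)%:R * (rightR u b)%:R) <= n0.
    have e1 : (k%:R - 1) * \sum_b ((wrong2 u b)%:R + (k - 2)%:R * (rightR u b)%:R) =
        2 * (k%:R - 2) * \sum_b ((wrong2 u b)%:R + (rightR u b)%:R)
        - (k%:R - 3) * excess u.
      rewrite /excess !mulr_sumr -sumrB; apply: eq_bigr => b _.
      by rewrite kE; ring.
    have e2 : \sum_b ((wrong2 u b)%:R + (rightR u b)%:R) <= m%:R :> R.
      rewrite /m -sum1_card natr_sum; apply: ler_sum => b _.
      rewrite /wrong2 /rightR -natrD ler_nat; case: (_ != _) => //=.
      by case: (right u b _) => //=; case: (right u b _).
    have k3 : 0 <= k%:R - 3 :> R by rewrite subr_ge0 ler_nat.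
    rewrite /n0 ler_pdivlMr; last by lra.
    rewrite mulrC e1; nra.
  have -> : x ^+ 2 / (2 * k%:R * (k%:R - 2) * m%:R) * #|P|%:R = 2 * l * x - l ^+ 2 * n0.
    rewrite PE /l /n0; field.
    by rewrite !gt_eqF //; lra.
  by rewrite lerB // ?ler_wpM2l // mulr_ge0.
have : #|P|%:R * #|[set u | x <= excess u]%SET|%:R *
    expR (x ^+ 2 / (2 * k%:R * (k%:R - 2) * m%:R)) <= #|P|%:R * (k ^ m)%:R.
  apply: le_trans tot; rewrite exchange_big /=.
  rewrite (bigID (fun u => x <= excess u)) /= -[leLHS]addr0 lerD //; last first.
    by apply: sumr_ge0 => u _; apply: sumr_ge0 => p _; exact: expR_ge0.
  have hN (c : R) : #|[set u | x <= excess u]%SET|%:R * c = \sum_(u | x <= excess u) c.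
    by rewrite mulr_natl -sumr_const; apply: eq_bigl => u; rewrite inE.
  by rewrite mulrAC mulrC hN; apply: ler_sum => u; exact: key.
by rewrite -mulrA ler_pM2l // expRN ler_pdivlMr ?expR_gt0.
Qed.
End Counting.

(** * Measurability of the learner *)

Section RidgeLimit.
Variables (R : realType) (p : nat) (A : 'M[R]_p).
Hypothesis A_ge0 : forall v : 'rV[R]_p, 0 <= (v *m A *m v^T) 0 0.

Lemma ridge_unitmx (e : R) : 0 < e -> A + e%:M \in unitmx.
Proof.
move=> e0; rewrite -row_free_unit -kermx_eq0; apply/eqP/row_matrixP => i.
rewrite row0; set u := row i _.
have uK : u *m (A + e%:M) = 0 by rewrite -row_mul mulmx_ker row0.
apply: rV_sqr_eq0; apply/eqP; rewrite eq_le rV_sqr_ge0 andbT.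
have : (u *m (A + e%:M) *m u^T) 0 0 = 0 by rewrite uK mul0mx mxE.
rewrite mulmxDr mulmxDl mxE mul_mx_scalar -scalemxAl [X in _ + X]mxE.
by have := A_ge0 u; nra.
Qed.

(** With q = v e (A + e)^-1, positivity of A gives |q|^2 <= <v, q>, and expanding |v - q|^2 >= 0
    finishes. *)
Lemma ridge_contract (e : R) (v : 'rV[R]_p) : 0 < e ->
  (v *m (e *: invmx (A + e%:M)) *m (v *m (e *: invmx (A + e%:M)))^T) 0 0
    <= (v *m v^T) 0 0.
Proof.
move=> e0; set q := v *m (e *: _).
have qE : q *m (A + e%:M) = e *: v.
  by rewrite /q -scalemxAr -scalemxAl -mulmxA mulVmx ?mulmx1 // ridge_unitmx.
have : (q *m (A + e%:M) *m q^T) 0 0 = e * (v *m q^T) 0 0.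
  by rewrite qE -scalemxAl mxE.
rewrite mulmxDr mulmxDl mxE mul_mx_scalar -scalemxAl [X in _ + X]mxE => h.
have h1 : (q *m q^T) 0 0 <= (v *m q^T) 0 0 by have := A_ge0 q; nra.
have : 0 <= ((v - q) *m (v - q)^T) 0 0 by exact: rV_sqr_ge0.
rewrite linearB /= mulmxBl !mulmxBr !mxE.
have : (q *m v^T) 0 0 = (v *m q^T) 0 0.
  by rewrite -[q *m v^T]trmxK trmx_mul trmxK mxE.
rewrite !mxE in h1 *; lra.
Qed.
End RidgeLimit.

Lemma cvg_harmonic_dist (R : realType) (u : nat -> R) (l C : R) :
  (forall n, `|u n - l| <= harmonic n * C) -> u n @[n --> \oo] --> l.
Proof.
move=> h.
have hC (s : R) : (fun n => l + harmonic n * (s * C)) @ \oo --> l.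
  rewrite -[X in _ --> X]addr0 -[X in _ --> _ + X](mul0r (s * C)).
  by apply: cvgD; [exact: cvg_cst|apply: cvgM; [exact: cvg_harmonic|exact: cvg_cst]].
apply: (squeeze_cvgr _ (hC (-1)) (hC 1)); near=> n.
by have := h n; rewrite ler_norml => /andP[h1 h2]; apply/andP; split; lra.
Unshelve. all: by end_near. Qed.

Section LearnLimit.
Variables (R : realType) (d k : nat) (lam : R) (T : finType).
Hypothesis lam_ge0 : 0 <= lam.
Variables (x : T -> 'rV[R]_d) (c : T -> 'I_k) (S : {set T}).

Let A := rgram lam x S.
Let V := Defs.pinv A *m Defs.pinv A *m corr x c S.

(** The pseudo-inverse is not continuous in its matrix, so measurability comes from a pointwise
    limit of invertible problems. This is the explicit rate of that limit as e -> 0. *)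
Lemma learn_ridge_dist (e : R) r a : 0 < e ->
  `|(invmx (A + e%:M) *m corr x c S) r a - learn lam x c S r a| <=
  e * (`|V r a| + (1 + ((col a V)^T *m ((col a V)^T)^T) 0 0)).
Proof.
move=> e0; have Age0 := rgram_ge0 lam_ge0 x S; rewrite -/A in Age0.
have uA := ridge_unitmx Age0 e0.
have [_ b2 _ _] := pinvP A.
have AV : A *m V = learn lam x c S.
  by rewrite /V !mulmxA -(@rgram_comm _ _ lam _ x S) -/A b2.
(* With W the limit and A V = W, multiplying the difference by A + e gives -e W = -e (A + e) V + e^2
   V. *)
have eqW : invmx (A + e%:M) *m corr x c S - learn lam x c S =
    - (e *: V) + e *: (e *: invmx (A + e%:M) *m V).
  rewrite -[LHS]mul1mx -(mulVmx uA) -mulmxA mulmxBr mulmxA mulmxV // mul1mx.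
  rewrite [(A + e%:M) *m learn _ _ _ _]mulmxDl (rgram_learn lam_ge0) opprD addrA subrr add0r mul_scalar_mx.
  have -> : e *: learn lam x c S = e *: ((A + e%:M) *m V) - e *: (e *: V).
    by rewrite -AV [(A + e%:M) *m V]mulmxDl mul_scalar_mx scalerDr addrK.
  rewrite opprB mulmxBr addrC; congr (_ + _).
    by rewrite -scalemxAr mulmxA mulVmx // mul1mx.
  by rewrite -!scalemxAr -!scalemxAl.
have -> : (invmx (A + e%:M) *m corr x c S) r a - learn lam x c S r a =
    (invmx (A + e%:M) *m corr x c S - learn lam x c S) r a by rewrite !mxE.
set q := (col a V)^T *m (e *: invmx (A + e%:M)).
have qE : (e *: invmx (A + e%:M) *m V) r a = q 0 r.
  have -> : q = (e *: invmx (A + e%:M) *m col a V)^T.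
    rewrite trmx_mul linearZ /= trmx_inv linearD /= tr_scalar_mx.
    by rewrite /A rgram_sym.
  rewrite [RHS]mxE [RHS]mxE [LHS]mxE; apply: eq_bigr => i _.
  by rewrite [col a V _ _]mxE.
rewrite eqW mxE [X in `|X + _|]mxE [X in `|_ + X|]mxE qE [X in `|- X + _|]mxE.
rewrite addrC -mulrBr normrM gtr0_norm // ler_pM2l // (le_trans (ler_normB _ _)) //.
(* |q_r| <= 1 + |q|^2 avoids a square root; only the order in [e] matters. *)
rewrite addrC lerD2l; apply: (@le_trans _ _ (1 + (q *m q^T) 0 0)).
  have : q 0 r ^+ 2 <= (q *m q^T) 0 0.
    rewrite [leRHS]mxE; under eq_bigr => j _ do rewrite [q^T _ _]mxE -expr2.
    by rewrite (bigD1 r) //= lerDl; apply: sumr_ge0 => i _; exact: sqr_ge0.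
  move=> h; rewrite -real_normK ?num_real // in h.
  by apply: le_trans (_ : 1 + `|q 0 r| ^+ 2 <= _); [nra|rewrite lerD2l].
by rewrite lerD2l; apply: ridge_contract.
Qed.

Lemma cvg_learn r a :
  (invmx (A + (harmonic n)%:M) *m corr x c S) r a @[n --> \oo]
    --> learn lam x c S r a.
Proof.
apply: cvg_harmonic_dist => n; apply: learn_ridge_dist.
by rewrite /harmonic /= invr_gt0.
Qed.
End LearnLimit.

Section MeasurableMatrix.
Context d0 (Om : measurableType d0) (R : realType).

Definition mmx m n (A : Om -> 'M[R]_(m, n)) :=
  forall i j, measurable_fun setT (fun om => A om i j).

Lemma mmx_add m n (A B : Om -> 'M[R]_(m, n)) :
  mmx A -> mmx B -> mmx (fun om => A om + B om).
Proof.
move=> hA hB i j; under eq_fun do rewrite mxE; exact: measurable_funD.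
Qed.

Lemma mmx_mul m n p (A : Om -> 'M[R]_(m, n)) (B : Om -> 'M[R]_(n, p)) :
  mmx A -> mmx B -> mmx (fun om => A om *m B om).
Proof.
move=> hA hB i j; under eq_fun do rewrite mxE.
by apply: measurable_sum => l; exact: measurable_funM.
Qed.

Lemma mmx_cst m n (A : 'M[R]_(m, n)) : mmx (fun=> A).
Proof. by move=> i j; exact: measurable_cst. Qed.

Lemma measurable_det n (A : Om -> 'M[R]_n) : mmx A ->
  measurable_fun setT (fun om => \det (A om)).
Proof.
move=> hA; apply: measurable_sum => s; apply: measurable_funM => //.
by apply: measurable_prod => i _; exact: hA.
Qed.

(** 1/f = f (f^2)^(-1) holds also where f = 0, and it reduces the claim to a power of a nonnegative
    function. *)
Lemma measurable_invr (f : Om -> R) : measurable_fun setT f ->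
  measurable_fun setT (fun om => (f om)^-1).
Proof.
move=> mf; have -> : (fun om => (f om)^-1) = (fun om => f om * (f om ^+ 2) `^ (-1)).
  apply/funext => om; rewrite powR_inv1 ?sqr_ge0 //.
  have [->|f0] := eqVneq (f om) 0; first by rewrite invr0 mul0r.
  by field.
apply: measurable_funM => //.
apply: (@measurableT_comp _ _ _ _ _ _ (fun y : R => y `^ (-1))).
  exact: measurable_powR.
exact: measurable_funX.
Qed.

Lemma mmx_inv n (A : Om -> 'M[R]_n) : mmx A -> (forall om, A om \in unitmx) ->
  mmx (fun om => invmx (A om)).
Proof.
move=> hA uA i j.
have -> : (fun om => invmx (A om) i j) = (fun om => (\det (A om))^-1 *
    ((-1) ^+ (j + i) * \det (row' j (col' i (A om))))).
  by apply/funext => om; rewrite /invmx uA !mxE.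
apply: measurable_funM; first exact/measurable_invr/measurable_det.
apply: measurable_funM => //; apply: measurable_det => a b.
by under eq_fun do rewrite !mxE; exact: hA.
Qed.

Lemma measurable_eq_lab k (y : Om -> 'I_k) a : measurable [set om | y om = a] ->
  measurable_fun setT (fun om => (a == y om)%:R : R).
Proof.
move=> my; have -> : (fun om => (a == y om)%:R : R) = \1_[set om | y om = a].
  apply/funext => om; rewrite indicE; congr ((nat_of_bool _)%:R); rewrite eq_sym.
  by apply/idP/idP; rewrite inE => /eqP.
exact: measurable_indic.
Qed.

Context (d k : nat) (lam : R) (T : finType).
Hypothesis lam_ge0 : 0 <= lam.
Variables (x : Om -> T -> 'rV[R]_d) (c : Om -> T -> 'I_k).
Hypothesis mx : forall i, mmx (fun om => x om i).
Hypothesis mc : forall i a, measurable [set om | c om i = a].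

Lemma mmx_learn (S : {set T}) : mmx (fun om => learn lam (x om) (c om) S).
Proof.
have mrg (e : R) : mmx (fun om => rgram lam (x om) S + e%:M).
  have mg : mmx (fun om => gram (x om) S).
    move=> i j.
    have -> : (fun om => gram (x om) S i j) =
        (fun om => \sum_(l <- enum S) x om l 0 i * x om l 0 j).
      apply/funext => om; rewrite /gram summxE big_enum /=; apply: eq_bigr => l _.
      by rewrite mxE big_ord1 mxE.
    by apply: measurable_sum => l; apply: measurable_funM; exact: mx.
  by apply: mmx_add (mmx_cst _); apply: mmx_add mg (mmx_cst _).
have mcorr : mmx (fun om => corr (x om) (c om) S).
  move=> i j.
  have -> : (fun om => corr (x om) (c om) S i j) =
      (fun om => \sum_(l <- enum S) x om l 0 i * (j == c om l)%:R).
    by apply/funext => om; rewrite corrE big_enum.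
  apply: measurable_sum => l; apply: measurable_funM; first exact: mx.
  exact: measurable_eq_lab.
move=> r a; apply: (@measurable_fun_cvg _ _ _ setT (fun n om =>
    (invmx (rgram lam (x om) S + (harmonic n)%:M) *m corr (x om) (c om) S) r a)).
  2: by move=> om _; exact: cvg_learn.
move=> n; apply: mmx_mul => //; apply: mmx_inv => // om.
apply: ridge_unitmx; first exact: rgram_ge0.
by rewrite /harmonic /= invr_gt0.
Qed.

Lemma measurable_err01 (S : {set T}) i (y : Om -> 'I_k) :
  (forall a, measurable [set om | y om = a]) ->
  measurable_fun setT (fun om => err01 (learn lam (x om) (c om) S) (x om i) (y om) : R).
Proof.
move=> my.
have ms a : measurable_fun setT (fun om => (x om i *m learn lam (x om) (c om) S) 0 a).
  by apply: mmx_mul; [exact: mx|exact: mmx_learn].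
pose s om := x om i *m learn lam (x om) (c om) S.
(* The argmax test becomes a polynomial in indicators of label events and score comparisons. *)
have -> : (fun om => err01 (learn lam (x om) (c om) S) (x om i) (y om) : R) =
    (fun om => \sum_a (a == y om)%:R * (1 - \prod_l (s om 0 l <= s om 0 a)%R%:R)).
  apply/funext => om; rewrite (bigD1 (y om)) //= eqxx mul1r.
  rewrite [X in _ + X]big1 ?addr0; last by move=> a /negbTE ->; rewrite mul0r.
  rewrite /err01 -/(s om); case: (in_argmaxs (s om) (y om)) => h /=.
    by rewrite big1 ?subrr // => l _; rewrite h.
  have [l] : exists l, ~~ (s om 0 l <= s om 0 (y om)).
    by apply/existsP; rewrite -negb_forall; apply/negP => /forallP.
  by move=> /negbTE hl; rewrite (bigD1 l) //= hl mul0r subr0.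
apply: measurable_sum => a; apply: measurable_funM.
  exact: measurable_eq_lab.
apply: measurable_funB => //; apply: measurable_prod => l _.
apply: (@measurableT_comp _ _ _ _ _ _ (fun b : bool => b%:R : R)) => //.
exact: measurable_fun_ler.
Qed.
End MeasurableMatrix.

(** * Expectations and independent samples *)

Section Mean.
Context d0 (Om : measurableType d0) (R : realType).
Implicit Types (f g : Om -> R) (P : probability Om R).

(** Bounded measurable functions are closed under the algebra needed here and integrable under every
    probability, so real-valued expectations carry no integrability side conditions. *)
Definition bmf f := measurable_fun setT f /\ exists M, forall om, `|f om| <= M.

Definition mean P f : R := \int[P]_om f om.

Lemma bmf_cst c : bmf (fun=> c).
Proof. by split; [exact: measurable_cst|exists `|c|]. Qed.

Lemma bmfD f g : bmf f -> bmf g -> bmf (fun om => f om + g om).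
Proof.
move=> [mf [M hM]] [mg [M' hM']]; split; first exact: measurable_funD.
by exists (M + M') => om; rewrite (le_trans (ler_normD _ _)) // lerD.
Qed.

Lemma bmfM f g : bmf f -> bmf g -> bmf (fun om => f om * g om).
Proof.
move=> [mf [M hM]] [mg [M' hM']]; split; first exact: measurable_funM.
by exists (M * M') => om; rewrite normrM ler_pM.
Qed.

Lemma bmfN f : bmf f -> bmf (fun om => - f om).
Proof.
move=> [mf [M hM]]; split; first exact: measurable_funN.
by exists M => om; rewrite normrN.
Qed.

Lemma bmfB f g : bmf f -> bmf g -> bmf (fun om => f om - g om).
Proof. by move=> hf hg; apply: bmfD => //; exact: bmfN. Qed.

Lemma bmf_norm f : bmf f -> bmf (fun om => `|f om|).
Proof.
move=> [mf [M hM]]; split; first exact: measurableT_comp.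
by exists M => om; rewrite normr_id.
Qed.

Lemma bmf_sum (I : Type) (s : seq I) (F : I -> Om -> R) :
  (forall i, bmf (F i)) -> bmf (fun om => \sum_(i <- s) F i om).
Proof.
move=> hF; elim: s => [|i s IH].
  by under eq_fun do rewrite big_nil; exact: bmf_cst.
by under eq_fun do rewrite big_cons; exact: bmfD.
Qed.

Lemma bmf_sum_cond (I : Type) (s : seq I) (p : pred I) (F : I -> Om -> R) :
  (forall i, bmf (F i)) -> bmf (fun om => \sum_(i <- s | p i) F i om).
Proof.
move=> hF; under eq_fun do rewrite big_mkcond /=.
by apply: bmf_sum => i; case: (p i); [exact: hF|exact: bmf_cst].
Qed.

Lemma bmf_integrable P f : bmf f -> P.-integrable setT (EFin \o f).
Proof.
move=> [mf [M hM]]; apply: measurable_bounded_integrable => //.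
  by rewrite (le_lt_trans (probability_le1 _ _)) ?ltry.
exists M; split; rewrite ?num_real // => x Mx om _.
by apply: le_trans (hM om) _; exact: ltW.
Qed.

Lemma mean_cst P c : mean P (fun=> c) = c.
Proof.
rewrite /mean Rintegral_cst // -[RHS]mulr1; congr (_ * _).
exact: (congr1 fine (probability_setT P)).
Qed.

Lemma meanD P f g : bmf f -> bmf g ->
  mean P (fun om => f om + g om) = mean P f + mean P g.
Proof. by move=> hf hg; rewrite /mean RintegralD //; exact: bmf_integrable. Qed.

Lemma meanB P f g : bmf f -> bmf g ->
  mean P (fun om => f om - g om) = mean P f - mean P g.
Proof. by move=> hf hg; rewrite /mean RintegralB //; exact: bmf_integrable. Qed.

Lemma meanZ P c f : bmf f -> mean P (fun om => c * f om) = c * mean P f.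
Proof. by move=> hf; rewrite /mean RintegralZl //; exact: bmf_integrable. Qed.

Lemma mean_sum P (I : Type) (s : seq I) (F : I -> Om -> R) :
  (forall i, bmf (F i)) ->
  mean P (fun om => \sum_(i <- s) F i om) = \sum_(i <- s) mean P (F i).
Proof.
move=> hF; elim: s => [|i s IH].
  by under eq_fun do rewrite big_nil; rewrite mean_cst big_nil.
under eq_fun do rewrite big_cons.
by rewrite big_cons meanD ?IH //; exact: bmf_sum.
Qed.

Lemma mean_sum_cond P (I : Type) (s : seq I) (p : pred I) (F : I -> Om -> R) :
  (forall i, bmf (F i)) ->
  mean P (fun om => \sum_(i <- s | p i) F i om) = \sum_(i <- s | p i) mean P (F i).
Proof.
move=> hF; under eq_fun do rewrite big_mkcond /=.
rewrite [RHS]big_mkcond mean_sum => [|i]; last first.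
  by case: (p i); [exact: hF|exact: bmf_cst].
by apply: eq_bigr => i _; case: (p i) => //; exact: mean_cst.
Qed.

Lemma le_mean P f g : bmf f -> bmf g -> (forall om, f om <= g om) ->
  mean P f <= mean P g.
Proof. by move=> hf hg h; rewrite /mean le_Rintegral //; exact: bmf_integrable. Qed.

Lemma mean_ge0 P f : (forall om, 0 <= f om) -> 0 <= mean P f.
Proof. by move=> h; apply: Rintegral_ge0. Qed.

Lemma mean_EFin P f : bmf f -> (\int[P]_om (f om)%:E = (mean P f)%:E)%E.
Proof.
move=> hf; rewrite /mean /Rintegral fineK //.
have := integrable_fin_num measurableT (bmf_integrable P hf); exact.
Qed.

Lemma bmf_indic (A : set Om) : measurable A -> bmf (\1_A : Om -> R).
Proof.
move=> mA; split; first exact: measurable_indic.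
by exists 1 => om; rewrite indicE; case: (_ \in _); rewrite ?normr1 ?normr0.
Qed.

Lemma mean_indic P (A : set Om) : measurable A -> P A = (mean P (\1_A))%:E.
Proof. by move=> mA; rewrite -mean_EFin ?integral_indic ?setIT //; exact: bmf_indic. Qed.

Lemma markov_mean P f (a v : R) : bmf f -> (forall om, 0 <= f om) -> 0 < a ->
  mean P f <= v -> (P [set om | a <= f om]%R <= (v / a)%:E)%E.
Proof.
move=> hf f0 a0 fv; have mA : measurable [set om | a <= f om].
  rewrite -[X in measurable X]setTI; apply: measurable_fun_ler => //.
  by case: hf.
rewrite mean_indic // lee_fin ler_pdivlMr // (le_trans _ fv) //.
rewrite mulrC -meanZ; last exact: bmf_indic.
apply: le_mean => //; first by apply: bmfM; [exact: bmf_cst|exact: bmf_indic].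
move=> om; rewrite indicE; case: (boolP (om \in _)) => h; last by rewrite mulr0.
by rewrite mulr1; move: h; rewrite inE.
Qed.

End Mean.

Lemma bmf_comp d0 d1 (Om : measurableType d0) (Y : measurableType d1) (R : realType)
    (V : Om -> Y) (g : Y -> R) :
  measurable_fun setT V -> bmf g -> bmf (fun om => g (V om)).
Proof.
move=> mV [mg [M hM]]; split; last by exists M.
exact: measurableT_comp.
Qed.

Section Fubini.
Context d0 d1 (Om : measurableType d0) (Z : measurableType d1) (R : realType).
Variables (P : probability Om R) (D : probability Z R) (f : Om * Z -> R).
Hypothesis hf : bmf f.

Lemma bmf_pair2 om : bmf (fun z => f (om, z)).
Proof.
case: hf => mf [M hM]; split; last by exists M.
exact: (measurableT_comp mf (pair1_measurable om)).
Qed.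

Lemma bmf_mean_pair : bmf (fun om => mean D (fun z => f (om, z))).
Proof.
have [mf [M hM]] := hf; split.
  have -> : (fun om => mean D (fun z => f (om, z))) =
      fine \o (fun om => \int[D]_z ((EFin \o f) (om, z)))%E by [].
  apply: measurableT_comp => //.
  apply: (measurable_fubini_F (m2 := D)); exact: (bmf_integrable (P \x D)%E).
exists M => om.
have h := bmf_pair2 om.
rewrite /mean (le_trans (le_normr_Rintegral _ _)) //; first exact: bmf_integrable.
rewrite -[leRHS](mean_cst D); apply: le_mean => //; first exact: bmf_norm.
exact: bmf_cst.
Qed.

Lemma mean_fubini : mean (P \x D)%E f = mean P (fun om => mean D (fun z => f (om, z))).
Proof.
rewrite /mean /Rintegral -integral12_prod_meas1; last exact: bmf_integrable.
congr fine; apply: eq_integral => om _.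
by rewrite /fubini_F -mean_EFin //; exact: bmf_pair2.
Qed.

End Fubini.

(** * Product sigma-algebra over an arbitrary finite index type *)

Definition rect (Z : Type) (T : finType) (A : T -> set Z) : set (T -> Z) :=
  [set z | forall i, A i (z i)].

Definition rects dZ (Z : measurableType dZ) (T : finType) : set (set (T -> Z)) :=
  [set B | exists2 A : T -> set Z, (forall i, measurable (A i)) & B = rect A].

Arguments rects {dZ} Z T.

Notation pvec Z T := (g_sigma_algebraType (rects Z T)).

Section Vectors.
Context dZ (Z : measurableType dZ) (T : finType).

Lemma rects_setI : setI_closed (rects Z T).
Proof.
move=> B B' [A mA ->] [A' mA' ->].
exists (fun i => A i `&` A' i) => [i|]; first exact: measurableI.
apply/seteqP; split => z /=; first by move=> [h h'] i; split.
by move=> h; split=> i; case: (h i).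
Qed.

Lemma measurable_rect (A : T -> set Z) :
  (forall i, measurable (A i)) -> measurable (rect A : set (pvec Z T)).
Proof. by move=> mA; apply: sub_sigma_algebra; exists A. Qed.

Lemma measurable_coord i : measurable_fun setT (fun z : pvec Z T => z i).
Proof.
move=> _ B mB; rewrite setTI.
have -> : (fun z : pvec Z T => z i) @^-1` B =
    rect (fun j => if j == i then B else setT).
  apply/seteqP; split => z /=; last by move=> /(_ i); rewrite eqxx.
  by move=> Bz j; case: eqP => // ->.
by apply: measurable_rect => j; case: ifP.
Qed.

Lemma measurable_vec d0 (Om : measurableType d0) (V : Om -> T -> Z) :
  (forall i, measurable_fun setT (fun om => V om i)) ->
  measurable_fun setT (V : Om -> pvec Z T).
Proof.
move=> mV; apply: (@measurability _ _ Om (pvec Z T) setT V (rects Z T)) => //.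
move=> _ [_ [A mA ->] <-]; rewrite setTI.
have -> : V @^-1` rect A = \bigcap_(i in [set: T]) ((fun om => V om i) @^-1` A i).
  by apply/seteqP; split => om /= h i; [move=> _|]; exact: h.
apply: fin_bigcap_measurable => // i _.
by rewrite -[X in measurable X]setTI; exact: mV.
Qed.

End Vectors.

Local Notation image_law :=
  measure_function_pushforward__canonical__measure_function_Measure.

Section Iid.
Context dZ (Z : measurableType dZ) (R : realType) (D : probability Z R).

(** The joint law is prescribed on rectangles only. They form a pi-system generating the product
    sigma-algebra, so by [eq_law] the law is determined. *)
Definition iid d0 (Om : measurableType d0) (P : probability Om R) (T : finType)
    (V : Om -> T -> Z) : Prop :=
  (forall i, measurable_fun setT (fun om => V om i)) /\
  forall A : T -> set Z, (forall i, measurable (A i)) ->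
    P (V @^-1` rect A) = (\prod_i fine (D (A i)))%:E.

Lemma iid_measurable d0 (Om : measurableType d0) (P : probability Om R) (T : finType)
    (V : Om -> T -> Z) : iid P V -> measurable_fun setT (V : Om -> pvec Z T).
Proof. by case=> mV _; exact: measurable_vec. Qed.

Section Law.
Context d0 (Om : measurableType d0) d1 (Om' : measurableType d1) (T : finType).
Variables (P : {finite_measure set Om -> \bar R}) (P' : {finite_measure set Om' -> \bar R}).
Variables (V : Om -> pvec Z T) (V' : Om' -> pvec Z T).
Hypotheses (mV : measurable_fun setT V) (mV' : measurable_fun setT V').
Hypothesis PV : forall A : T -> set Z, (forall i, measurable (A i)) ->
  P (V @^-1` rect A) = P' (V' @^-1` rect A).

Lemma eq_law (B : set (pvec Z T)) : measurable B -> P (V @^-1` B) = P' (V' @^-1` B).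
Proof.
move=> mB.
apply: (@measure_unique _ _ (pvec Z T) (rects Z T) (fun=> setT) _ _ _ _
  (image_law P mV) (image_law P' mV')) => //.
- exact: rects_setI.
- move=> _; exists (fun=> setT) => //.
  by apply/seteqP; split.
- by apply: bigcup_const; exists 0%N.
- by move=> _ [A mA ->]; exact: PV.
- by move=> _; change (P setT < +oo)%E; rewrite -ge0_fin_numE ?fin_num_measure.
Qed.

End Law.

Lemma iid_mean d0 (Om : measurableType d0) (P : probability Om R)
    d1 (Om' : measurableType d1) (P' : probability Om' R) (T : finType)
    (V : Om -> T -> Z) (V' : Om' -> T -> Z) (g : pvec Z T -> R) :
  iid P V -> iid P' V' -> bmf g ->
  mean P (fun om => g (V om)) = mean P' (fun om => g (V' om)).
Proof.
move=> hV hV' hg; have mV := iid_measurable hV; have mV' := iid_measurable hV'.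
have hg1 := bmf_comp mV hg; have hg2 := bmf_comp mV' hg.
rewrite /mean /Rintegral; congr fine.
have mg : measurable_fun setT (EFin \o g) by apply/measurable_EFinP; case: hg.
apply: etrans (esym (integral_pushforward mV mg (bmf_integrable P hg1) measurableT)) _.
apply: etrans (integral_pushforward mV' mg (bmf_integrable P' hg2) measurableT).
apply: eq_measure_integral => B mB _.
apply: eq_law => // A mA.
exact: etrans (hV.2 A mA) (esym (hV'.2 A mA)).
Qed.

Lemma iid_perm d0 (Om : measurableType d0) (P : probability Om R) (T : finType)
    (V : Om -> T -> Z) (s : {perm T}) :
  iid P V -> iid P (fun om i => V om (s i)).
Proof.
move=> [mV hV]; split => [i|A mA]; first exact: mV.
have -> : (fun om i => V om (s i)) @^-1` rect A =
          V @^-1` rect (fun i => A ((s^-1)%g i)).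
  apply/seteqP; split => om /= h i.
    by have := h ((s^-1)%g i); rewrite permKV.
  by have := h (s i); rewrite permK.
rewrite hV; last by move=> i; exact: mA.
rewrite (reindex_inj (@perm_inj _ s)) /=; congr (_%:E).
by apply: eq_bigr => i _; rewrite permK.
Qed.

Lemma mean_indep d0 (Om : measurableType d0) (P : probability Om R) (T : finType)
    (V : Om -> T -> Z) (E : set Om) (c : R) (g : pvec Z T -> R) :
  iid P V -> measurable E -> 0 <= c ->
  (forall A : T -> set Z, (forall i, measurable (A i)) ->
     P (V @^-1` rect A `&` E) = (c%:E * P (V @^-1` rect A))%E) ->
  bmf g ->
  mean P (fun om => \1_E om * g (V om)) = c * mean P (fun om => g (V om)).
Proof.
move=> hV mE c0 hE hg.
have mV : measurable_fun setT (V : Om -> pvec Z T) := iid_measurable hV.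
(* Adding the bound |M| makes [g] nonnegative; for the constant |M| the identity is P(E) = c, the
   case of the full rectangle. *)
wlog g0 : g hg / forall z, 0 <= g z => [th|].
  have [mg [M hM]] := hg.
  have hM' z : 0 <= g z + `|M|.
    have := hM z; rewrite ler_norml => /andP[h _].
    by rewrite -lerBlDr sub0r (le_trans _ h) // lerN2 ler_norm.
  have hgM : bmf (fun z => g z + `|M|) by apply: bmfD => //; exact: bmf_cst.
  have := th _ hgM hM'; have hgV := bmf_comp mV hg; have h1 := bmf_indic R mE.
  under eq_fun do rewrite mulrDr.
  have h2 : bmf (fun om => \1_E om * g (V om)) := bmfM h1 hgV.
  have h3 : bmf (fun om => \1_E om * `|M|) := bmfM h1 (bmf_cst _ _).
  rewrite (meanD P h2 h3).
  rewrite meanD //; last exact: bmf_cst.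
  rewrite mean_cst mulrDr.
  under [X in _ + mean _ X]eq_fun do rewrite mulrC.
  rewrite meanZ //.
  have -> : mean P \1_E = c.
    apply: EFin_inj; rewrite -mean_indic // -[E]setTI.
    have -> : [set: Om] = V @^-1` rect (fun=> setT) by apply/seteqP; split.
    rewrite hE // (_ : _ @^-1` _ = setT); last by apply/seteqP; split.
    by rewrite (probability_setT P) mule1.
  by rewrite (mulrC c `|M|) => /addIr.
have hgV := bmf_comp mV hg; have h1 := bmf_indic R mE.
apply: EFin_inj; rewrite EFinM -!mean_EFin //; last exact: bmfM.
have mgE : measurable_fun setT (EFin \o g) by apply/measurable_EFinP; case: hg.
have -> : (\int[P]_om (\1_E om * g (V om))%:E = \int[P]_(om in E) (g (V om))%:E)%E.
  rewrite [RHS]integral_mkcond; apply: eq_integral => om _.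
  by rewrite /= patchE indicE; case: ifP; rewrite ?mul1r ?mul0r.
have -> : (\int[P]_(om in E) (g (V om))%:E = \int[mrestr P mE]_(om in E) (g (V om))%:E)%E.
  by apply: eq_measure_integral => A mA AE; rewrite /= /mrestr setIidl.
pose c' : {nonneg R} := NngNum c0.
have -> : (\int[mrestr P mE]_(om in E) (g (V om))%:E
          = \int[mrestr P mE]_om (g (V om))%:E)%E.
  apply/esym; rewrite (@negligible_integral _ _ _ _ setT (~` E)) //; last 3 first.
  - exact: measurableC.
  - apply: measurable_bounded_integrable => //.
    + change (P (setT `&` E) < +oo)%E.
      by rewrite setTI (le_lt_trans (probability_le1 P mE)) ?ltry.
    + by case: hgV.
    + case: hg => _ [M hM]; exists M; split; rewrite ?num_real // => x Mx om _.
      by apply: le_trans (hM _) _; exact: ltW.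
  - by rewrite /= /mrestr setICl measure0.
  by rewrite setTD setCK.
have -> : (\int[mrestr P mE]_om (g (V om))%:E
          = \int[pushforward (mrestr P mE) (V : Om -> pvec Z T)]_z (g z)%:E)%E.
  rewrite ge0_integral_pushforward //. by move=> z _; rewrite lee_fin.
have -> : (\int[P]_om (g (V om))%:E = \int[pushforward P (V : Om -> pvec Z T)]_z (g z)%:E)%E.
  rewrite ge0_integral_pushforward //. by move=> z _; rewrite lee_fin.
rewrite -[c]/(c'%:num) -ge0_integral_mscale //; last by move=> z _; rewrite lee_fin.
(* The law of V restricted to E and c times the law of V agree on rectangles, hence everywhere. *)
apply: eq_measure_integral => B mB _.
apply: (@measure_unique _ _ (pvec Z T) (rects Z T) (fun=> setT) _ _ _ _
  (image_law (mrestr P mE) mV) (mscale c' (image_law P mV))) => //.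
- exact: rects_setI.
- by move=> _; exists (fun=> setT) => //; apply/seteqP; split.
- by apply: bigcup_const; exists 0%N.
- by move=> _ [A mA ->]; exact: hE.
- move=> _; change (P (setT `&` E) < +oo)%E.
  by rewrite setTI (le_lt_trans (probability_le1 P mE)) ?ltry.
Qed.

Definition unif_indep d0 (Om : measurableType d0) (P : probability Om R)
    (T I : finType) (V : Om -> T -> Z) (U : Om -> I) : Prop :=
  (forall u, measurable (U @^-1` [set u])) /\
  forall (A : T -> set Z) u, (forall i, measurable (A i)) ->
    P (V @^-1` rect A `&` U @^-1` [set u]) =
    ((#|I|%:R^-1)%:E * P (V @^-1` rect A))%E.

Lemma mean_unif_indep d0 (Om : measurableType d0) (P : probability Om R)
    (T I : finType) (V : Om -> T -> Z) (U : Om -> I) (g : I -> pvec Z T -> R) :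
  iid P V -> unif_indep P V U -> (forall u, bmf (g u)) ->
  bmf (fun om => g (U om) (V om)) /\
  mean P (fun om => g (U om) (V om)) =
  #|I|%:R^-1 * \sum_u mean P (fun om => g u (V om)).
Proof.
move=> hV [mU hU] hg; have mV := iid_measurable hV.
have -> : (fun om => g (U om) (V om)) =
    (fun om => \sum_u \1_(U @^-1` [set u]) om * g u (V om)).
  apply/funext => om; rewrite (bigD1 (U om)) //= big1 => [|u uU].
    by rewrite addr0 indicE mem_set // mul1r.
  by rewrite indicE memNset ?mul0r // => /= /esym /eqP; exact/negP.
have h u : bmf (fun om => \1_(U @^-1` [set u]) om * g u (V om)).
  exact: bmfM (bmf_indic R (mU u)) (bmf_comp mV (hg u)).
split; first exact: bmf_sum.
rewrite mean_sum // mulr_sumr; apply: eq_bigr => u _.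
by apply: mean_indep => // A mA; exact: hU.
Qed.

Section Extension.
Context d0 (Om : measurableType d0) (P : probability Om R) (T I : finType).
Variables (V : Om -> T -> Z) (U : Om -> I).
Hypotheses (hV : iid P V) (hU : unif_indep P V U).

(** Appends one fresh draw; [option T] indexes the enlarged sample, on which permutations can
    exchange old and fresh points. *)
Definition snocv (w : Om * Z) (o : option T) : Z :=
  if o is Some t then V w.1 t else w.2.

Lemma iid_snoc : iid (P \x D)%E snocv.
Proof.
have [mV pV] := hV; split => [[t|]|A mA].
- exact: (measurableT_comp (mV t) measurable_fst).
- exact: measurable_snd.
have -> : snocv @^-1` rect A = (V @^-1` rect (fun t => A (Some t))) `*` (A None).
  apply/seteqP; split => w /=.
    by move=> h; split => [t|]; [exact: (h (Some t))|exact: (h None)].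
  by move=> [h1 h2] [t|]; [exact: h1|exact: h2].
have mR : measurable (V @^-1` rect (fun t => A (Some t))).
  rewrite -[X in measurable X]setTI; apply: (iid_measurable hV) => //.
  exact: measurable_rect.
apply: etrans (product_measure1E _ _ mR (mA None)) _.
apply: (etrans (congr2 mule (pV _ (fun t => mA (Some t))) (esym (fineK _)))).
  exact: fin_num_measure.
rewrite -EFinM; congr (_%:E); rewrite (bigD1 (None : option T)) //= mulrC; congr (_ * _).
rewrite (reindex_omap Some id) => [|[t|]//].
by apply: eq_bigl => t /=; rewrite eqxx.
Qed.

Lemma unif_indep_snoc : unif_indep (P \x D)%E snocv (fun w => U w.1).
Proof.
have [mU pU] := hU; have mR (A : T -> set Z) : (forall i, measurable (A i)) ->
    measurable (V @^-1` rect A).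
  move=> mA; rewrite -[X in measurable X]setTI; apply: (iid_measurable hV) => //.
  exact: measurable_rect.
have eU u : (fun w : Om * Z => U w.1) @^-1` [set u] = (U @^-1` [set u]) `*` setT.
  by apply/seteqP; split => w //= [].
split => [u|A u mA]; first by rewrite eU; exact: measurableX.
have -> : snocv @^-1` rect A = (V @^-1` rect (fun t => A (Some t))) `*` (A None).
  apply/seteqP; split => w /=.
    by move=> h; split => [t|]; [exact: (h (Some t))|exact: (h None)].
  by move=> [h1 h2] [t|]; [exact: h1|exact: h2].
rewrite eU -setXI setIT.
have mR' := mR (fun t => A (Some t)) (fun t => mA (Some t)).
apply: etrans (product_measure1E _ _ (measurableI _ _ mR' (mU u)) (mA None)) _.
apply: etrans (congr1 (mule^~ _) (pU _ u (fun t => mA (Some t)))) _.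
rewrite -muleA; congr (_ * _)%E.
by apply/esym; exact: product_measure1E.
Qed.

End Extension.

End Iid.

(** * Second moment of the leave-one-out deviation *)

(** One coordinate of a uniform vector is independent of the others: translating that coordinate
    alone leaves [h] unchanged. *)
Lemma sum_ffun_factor (R : realType) (T : finType) (K : finZmodType) (q : T)
    (phi : K -> R) (h : {ffun T -> K} -> R) :
  (forall v v' : {ffun T -> K}, (forall t, t != q -> v t = v' t) -> h v = h v') ->
  \sum_(v : {ffun T -> K}) phi (v q) * h v = #|K|%:R^-1 * (\sum_c phi c) * \sum_v h v.
Proof.
move=> hq.
pose sh (c : K) (v : {ffun T -> K}) := [ffun t => if t == q then v t + c else v t].
have shK c : cancel (sh c) (sh (- c)).
  by move=> v; apply/ffunP => t; rewrite !ffunE; case: eqP => // _; rewrite addrK.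
have inj_sh c : injective (sh c) := can_inj (shK c).
have hsh c v : h (sh c v) = h v.
  by apply: hq => t tq; rewrite ffunE (negbTE tq).
have e c : \sum_(v : {ffun T -> K}) phi (v q) * h v = \sum_(v : {ffun T -> K}) phi (v q + c) * h v.
  rewrite (reindex_inj (inj_sh c)) /=; apply: eq_bigr => v _.
  by rewrite hsh ffunE eqxx.
have K0 : #|K|%:R != 0 :> R.
  by rewrite pnatr_eq0 -lt0n; apply/card_gt0P; exists 0.
apply: (mulfI K0); rewrite -!mulrA mulVKf //.
transitivity (\sum_(c : K) \sum_(v : {ffun T -> K}) phi (v q + c) * h v).
  rewrite -[#|K|]/(#|[eta predT : pred K]|) mulr_natl -sumr_const.
  by apply: eq_bigr => c _.
rewrite exchange_big /= mulr_sumr; apply: eq_bigr => v _.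
rewrite -mulr_suml; congr (_ * _).
by rewrite [RHS](reindex_inj (addrI (v q))).
Qed.

Section Expectation.
Context dZ (Z : measurableType dZ) (R : realType) (D : probability Z R).
Context d0 (Om : measurableType d0) (P : probability Om R) (T : finType).
Context (K : finZmodType) (V : Om -> T -> Z).
Hypothesis hV : iid D P V.

Definition nice (g : {ffun T -> K} -> pvec Z T -> R) := forall v, bmf (g v).

(* Expectation over the points and over independent uniform offsets [v]. *)
Definition Ex (g : {ffun T -> K} -> pvec Z T -> R) : R :=
  #|{ffun T -> K}|%:R^-1 * \sum_v mean P (fun om => g v (V om)).

Lemma nice_comp g v : nice g -> bmf (fun om => g v (V om)).
Proof. by move=> hg; exact: (bmf_comp (iid_measurable hV) (hg v)). Qed.

Lemma card_ffun_neq0 : #|{ffun T -> K}|%:R != 0 :> R.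
Proof. by rewrite pnatr_eq0 -lt0n; apply/card_gt0P; exists [ffun=> 0]. Qed.

Lemma Ex_cst c : Ex (fun _ _ => c) = c.
Proof.
rewrite /Ex; under eq_bigr do rewrite mean_cst.
by rewrite sumr_const -[c *+ _]mulr_natl mulKf // card_ffun_neq0.
Qed.

Lemma ExD g g' : nice g -> nice g' -> Ex (fun v z => g v z + g' v z) = Ex g + Ex g'.
Proof.
move=> hg hg'; rewrite /Ex -mulrDr -big_split /=; congr (_ * _).
by apply: eq_bigr => v _; rewrite meanD //; exact: nice_comp.
Qed.

Lemma ExZ c g : nice g -> Ex (fun v z => c * g v z) = c * Ex g.
Proof.
move=> hg; rewrite /Ex [RHS]mulrCA; congr (_ * _); rewrite mulr_sumr.
by apply: eq_bigr => v _; rewrite meanZ //; exact: nice_comp.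
Qed.

Lemma ExB g g' : nice g -> nice g' -> Ex (fun v z => g v z - g' v z) = Ex g - Ex g'.
Proof.
move=> hg hg'; rewrite /Ex -mulrBr -sumrB /=; congr (_ * _).
by apply: eq_bigr => v _; rewrite meanB //; exact: nice_comp.
Qed.

Lemma Ex_sum (I : Type) (s : seq I) (p : pred I) (F : I -> {ffun T -> K} -> pvec Z T -> R) :
  (forall i, nice (F i)) ->
  Ex (fun v z => \sum_(i <- s | p i) F i v z) = \sum_(i <- s | p i) Ex (F i).
Proof.
move=> hF; elim: s => [|i s IH].
  rewrite big_nil -[RHS](Ex_cst 0); congr Ex.
  by apply/funext => v; apply/funext => z; rewrite big_nil.
rewrite big_cons -IH; case: ifP => pi; last first.
  by congr Ex; apply/funext => v; apply/funext => z; rewrite big_cons pi.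
have hs : nice (fun v z => \sum_(i <- s | p i) F i v z).
  by move=> v; apply: (@bmf_sum_cond _ (pvec Z T) R _ _ _ (fun i => F i v)) => j; exact: hF.
rewrite -(ExD (hF i) hs).
by congr Ex; apply/funext => v; apply/funext => z; rewrite big_cons pi.
Qed.

Lemma le_Ex g g' : nice g -> nice g' -> (forall v z, g v z <= g' v z) -> Ex g <= Ex g'.
Proof.
move=> hg hg' h; rewrite ler_wpM2l ?invr_ge0 // ler_sum // => v _.
by apply: le_mean => //; exact: nice_comp.
Qed.

Lemma Ex_perm (s : {perm T}) g : nice g ->
  Ex (fun v z => g [ffun t => v (s t)] (fun t => z (s t))) = Ex g.
Proof.
move=> hg; rewrite /Ex; congr (_ * _).
have inj_s : injective (fun v : {ffun T -> K} => [ffun t => v (s t)]).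
  move=> v v' /ffunP e; apply/ffunP => t.
  by have := e ((s^-1)%g t); rewrite !ffunE permKV.
rewrite [RHS](reindex_inj inj_s) /=; apply: eq_bigr => v _.
by apply: (iid_mean (g := g _) (iid_perm s hV) hV).
Qed.

Lemma Ex_factor q (phi : K -> R) g : nice g ->
  (forall (v v' : {ffun T -> K}) z, (forall t, t != q -> v t = v' t) -> g v z = g v' z) ->
  Ex (fun v z => phi (v q) * g v z) = #|K|%:R^-1 * (\sum_c phi c) * Ex g.
Proof.
move=> hg hq; rewrite /Ex [RHS]mulrCA; congr (_ * _).
rewrite -(sum_ffun_factor (q := q)) => [|v v' vv'].
  by apply: eq_bigr => v _; rewrite meanZ //; exact: nice_comp.
by congr mean; apply/funext => om; exact: hq.
Qed.

Lemma nice_fun (h : {ffun T -> K} -> R) : nice (fun v _ => h v).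
Proof. by move=> v; exact: bmf_cst. Qed.

Lemma niceD g g' : nice g -> nice g' -> nice (fun v z => g v z + g' v z).
Proof. by move=> hg hg' v; exact: bmfD. Qed.

Lemma niceB g g' : nice g -> nice g' -> nice (fun v z => g v z - g' v z).
Proof. by move=> hg hg' v; exact: bmfB. Qed.

Lemma niceM g g' : nice g -> nice g' -> nice (fun v z => g v z * g' v z).
Proof. by move=> hg hg' v; exact: bmfM. Qed.

Lemma nice_norm g : nice g -> nice (fun v z => `|g v z|).
Proof. by move=> hg v; exact: bmf_norm. Qed.

Lemma nice_sum (I : Type) (r : seq I) (p : pred I) (F : I -> {ffun T -> K} -> pvec Z T -> R) :
  (forall i, nice (F i)) -> nice (fun v z => \sum_(i <- r | p i) F i v z).
Proof.
move=> hF v; apply: (@bmf_sum_cond _ (pvec Z T) R _ _ _ (fun i => F i v)) => i.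
exact: hF.
Qed.

Lemma eq_Ex g g' : (forall v z, g v z = g' v z) -> Ex g = Ex g'.
Proof. by move=> h; congr Ex; apply/funext => v; apply/funext => z. Qed.

End Expectation.

Lemma mem_tperm_imset (T : finType) (x y a : T) (S : {set T}) :
  (a \in tperm x y @: S)%SET = (tperm x y a \in S).
Proof. by rewrite -{1}(tpermK x y a) mem_imset //; exact: perm_inj. Qed.

Lemma ler_mul_dist (R : realType) (a b a' b' : R) :
  0 <= a <= 1 -> 0 <= b <= 1 -> 0 <= a' <= 1 -> 0 <= b' <= 1 ->
  a * b <= a' * b' + (`|a - a'| + `|b - b'|).
Proof.
move=> /andP[a0 a1] /andP[b0 b1] /andP[a'0 a'1] /andP[b'0 b'1].
have h1 : (a - a') * b <= `|a - a'|.
  by rewrite (le_trans (ler_norm _)) // normrM ler_piMr // ger0_norm.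
have h2 : a' * (b - b') <= `|b - b'|.
  by rewrite (le_trans (ler_norm _)) // normrM ler_piMl // ger0_norm.
by lra.
Qed.

Section Stability.
Context dZ (Z : measurableType dZ) (R : realType) (D : probability Z R).
Context d0 (Om : measurableType d0) (P : probability Om R) (T : finType).
Context (K : finZmodType) (V : Om -> T -> Z).
Hypothesis hV : iid D P V.
(** [e S j v z] stands for the error at site [j] of the predictor trained on [S]; [r] and [s] are
    the fresh sites, [gam] the stability bound. *)
Variables (e : {set T} -> T -> {ffun T -> K} -> pvec Z T -> R) (B : {set T}).
Variables (r s : T) (K0 gam : R).
Hypothesis e01 : forall S j v z, 0 <= e S j v z <= 1.
Hypothesis e_nice : forall S j, nice (e S j).
Hypothesis e_perm : forall x y S j (v : {ffun T -> K}) (z : pvec Z T), x \in B -> y \in B ->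
  e S j [ffun t => v (tperm x y t)] (fun t => z (tperm x y t)) =
  e (tperm x y @: S)%SET (tperm x y j) v z.
Hypothesis e_indep : forall (S : {set T}) j q (v v' : {ffun T -> K}) (z : pvec Z T), q \notin S ->
  (forall t, t != q -> v t = v' t) -> e S j v z = e S j v' z.
Hypotheses (rB : r \in B) (sB : s \in B) (rs : r != s).
Hypotheses (K0_ge1 : 1 <= K0) (K0_le2 : K0 <= 2).
Hypothesis K0_mean : K0 * (#|K|%:R - 1) = #|K|%:R.

Local Notation Ex := (@Ex _ Z R _ Om P T K V).
Local Notation F0 := (~: [set r; s])%SET.
Local Notation J0 := (B :\: [set r; s])%SET.

Hypothesis stab : forall p, p \in J0 ->
  Ex (fun v z => `|e F0 r v z - e (F0 :\ p)%SET r v z|) <= gam.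

(** Importance weight of a wrong label. It has mean 1 and can be inserted or removed ([Ex_kap]) in
    front of anything that ignores the offset at [p]. *)
Definition kap (p : T) (v : {ffun T -> K}) : R := K0 * (v p != 0)%:R.

Ltac nice := repeat first [exact: e_nice | apply: nice_norm | apply: niceM | apply: niceB
  | apply: niceD | exact: (nice_fun Z (fun v => _ v)) | exact: nice_fun].

Ltac tperm_set :=
  apply/setP => ?; rewrite mem_tperm_imset !inE;
  repeat match goal with H : is_true (?x != ?y) |- _ => move/eqP: H => H end;
  case: tpermP => *; do ?[case: eqP => ?] => //=; congruence.

Lemma Ex_swap x y g : nice g ->
  Ex g = Ex (fun v z => g [ffun t => v (tperm x y t)] (fun t => z (tperm x y t))).
Proof. by move=> hg; rewrite (Ex_perm hV). Qed.

Lemma kap_ge0 p (v : {ffun T -> K}) : 0 <= kap p v.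
Proof. by rewrite mulr_ge0 // (le_trans _ K0_ge1). Qed.

Lemma kap_le p v : kap p v <= K0.
Proof. by rewrite /kap; case: (v p != 0); rewrite ?mulr1 // mulr0 (le_trans _ K0_ge1). Qed.

Lemma kap_sqr p v : kap p v * kap p v = K0 * kap p v.
Proof. by rewrite /kap; case: (v p != 0); rewrite ?mulr1 // !mulr0. Qed.

Lemma kap_swap x y p (v : {ffun T -> K}) : kap p [ffun t => v (tperm x y t)] = kap (tperm x y p) v.
Proof. by rewrite /kap ffunE. Qed.

Lemma Ex_kap q g : nice g ->
  (forall (v v' : {ffun T -> K}) z, (forall t, t != q -> v t = v' t) -> g v z = g v' z) ->
  Ex (fun v z => kap q v * g v z) = Ex g.
Proof.
move=> hg hq; rewrite (Ex_factor hV (fun c => K0 * (c != 0)%:R) hg hq).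
have -> : \sum_(c : K) K0 * (c != 0)%:R = #|K|%:R :> R.
  rewrite -mulr_sumr -[RHS]K0_mean; congr (_ * _).
  rewrite (eq_bigr (fun c => 1 - (c == 0)%:R)) => [|c _]; last first.
    by case: eqP; rewrite ?subrr ?subr0.
  rewrite sumrB sumr_const (bigD1 0) //= eqxx big1 ?addr0 // => c /negbTE -> //.
by rewrite mulVf ?mul1r // pnatr_eq0 -lt0n; apply/card_gt0P; exists 0.
Qed.

Let ExC (c : R) : Ex (fun _ _ => c) = c. Proof. exact: Ex_cst. Qed.

Let sr : s != r. Proof. by rewrite eq_sym. Qed.

Let J0P p : p \in J0 -> [/\ p \in B, p != r, p != s, r != p & s != p].
Proof. by rewrite !inE negb_or !(eq_sym p) => /andP[/andP[-> ->] ->]. Qed.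

Lemma stab_s p : p \in J0 ->
  Ex (fun v z => `|e F0 s v z - e (F0 :\ p)%SET s v z|) <= gam.
Proof.
move=> pJ; have [pB pr ps rp sp] := J0P pJ.
apply: le_trans (stab pJ); rewrite (Ex_swap r s); last by nice.
rewrite le_eqVlt; apply/predU1P; left; apply: eq_Ex => v z.
rewrite !e_perm // tpermR.
by congr `|e _ _ _ _ - e _ _ _ _|; tperm_set.
Qed.

(** Joint error at two fresh points with [p] left out: the common reference to which the terms of
    the expanded square are compared. Its value is never computed. *)
Definition indep2 p : R :=
  Ex (fun v z => e (F0 :\ p)%SET r v z * e (F0 :\ p)%SET s v z).

Lemma sq_le p : p \in J0 ->
  Ex (fun v z => e F0 r v z * e F0 s v z) <= indep2 p + 2 * gam.
Proof.
move=> pJ; have := stab pJ; have := stab_s pJ => h1 h2.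
apply: (@le_trans _ _ (Ex (fun v z => e (F0 :\ p)%SET r v z * e (F0 :\ p)%SET s v z
   + (`|e F0 r v z - e (F0 :\ p)%SET r v z| + `|e F0 s v z - e (F0 :\ p)%SET s v z|)))).
  by apply: (le_Ex hV); [nice|nice|move=> v z; exact: ler_mul_dist].
by rewrite !(ExD hV); [rewrite /indep2; lra|nice..].
Qed.

Definition cross p : R :=
  Ex (fun v z => kap p v * (e F0 r v z * e (F0 :\ p)%SET p v z)).

(** Exchanging [p] with [s] turns the left-out random point into a fresh one. Removing [s] from the
    training set that is tested at [r] costs [K0 * gam], after which the weight integrates out. *)
Lemma cross_ge p : p \in J0 -> indep2 p - K0 * gam <= cross p.
Proof.
move=> pJ; have [pB pr ps rp sp] := J0P pJ; have h1 := stab pJ.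
have -> : cross p = Ex (fun v z => kap s v *
    (e (s |: (F0 :\ p))%SET r v z * e (F0 :\ p)%SET s v z)).
  rewrite /cross (Ex_swap p s); last by nice.
  apply: eq_Ex => v z; rewrite kap_swap !e_perm // tpermL tpermD //.
  by congr (_ * (e _ _ _ _ * e _ _ _ _)); tperm_set.
have -> : indep2 p = Ex (fun v z => kap s v *
    (e (F0 :\ p)%SET r v z * e (F0 :\ p)%SET s v z)).
  rewrite Ex_kap //; first by nice.
  by move=> v v' z vv'; congr (_ * _); apply: (@e_indep _ _ s) => //; rewrite !inE eqxx orbT andbF.
have {}h1 : Ex (fun v z => `|e (s |: (F0 :\ p))%SET r v z - e (F0 :\ p)%SET r v z|) <= gam.
  apply: le_trans h1; rewrite le_eqVlt; apply/predU1P; left.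
  rewrite [RHS](Ex_swap p s); last by nice.
  apply: eq_Ex => v z; rewrite !e_perm // tpermD //.
  by congr `|e _ _ _ _ - e _ _ _ _|; tperm_set.
have K00 : 0 < K0 := lt_le_trans ltr01 K0_ge1.
have {}h1 := ler_wpM2l (ltW K00) h1.
rewrite lerBlDr; apply: le_trans (lerD (lexx _) h1); rewrite -(ExZ hV) -?(ExD hV); [|nice..].
apply: (le_Ex hV); [nice|nice|move=> v z].
rewrite -lerBlDl -mulrBr; apply: le_trans (ler_wpM2r (normr_ge0 _) (kap_le s v)).
apply: ler_wpM2l; first exact: kap_ge0.
have := ler_mul_dist (e01 (F0 :\ p)%SET r v z) (e01 (F0 :\ p)%SET s v z)
  (e01 (s |: (F0 :\ p))%SET r v z) (e01 (F0 :\ p)%SET s v z).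
by rewrite lerBlDl subrr normr0 addr0 distrC.
Qed.

Definition off p q : R :=
  Ex (fun v z => kap p v * kap q v * (e (F0 :\ p)%SET p v z * e (F0 :\ q)%SET q v z)).

(** Exchanging [q] with [r] brings [cross p] to the form of [off p q], with training sets [G1] and
    [G2]. One differs from its counterpart by two stability steps, the other by one, hence the 3. *)
Lemma off_le p q : p \in J0 -> q \in J0 -> p != q -> off p q <= cross p + 3 * K0 * gam.
Proof.
move=> pJ qJ pq; have [pB pr ps rp sp] := J0P pJ; have [qB qr qs rq sq] := J0P qJ.
have qp : q != p by rewrite eq_sym.
pose G1 := (r |: (F0 :\ p :\ q))%SET; pose G2 := (r |: (F0 :\ q))%SET.
have -> : cross p = Ex (fun v z => kap q v * (kap p v * (e G2 q v z * e G1 p v z))).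
  rewrite Ex_kap; last 2 first.
  - by nice.
  - move=> v v' z vv'; rewrite /kap vv' //; congr (_ * (_ * _)).
      by apply: (@e_indep _ _ q) => //; rewrite !inE !eqxx (negbTE qr).
    by apply: (@e_indep _ _ q) => //; rewrite !inE !eqxx (negbTE qr).
  rewrite /cross (Ex_swap q r); last by nice.
  apply: eq_Ex => v z; rewrite kap_swap !e_perm // tpermR tpermD //.
  by congr (_ * (e _ _ _ _ * e _ _ _ _)); rewrite /G1 /G2; tperm_set.
have d2 : Ex (fun v z => `|e (F0 :\ q)%SET q v z - e G2 q v z|) <= gam.
  apply: le_trans (stab qJ); rewrite le_eqVlt; apply/predU1P; left.
  rewrite [RHS](Ex_swap q r); last by nice.
  apply: eq_Ex => v z; rewrite !e_perm // tpermR distrC.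
  by congr `|e _ _ _ _ - e _ _ _ _|; rewrite /G2; tperm_set.
have d1 : Ex (fun v z => `|e (F0 :\ p)%SET p v z - e G1 p v z|) <= 2 * gam.
  have -> : Ex (fun v z => `|e (F0 :\ p)%SET p v z - e G1 p v z|) =
      Ex (fun v z => `|e (F0 :\ p)%SET r v z - e (F0 :\ q)%SET r v z|).
    rewrite [RHS](Ex_swap p r); last by nice.
    apply: eq_Ex => v z; rewrite !e_perm // tpermR.
    by congr `|e _ _ _ _ - e _ _ _ _|; rewrite /G1; tperm_set.
  apply: (@le_trans _ _ (Ex (fun v z => `|e F0 r v z - e (F0 :\ p)%SET r v z|
     + `|e F0 r v z - e (F0 :\ q)%SET r v z|))).
    apply: (le_Ex hV); [nice|nice|move=> v z].
    by rewrite (distrC (e F0 r v z) (e (F0 :\ p)%SET r v z)) ler_distD.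
  rewrite (ExD hV); [|nice..].
  by have := stab pJ; have := stab qJ; lra.
have kd1 : Ex (fun v z => kap p v * `|e (F0 :\ p)%SET p v z - e G1 p v z|) =
    Ex (fun v z => `|e (F0 :\ p)%SET p v z - e G1 p v z|).
  apply: Ex_kap; first by nice.
  move=> v v' z vv'; congr `|_ - _|; apply: (@e_indep _ _ p) => //;
    by rewrite !inE !eqxx ?andbF ?orbF // (negbTE pr).
have kd2 : Ex (fun v z => kap q v * `|e (F0 :\ q)%SET q v z - e G2 q v z|) =
    Ex (fun v z => `|e (F0 :\ q)%SET q v z - e G2 q v z|).
  apply: Ex_kap; first by nice.
  move=> v v' z vv'; congr `|_ - _|; apply: (@e_indep _ _ q) => //;
    by rewrite !inE !eqxx ?andbF ?orbF // (negbTE qr).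
have K00 : 0 <= K0 := le_trans ler01 K0_ge1.
(* In each error term one weight is bounded by [K0] and the other integrates to 1, because the
   difference ignores the offset at its own test point. *)
have h : K0 * Ex (fun v z => kap p v * `|e (F0 :\ p)%SET p v z - e G1 p v z|)
   + K0 * Ex (fun v z => kap q v * `|e (F0 :\ q)%SET q v z - e G2 q v z|) <= 3 * K0 * gam.
  have := ler_wpM2l K00 d1; have := ler_wpM2l K00 d2; rewrite kd1 kd2; lra.
apply: le_trans (lerD (lexx _) h); rewrite -!(ExZ hV) -?(ExD hV); [|nice..].
apply: (le_Ex hV); [nice|nice|move=> v z].
have kp0 := kap_ge0 p v; have kq0 := kap_ge0 q v.
have := ler_wpM2l (mulr_ge0 kp0 kq0) (ler_mul_dist (e01 (F0 :\ p)%SET p v z)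
  (e01 (F0 :\ q)%SET q v z) (e01 G1 p v z) (e01 G2 q v z)).
rewrite mulrDr mulrDr => /le_trans; apply.
have := ler_wpM2r (normr_ge0 (e (F0 :\ p)%SET p v z - e G1 p v z))
  (ler_wpM2l kp0 (kap_le q v)).
have := ler_wpM2r (normr_ge0 (e (F0 :\ q)%SET q v z - e G2 q v z))
  (ler_wpM2r kq0 (kap_le p v)).
by lra.
Qed.

(** The diagonal is at most K0 mu <= 2 mu, with mu the mean leave-one-out error, and the mean of (1
    - e_r)(1 - e_s) >= 0 gives 2 mu <= 1 + [indep2 p]. *)
Lemma diag_le p : p \in J0 -> off p p <= 1 + indep2 p.
Proof.
move=> pJ; have [pB pr ps rp sp] := J0P pJ.
have K00 : 0 <= K0 := le_trans ler01 K0_ge1.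
set mu := Ex (e (F0 :\ p)%SET p).
have mu0 : 0 <= mu.
  rewrite -(ExC 0).
  by apply: (le_Ex hV); [nice|nice|move=> v z; case/andP: (e01 (F0 :\ p)%SET p v z)].
have mur : mu = Ex (e (F0 :\ p)%SET r).
  rewrite /mu (Ex_swap p r); last by nice.
  apply: eq_Ex => v z; rewrite !e_perm // tpermL.
  by congr (e _ _ _ _); tperm_set.
have mus : mu = Ex (e (F0 :\ p)%SET s).
  rewrite /mu (Ex_swap p s); last by nice.
  apply: eq_Ex => v z; rewrite !e_perm // tpermL.
  by congr (e _ _ _ _); tperm_set.
have h1 : 0 <= 1 - mu - mu + indep2 p.
  rewrite {1}mur {1}mus -(ExC 1).
  rewrite -!(ExB hV) -?(ExD hV); [|nice..].
  rewrite -(ExC 0).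
  apply: (le_Ex hV); [nice|nice|move=> v z].
  case/andP: (e01 (F0 :\ p)%SET r v z) => _ h1; case/andP: (e01 (F0 :\ p)%SET s v z) => _ h2.
  have := mulr_ge0 (_ : 0 <= 1 - e (F0 :\ p)%SET r v z) (_ : 0 <= 1 - e (F0 :\ p)%SET s v z).
  by rewrite !subr_ge0 => /(_ h1 h2); lra.
apply: (@le_trans _ _ (K0 * mu)); last by have := ler_wpM2r mu0 K0_le2; lra.
rewrite /mu -(Ex_kap (q := p)); last 2 first.
- by nice.
- by move=> v v' z vv'; apply: (@e_indep _ _ p) => //; rewrite !inE eqxx.
rewrite -(ExZ hV); last by nice.
apply: (le_Ex hV); [nice|nice|move=> v z].
rewrite kap_sqr -mulrA ler_wpM2l // ler_wpM2l ?kap_ge0 //.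
by case/andP: (e01 (F0 :\ p)%SET p v z) => h0 h; rewrite ler_piMr.
Qed.

Definition loomean (v : {ffun T -> K}) (z : pvec Z T) : R :=
  #|J0|%:R^-1 * \sum_(p in J0) kap p v * e (F0 :\ p)%SET p v z.

Lemma nice_loomean : nice loomean.
Proof.
apply: niceM; first exact: nice_fun.
by apply: (@nice_sum _ Z R T K _ _ _ (fun p v z => kap p v * e (F0 :\ p)%SET p v z)) => p; nice.
Qed.

Lemma loomean_swap (v : {ffun T -> K}) (z : pvec Z T) :
  loomean [ffun t => v (tperm r s t)] (fun t => z (tperm r s t)) = loomean v z.
Proof.
congr (_ * _); apply: eq_bigr => p pJ; have [pB pr ps rp sp] := J0P pJ.
by rewrite kap_swap e_perm // tpermD //; congr (_ * e _ _ _ _); tperm_set.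
Qed.

(** Given the sample, the two fresh points are independent, so this product stands for the square of
    the population error minus [loomean]. *)
Lemma Ex_loo_sqr : (0 < #|J0|)%N ->
  Ex (fun v z => (e F0 r v z - loomean v z) * (e F0 s v z - loomean v z))
    <= #|J0|%:R^-1 + (2 + 4 * K0) * gam.
Proof.
move=> m0; set m : R := #|J0|%:R.
have m0' : 0 < m by rewrite ltr0n.
have hB := nice_loomean.
pose c1 p v z := kap p v * (e F0 r v z * e (F0 :\ p)%SET p v z).
pose c2 p q v z := kap p v * kap q v * (e (F0 :\ p)%SET p v z * e (F0 :\ q)%SET q v z).
have n1 p : nice (c1 p) by rewrite /c1; nice.
have n2 p q : nice (c2 p q) by rewrite /c2; nice.
have n3 p : nice (fun v z => \sum_(q in J0) c2 p q v z) by exact: (@nice_sum _ Z R T K _ _ _ (c2 p)).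
have eBr : Ex (fun v z => loomean v z * e F0 r v z) = m^-1 * \sum_(p in J0) cross p.
  rewrite -(@Ex_sum _ Z R D _ Om P T K V hV _ _ _ (c1)) // -(ExZ hV);
    last exact: (@nice_sum _ Z R T K _ _ _ c1).
  apply: eq_Ex => v z; rewrite /loomean -mulrA; congr (_ * _).
  by rewrite mulr_suml; apply: eq_bigr => p _; rewrite /c1; ring.
have eBs : Ex (fun v z => loomean v z * e F0 s v z) = m^-1 * \sum_(p in J0) cross p.
  rewrite -eBr [RHS](Ex_swap r s); last by apply: niceM.
  apply: eq_Ex => v z; rewrite loomean_swap e_perm // tpermL.
  by congr (_ * e _ _ _ _); tperm_set.
have eBB : Ex (fun v z => loomean v z * loomean v z) =
    m^-1 * (m^-1 * \sum_(p in J0) \sum_(q in J0) off p q).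
  under eq_bigr do rewrite -(@Ex_sum _ Z R D _ Om P T K V hV _ _ _ (c2 _)) //.
  rewrite -(@Ex_sum _ Z R D _ Om P T K V hV _ _ _ (fun p v z => \sum_(q in J0) c2 p q v z)) //.
  have n4 := @nice_sum _ Z R T K _ (index_enum T) (mem J0) _ n3.
  rewrite -(ExZ hV) // -(ExZ hV); last by apply: niceM; [exact: nice_fun|].
  apply: eq_Ex => v z; rewrite /loomean mulrACA -mulrA; congr (_ * _); congr (_ * _).
  rewrite mulr_suml; apply: eq_bigr => p _; rewrite mulr_sumr; apply: eq_bigr => q _.
  by rewrite /c2; ring.
have h0 : Ex (fun v z => (e F0 r v z - loomean v z) * (e F0 s v z - loomean v z)) =
   Ex (fun v z => e F0 r v z * e F0 s v z) - Ex (fun v z => loomean v z * e F0 s v z) -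
   Ex (fun v z => loomean v z * e F0 r v z) + Ex (fun v z => loomean v z * loomean v z).
  rewrite -!(ExB hV) -?(ExD hV); 
    [|repeat first [exact: hB | exact: e_nice | apply: niceM | apply: niceB | apply: niceD]..].
  by apply: eq_Ex => v z; ring.
rewrite h0 eBr eBs eBB.
set sq := Ex _.
have hrow p : p \in J0 -> \sum_(q in J0) off p q <=
    1 + indep2 p + (m - 1) * (cross p + 3 * K0 * gam).
  move=> pJ; rewrite (bigD1 p) //= lerD ?diag_le //.
  have -> : m - 1 = \sum_(q in J0 | q != p) 1.
    by rewrite /m -sumr_const (bigD1 p pJ) /= addrAC subrr add0r.
  rewrite mulr_suml; apply: ler_sum => q /andP[qJ qp].
  by rewrite mul1r off_le // eq_sym.
rewrite -(ler_pM2l m0') -(ler_pM2l m0').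
have mE x : m * x = \sum_(p in J0) x by rewrite /m mulr_natl sumr_const.
have mV : m * m^-1 = 1 by rewrite mulfV // gt_eqF.
apply: (@le_trans _ _ (\sum_(p in J0) (m * (indep2 p + 2 * gam) - 2 * m * cross p +
  (1 + indep2 p + (m - 1) * (cross p + 3 * K0 * gam))))).
  have h1 : m * (m * sq) <= \sum_(p in J0) m * (indep2 p + 2 * gam).
    rewrite -mulr_sumr ler_pM2l // mE.
    by apply: ler_sum => p pJ; exact: sq_le.
  have h2 : \sum_(p in J0) \sum_(q in J0) off p q <=
      \sum_(p in J0) (1 + indep2 p + (m - 1) * (cross p + 3 * K0 * gam)).
    exact: ler_sum.
  apply: (@le_trans _ _ (\sum_(p in J0) m * (indep2 p + 2 * gam) -
      2 * m * \sum_(p in J0) cross p +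
      \sum_(p in J0) (1 + indep2 p + (m - 1) * (cross p + 3 * K0 * gam)))); last first.
    by rewrite mulr_sumr -sumrB -big_split.
  apply: le_trans (lerD (lerB h1 (lexx _)) h2).
  rewrite !mulrDr !mulrN !(mulrA m m^-1) mV !mul1r (mulrA m m^-1) mV mul1r.
  by rewrite le_eqVlt; apply/predU1P; left; ring.
rewrite mulrDr mV mE; apply: ler_sum => p pJ.
have g0 : 0 <= gam.
  apply: le_trans (stab pJ); rewrite -(ExC 0); apply: (le_Ex hV); [nice|nice|].
  by move=> v z; exact: normr_ge0.
have Kg : 0 <= K0 * gam := mulr_ge0 (le_trans ler01 K0_ge1) g0.
(* In total [cross p] has coefficient -(m + 1) and [indep2 p] has m + 1: only the lower bound on
   [cross] is needed and the reference term cancels. *)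
have h := ler_wpM2l (_ : 0 <= m + 1) (cross_ge pJ).
have {}h := h (addr_ge0 (ltW m0') ler01).
lra.
Qed.

End Stability.

(** * Second moment of the class balance *)

Section Exchangeable.
Context dZ (Z : measurableType dZ) (R : realType) (D : probability Z R).
Context d0 (Om : measurableType d0) (P : probability Om R) (T : finType).
Context (V : Om -> T -> Z).
Hypothesis hV : iid D P V.
Variables (f : T -> pvec Z T -> R) (N : {set T}).
Hypotheses (f01 : forall t z, 0 <= f t z <= 1) (f_bmf : forall t, bmf (f t)).
Hypothesis f_perm : forall x y t z, x \in N -> y \in N ->
  f t (fun i => z (tperm x y i)) = f (tperm x y t) z.
Hypothesis N_gt1 : (1 < #|N|)%N.

Local Notation E g := (mean P (fun om => g (V om))).

Lemma mean_swap x y (g : pvec Z T -> R) : bmf g ->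
  E g = E (fun z => g (fun i => z (tperm x y i))).
Proof. by move=> hg; apply: (iid_mean (g := g) hV (iid_perm (tperm x y) hV)). Qed.

Lemma mean_exchangeable a b s t : a \in N -> b \in N -> s \in N -> t \in N ->
  a != b -> s != t -> E (fun z => f s z * f t z) = E (fun z => f a z * f b z).
Proof.
move=> aN bN sN tN ab st.
pose t' := tperm s a t.
have t'N : t' \in N by rewrite /t'; case: tpermP.
have t'a : t' != a by rewrite /t' -{2}(tpermL s a) (inj_eq perm_inj) eq_sym.
apply: (etrans (mean_swap s a (bmfM (f_bmf s) (f_bmf t)))).
transitivity (E (fun z => f a z * f t' z)).
  by congr mean; apply/funext => om; rewrite !f_perm // tpermL.
apply: (etrans (mean_swap t' b (bmfM (f_bmf a) (f_bmf t')))).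
congr mean; apply/funext => om; rewrite !f_perm // tpermL tpermD //.
by rewrite eq_sym.
Qed.

(** With c = E f_s f_t for s <> t, the left side is the sum of w_t^2 (E f_t^2 - c) plus c (sum w)^2.
    Here E f_t^2 - c = E (f_s - f_t)^2 / 2 <= 1/2, and c <= 1. *)
Lemma mean_exchangeable_sqr (w : T -> R) :
  E (fun z => (\sum_(t in N) w t * f t z) ^+ 2) <=
  2^-1 * (\sum_(t in N) w t ^+ 2) + (\sum_(t in N) w t) ^+ 2.
Proof.
have bE (g : pvec Z T -> R) : bmf g -> bmf (fun om => g (V om)) by exact: bmf_comp (iid_measurable hV).
have f0 t z : 0 <= f t z by case/andP: (f01 t z).
have f1 t z : f t z <= 1 by case/andP: (f01 t z).
have /card_gt1P[a [b [aN bN ab]]] := N_gt1.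
pose c := E (fun z => f a z * f b z).
pose d := fun t => E (fun z => f t z * f t z).
have bff s t : bmf (fun z : pvec Z T => f s z * f t z) by exact: bmfM.
have c01 : 0 <= c <= 1.
  apply/andP; split.
    by apply: mean_ge0 => om; rewrite mulr_ge0.
  rewrite -(mean_cst P 1); apply: le_mean; [exact: bE (bff a b)|exact: bmf_cst|move=> om].
  by rewrite mulr_ile1.
have dc t : t \in N -> d t - c <= 2^-1.
  move=> tN; have [s sN st] : exists2 s, s \in N & s != t.
    case: (eqVneq a t) => [<-|at_]; last by exists a.
    by exists b; rewrite // eq_sym.
  have -> : c = E (fun z => f s z * f t z) by apply/esym/mean_exchangeable.
  have dst : d t = d s.
    apply: (etrans (mean_swap s t (bff t t))).
    by congr mean; apply/funext => om; rewrite !f_perm // tpermR.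
  have h : E (fun z => (f s z - f t z) * (f s z - f t z)) <= 1.
    rewrite -(mean_cst P 1); apply: le_mean; [|exact: bmf_cst|move=> om].
      have h := bmfB (f_bmf s) (f_bmf t); exact: bE (bmfM h h).
    have := f0 s (V om); have := f0 t (V om); have := f1 s (V om); have := f1 t (V om); nra.
  have e : E (fun z => (f s z - f t z) * (f s z - f t z)) =
      d s - 2 * E (fun z => f s z * f t z) + d t.
    have h1 := bE _ (bff s t); have h2 := bE _ (bff s s); have h3 := bE _ (bff t t).
    have h4 := bmfM (bmf_cst _ (2 : R)) h1.
    rewrite /d -(meanZ P 2 h1) -(meanB P h2 h4) -(meanD P (bmfB h2 h4) h3).
    by congr mean; apply/funext => om; ring.
  by move: h; rewrite e -dst; lra.
have -> : E (fun z => (\sum_(t in N) w t * f t z) ^+ 2) =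
    \sum_(s in N) \sum_(t in N) w s * w t * E (fun z => f s z * f t z).
  transitivity (E (fun z => \sum_(s in N) \sum_(t in N) w s * w t * (f s z * f t z))).
    congr mean; apply/funext => om; rewrite expr2 mulr_suml; apply: eq_bigr => s _.
    by rewrite mulr_sumr; apply: eq_bigr => t _; ring.
  have h2 s t := bmfM (bmf_cst _ (w s * w t)) (bE _ (bff s t)).
  rewrite mean_sum_cond; last by move=> s; exact: bmf_sum_cond.
  apply: eq_bigr => s _; rewrite mean_sum_cond //.
  by apply: eq_bigr => t _; rewrite meanZ //; exact: bE (bff s t).
have -> : \sum_(s in N) \sum_(t in N) w s * w t * E (fun z => f s z * f t z) =
    \sum_(t in N) w t ^+ 2 * (d t - c) + c * (\sum_(t in N) w t) ^+ 2.
  rewrite expr2 mulr_suml mulr_sumr -big_split /=; apply: eq_bigr => s sN.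
  rewrite (bigD1 s sN) /= [in RHS](bigD1 s sN) /=.
  rewrite (eq_bigr (fun t => w s * w t * c)) => [|t /andP[tN ts]]; last first.
    by congr (_ * _); apply: mean_exchangeable => //; rewrite eq_sym.
  by rewrite -mulr_suml -mulr_sumr -/(d s); ring.
case/andP: c01 => c0 c1; apply: lerD.
  rewrite mulr_sumr; apply: ler_sum => t tN.
  by rewrite mulrC ler_wpM2r ?sqr_ge0 // dc.
by rewrite ler_piMl // sqr_ge0.
Qed.

End Exchangeable.

Section Balance.
Context dZ (Z : measurableType dZ) (R : realType) (D : probability Z R).
Context d0 (Om : measurableType d0) (P : probability Om R) (T : finType).
Context (K : finZmodType) (V : Om -> T -> Z).
Hypothesis hV : iid D P V.
Variables (f : {ffun T -> K} -> T -> pvec Z T -> R) (C J0 : {set T}).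
Hypotheses (CJ0 : forall t, t \in C -> t \notin J0) (C_gt1 : (1 < #|C|)%N).
Hypotheses (J0_gt0 : (0 < #|J0|)%N) (J0_le : (#|J0| <= #|C|)%N).
Hypotheses (f01 : forall v t z, 0 <= f v t z <= 1) (f_bmf : forall v t, bmf (f v t)).

(* For a fixed offset vector these points are exchangeable. *)
Definition neutral (v : {ffun T -> K}) : {set T} :=
  (C :|: [set b in J0 | v b == 0])%SET.

Hypothesis f_perm : forall v x y t z, x \in neutral v -> y \in neutral v ->
  f v t (fun i => z (tperm x y i)) = f v (tperm x y t) z.

Local Notation Ex := (@Ex _ Z R _ Om P T K V).
Local Notation k := (#|K|%:R : R).
Local Notation n := (#|C|%:R : R).
Local Notation m := (#|J0|%:R : R).

Definition balance (v : {ffun T -> K}) (z : pvec Z T) : R :=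
  n^-1 * (\sum_(t in C) f v t z) -
  k / m * (\sum_(b in J0) (v b == 0)%:R * f v b z).

Lemma nice_balance : nice balance.
Proof.
move=> v; apply: bmfB; apply: bmfM; try exact: bmf_cst.
  exact: (@bmf_sum_cond _ (pvec Z T) R _ _ _ (f v)).
apply: (@bmf_sum_cond _ (pvec Z T) R _ _ _ (fun b z => (v b == 0)%:R * f v b z)) => b.
by apply: bmfM => //; exact: bmf_cst.
Qed.

(** Has mean 0 and variance k - 1 under a uniform offset. *)
Definition centred (c : K) : R := 1 - k * (c == 0)%:R.

Lemma Ex_balance_sqr : Ex (fun v z => balance v z ^+ 2) <= (3 * k - 1) / (2 * m).
Proof.
have k0 : 0 < k by rewrite ltr0n; apply/card_gt0P; exists 0.
have m0 : 0 < m by rewrite ltr0n.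
have nm : m <= n by rewrite ler_nat.
have n0 : 0 < n := lt_le_trans m0 nm.
pose w (v : {ffun T -> K}) t := if t \in C then n^-1 else - (k / m).
have sumN (v : {ffun T -> K}) (F : T -> R) : \sum_(t in neutral v) F t =
    \sum_(t in C) F t + \sum_(b in J0) (v b == 0)%:R * F b.
  rewrite (big_setID C) /=; congr (_ + _).
    by apply: eq_bigl => t; rewrite !inE; case: (t \in C) => //; rewrite ?andbF.
  rewrite [RHS](bigID (fun b => v b == 0)) /= [X in _ = _ + X]big1 => [|b]; last first.
    by case/andP => _ /negbTE ->; rewrite mul0r.
  rewrite addr0; apply: eq_big => [t|t].
    by rewrite !inE; case: (boolP (t \in C)) => //= /CJ0 /negbTE ->.
  rewrite !inE => /andP[tC]; rewrite (negbTE tC) /= => /andP[_ ->].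
  by rewrite mul1r.
have wC v t : t \in C -> w v t = n^-1 by rewrite /w => ->.
have wJ v b : b \in J0 -> w v b = - (k / m) by rewrite /w; case: ifP => // /CJ0 /negbTE ->.
have bal v z : balance v z = \sum_(t in neutral v) w v t * f v t z.
  rewrite sumN /balance !mulr_sumr -sumrN; congr (_ + _).
    by apply: eq_bigr => t /(wC v) ->.
  by apply: eq_bigr => b /(wJ v) ->; ring.
pose S (v : {ffun T -> K}) : R := \sum_(b in J0) centred (v b).
have mE : m = \sum_(b in J0) 1 by rewrite sumr_const.
have qS (v : {ffun T -> K}) : \sum_(b in J0) (v b == 0)%:R = k^-1 * (m - S v).
  rewrite mE /S -sumrB mulr_sumr; apply: eq_bigr => b _.
  by rewrite /centred opprB addrC subrK mulKf // gt_eqF.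
(* For fixed offsets the weights sum to S/m, and their squares to 1/n + (k / m^2)(m - S). *)
have h v : mean P (fun om => balance v (V om) ^+ 2) <=
    2^-1 * (n^-1 + k / m ^+ 2 * (m - S v)) + (m^-1 * S v) ^+ 2.
  have -> : (fun om => balance v (V om) ^+ 2) =
     (fun om => (\sum_(t in neutral v) w v t * f v t (V om)) ^+ 2).
    by apply/funext => om; rewrite bal.
  have N1 : (1 < #|neutral v|)%N.
    by apply: leq_trans C_gt1 _; apply: subset_leq_card; exact: finset.subsetUl.
  apply: (le_trans (mean_exchangeable_sqr hV (f01 v) (f_bmf v) (@f_perm v) N1 (w v))).
  have e1 g : \sum_(t in C) g (w v t) = n * g n^-1.
    rewrite (eq_bigr (fun=> g n^-1)) => [|t /(wC v) -> //].
    by rewrite sumr_const mulr_natl.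
  have e2 g : \sum_(b in J0) (v b == 0)%:R * g (w v b) = k^-1 * (m - S v) * g (- (k / m)).
    rewrite -qS mulr_suml; apply: eq_bigr => b /(wJ v) -> //.
  rewrite !sumN (e1 (fun x => x ^+ 2)) (e1 id) (e2 (fun x => x ^+ 2)) (e2 id).
  rewrite le_eqVlt; apply/predU1P; left.
  by move: (S v) => Sv; field; rewrite !gt_eqF.
have delta1 : \sum_(c : K) (c == 0)%:R = 1 :> R.
  by rewrite (bigD1 0) //= eqxx big1 ?addr0 // => c /negbTE ->.
have cen1 : \sum_c centred c = 0.
  by rewrite /centred sumrB sumr_const -mulr_sumr delta1 mulr1 subrr.
have cen2 : \sum_c centred c ^+ 2 = k * (k - 1).
  rewrite (eq_bigr (fun c => 1 + (k ^+ 2 - 2 * k) * (c == 0)%:R)) => [|c _]; last first.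
    by rewrite /centred; case: eqP => _ /=; ring.
  by rewrite big_split /= sumr_const -mulr_sumr delta1; ring.
have nf (g : {ffun T -> K} -> R) : nice (fun v (_ : pvec Z T) => g v) by exact: nice_fun.
have ES : Ex (fun v _ => S v) = 0.
  rewrite (@Ex_sum _ Z R D _ Om P T K V hV _ _ _ (fun b v _ => centred (v b))) //.
  apply: big1 => b _.
  rewrite (@eq_Ex _ Z R _ Om P T K V _ (fun v z => centred (v b) * 1)) => [|v z]; last by rewrite mulr1.
  by rewrite (Ex_factor hV centred (nf (fun=> 1))) // cen1 mulr0 mul0r.
have ES2 : Ex (fun v _ => S v ^+ 2) = m * (k - 1).
  rewrite (@eq_Ex _ Z R _ Om P T K V _ (fun v z => \sum_(b in J0) \sum_(b' in J0) centred (v b) * centred (v b')))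
    => [|v z]; last first.
    by rewrite expr2 mulr_suml; apply: eq_bigr => b _; rewrite mulr_sumr.
  rewrite (@Ex_sum _ Z R D _ Om P T K V hV _ _ _
    (fun b v _ => \sum_(b' in J0) centred (v b) * centred (v b'))) //.
  rewrite mE mulr_suml; apply: eq_bigr => b bJ; rewrite mul1r.
  rewrite (@Ex_sum _ Z R D _ Om P T K V hV _ _ _
    (fun b' v _ => centred (v b) * centred (v b'))) //.
  rewrite (bigD1 b) //= big1 ?addr0 => [|b' /andP[b'J b'b]]; last first.
    rewrite (Ex_factor hV centred (nf (fun v => centred (v b')))) ?cen1 ?mulr0 ?mul0r //.
    by move=> v v' _ ->.
  rewrite (@eq_Ex _ Z R _ Om P T K V _ (fun v z => centred (v b) ^+ 2 * 1)) => [|v z]; last by rewrite mulr1.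
  rewrite (Ex_factor hV (fun c => centred c ^+ 2) (nf (fun=> 1))) // cen2 Ex_cst mulr1.
  by rewrite mulKf // gt_eqF.
apply: (@le_trans _ _ (Ex (fun v _ =>
    2^-1 * (n^-1 + k / m ^+ 2 * (m - S v)) + (m^-1 * S v) ^+ 2))).
  rewrite ler_wpM2l ?invr_ge0 // ler_sum // => v _.
  by rewrite [leRHS]mean_cst.
rewrite (@eq_Ex _ Z R _ Om P T K V _ (fun v z => (2^-1 * (n^-1 + k / m) - 2^-1 * (k / m ^+ 2) * S v)
   + m^-2 * S v ^+ 2)) => [|v z]; last by move: (S v) => Sv; field; rewrite !gt_eqF.
rewrite (ExD hV) // (ExB hV) // !(ExZ hV) // Ex_cst ES ES2 mulr0 subr0.
have -> : m^-2 * (m * (k - 1)) = (k - 1) / m by field; rewrite gt_eqF.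
have h2 : n^-1 <= m^-1 by rewrite lef_pV2.
have -> : (3 * k - 1) / (2 * m) = 2^-1 * (m^-1 + k / m) + (k - 1) / m.
  by field; rewrite gt_eqF.
by rewrite lerD2r ler_pM2l ?lerD2r.
Qed.

End Balance.

(** * Relabeling the random points of one sample *)

Section Relabeling.
Variables (R : realType) (d k n m : nat) (lam : R).
Hypothesis lam_ge0 : 0 <= lam.
Variables (x : 'I_n + 'I_m -> 'rV[R]_d) (t : 'I_n + 'I_m -> 'I_k).
Local Notation T0 := ('I_n + 'I_m)%type.
Local Notation full := [set: T0]%SET.
Implicit Types u v : {ffun 'I_m -> 'I_k}.

Definition relabel u (i : T0) : 'I_k := if i is inr b then u b else t i.

Definition rscore u (b : 'I_m) : 'rV[R]_k := score lam x (relabel u) full (inr b).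

Lemma rscore_mono u v : 0 <= \sum_b ((rscore u b 0 (u b) - rscore u b 0 (v b))
  - (rscore v b 0 (u b) - rscore v b 0 (v b))).
Proof.
have := score_monotone lam_ge0 x (relabel u) (relabel v) full.
rewrite (eq_bigl predT) => [|i]; last by rewrite inE.
rewrite big_sumType /= [X in X + _]big1 ?add0r // => a _.
by rewrite !subrr.
Qed.

Lemma rscore_class u v a : (forall b, (u b == a) = (v b == a)) ->
  forall b, rscore u b 0 a = rscore v b 0 a.
Proof.
move=> uv b; rewrite /rscore !scoreE; apply: eq_bigr => -[i|i] _ //=.
by rewrite ![a == _]eq_sym uv.
Qed.

Lemma rscore_pair u v a c : a != c ->
  (forall b, (u b \in [:: a; c]) = (v b \in [:: a; c])) ->
  forall b, rscore u b 0 a + rscore u b 0 c = rscore v b 0 a + rscore v b 0 c.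
Proof.
move=> ac uv b; rewrite /rscore !scoreE -!big_split; apply: eq_bigr => -[i|i] _ //=.
rewrite -!mulrDr; congr (_ * _); have := uv i; rewrite !inE ![_ == u i]eq_sym ![_ == v i]eq_sym.
have H y : ((y == a) || (y == c))%:R = (y == a)%:R + (y == c)%:R :> R.
  by case: (eqVneq y a) => [->|_] /=; rewrite ?(negbTE ac) ?addr0 ?add0r.
by move=> e; rewrite -!H e.
Qed.

Definition tlab (b : 'I_m) : 'I_k := t (inr b).

(** Everything reduces to the pointwise inequality [hb], summed over the random points. *)
Lemma decomposition u (ED : R) w : (0 < n)%N -> (0 < m)%N -> (1 < k)%N ->
  w = learn lam x (relabel u) full ->
  ED - n%:R^-1 * (\sum_a err01 w (x (inl a)) (t (inl a)))
    + k%:R * (m%:R^-1 * \sum_b err01 w (x (inr b)) (u b)) - (k%:R - 1)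
  <= (n%:R^-1 * (\sum_a (1 - err01 w (x (inl a)) (t (inl a))))
       - k%:R / m%:R * (\sum_b (u b == tlab b)%:R * (1 - err01 w (x (inr b)) (tlab b))))
   + (ED - m%:R^-1 * \sum_b k%:R / (k%:R - 1) * (u b != tlab b)%:R *
        err01 (learn lam x (relabel u) (full :\ inr b)) (x (inr b)) (tlab b))
   + k%:R / (k%:R - 1) / m%:R * excess rscore tlab u.
Proof.
move=> n0 m0 k1 wE.
have n0' : n%:R != 0 :> R by rewrite pnatr_eq0 -lt0n.
have m0' : 0 < m%:R :> R by rewrite ltr0n.
have k1' : 0 < k%:R - 1 :> R by rewrite subr_gt0 ltr1n.
have k2 : (k - 2)%N%:R = k%:R - 2 :> R by rewrite natrB.
set eu := fun b => err01 w (x (inr b)) (u b).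
set et := fun b => err01 w (x (inr b)) (tlab b).
set el := fun b => err01 (learn lam x (relabel u) (full :\ inr b)) (x (inr b)) (tlab b).
set K0 := k%:R / (k%:R - 1).
have K00 : 0 <= K0 by rewrite divr_ge0 // ltW.
(* For u <> t, a point where [u] wins then weighs exactly [K0], the same as a doubly wrong one. By
   [argmaxs_loo] a leave-one-out error falls in one of these two cases. *)
have K0E : k%:R - K0 * (k%:R - 2) = K0 by rewrite /K0; field; rewrite gt_eqF.
have hb b : K0 * (u b != tlab b)%:R * el b <=
    K0 * ((wrong2 rscore tlab u b)%:R - (k - 2)%N%:R * (rightR rscore tlab u b)%:R) +
    k%:R * (1 - eu b) - k%:R * ((u b == tlab b)%:R * (1 - et b)).
  have euE : eu b = (u b \notin argmaxs (rscore u b))%:R by rewrite /eu wE.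
  have etE : et b = (tlab b \notin argmaxs (rscore u b))%:R by rewrite /et wE.
  rewrite /wrong2 /rightR euE etE k2.
  have [utb|utb] := eqVneq (u b) (tlab b); rewrite /=.
    by rewrite utb; lra.
  have elE : el b = (tlab b \notin argmaxs
      (score lam x (relabel u) (full :\ inr b) (inr b)))%:R by [].
  have loo := @argmaxs_loo R d k lam T0 lam_ge0 x (relabel u) full (inr b) (tlab b).
  rewrite inE eq_sym in loo; have {}loo := loo isT utb; rewrite elE -/(rscore u b) in loo *.
  have := K0E; move: loo.
  case: (tlab b \in argmaxs (score _ _ _ _ _)); case: (tlab b \in argmaxs (rscore u b)) => /= loo;
    case: (u b \in argmaxs (rscore u b)) => /=; try (by have := loo isT); nra.
pose A1 : R := \sum_b K0 * (u b != tlab b)%:R * el b.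
pose A2 : R := excess rscore tlab u.
pose A3 : R := \sum_b (1 - eu b).
pose A4 : R := \sum_b (u b == tlab b)%:R * (1 - et b).
have hs : A1 <= K0 * A2 + k%:R * A3 - k%:R * A4.
  rewrite /A2 /excess /A3 /A4 !mulr_sumr -big_split -sumrB; exact: ler_sum.
rewrite -/A1 -/A4 -/A2 !sumrB !sumr_const !card_ord.
set es := \sum_a _; set eus := \sum_b _.
have A3E : A3 = m%:R - eus by rewrite /A3 sumrB sumr_const card_ord.
rewrite A3E in hs.
have {}hs : m%:R^-1 * A1 <= m%:R^-1 * (K0 * A2 + k%:R * (m%:R - eus) - k%:R * A4).
  by rewrite ler_pM2l ?invr_gt0.
have e1 : m%:R^-1 * (K0 * A2 + k%:R * (m%:R - eus) - k%:R * A4) =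
  K0 / m%:R * A2 + k%:R - k%:R * (m%:R^-1 * eus) - k%:R / m%:R * A4.
  by field; rewrite gt_eqF.
have e2 : n%:R^-1 * (n%:R - es) = 1 - n%:R^-1 * es by rewrite mulrBr mulVf.
by rewrite e2; rewrite e1 in hs; lra.
Qed.


End Relabeling.

(** * Numerical bounds *)

Section Numerics.
Variable R : realType.
Implicit Types x y k a b c : R.

Lemma le_sqrtr a b : 0 <= b -> b ^+ 2 <= a -> b <= Num.sqrt a.
Proof. by move=> b0 h; rewrite -(ger0_norm b0) -sqrtr_sqr ler_wsqrtr. Qed.

Lemma ge_sqrtr a b : 0 <= b -> a <= b ^+ 2 -> Num.sqrt a <= b.
Proof. by move=> b0 h; rewrite -(ger0_norm b0) -sqrtr_sqr ler_wsqrtr. Qed.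

Lemma ln4_le : ln 4 <= 3 / 2 :> R.
Proof.
rewrite -ler_expR lnK ?posrE //.
have -> : 3 / 2 = 24%:R * (16%:R^-1) :> R by lra.
rewrite expRM_natl; apply: (@le_trans _ _ ((1 + 16%:R^-1) ^+ 24)); last first.
  by apply: lerXn2r; rewrite ?nnegrE ?expR_ge0 // ?expR_ge1Dx //; lra.
by lra.
Qed.

(** ln (1/delta) <= 1/delta - 1 and ln 4 <= 3/2 bound the left side by 1 + delta/2. *)
Lemma delta_ln_le (delta : R) : 0 < delta -> delta <= 1 -> delta * ln (4 / delta) <= 3 / 2.
Proof.
move=> d0 d1; rewrite lnM ?posrE ?invr_gt0 //.
have h : ln delta^-1 <= delta^-1 - 1.
  have := @le_ln1Dx R (delta^-1 - 1); rewrite addrCA subrr addr0; apply.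
  by rewrite ltrBrDr addNr invr_gt0.
have h4 := ln4_le; have h1 := ler_wpM2l (ltW d0) h.
have h2 := ler_wpM2l (ltW d0) h4.
move: h1; rewrite mulrBr mulfV ?gt_eqF // mulr1 mulrDr; lra.
Qed.

(** On the left, what the tail constant of X has in excess of k + sqrt k; on the right, what the
    second-moment bound leaves of 2 sqrt (k (k - 1)). *)
Lemma coef_le (k : nat) (s : R) : (2 < k)%N -> 0 <= s -> s ^+ 2 <= 3 / 4 ->
  (2 * k%:R * Num.sqrt (k%:R * (k%:R - 2)) / (k%:R - 1) - (k%:R + Num.sqrt k%:R)) * s
  <= 2 * Num.sqrt (k%:R * (k%:R - 1)) - Num.sqrt (6 * k%:R + 2) /\
  0 <= 2 * Num.sqrt (k%:R * (k%:R - 1)) - Num.sqrt (6 * k%:R + 2 : R).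
Proof.
move=> k2 s0 s1.
have s2 : s <= 13 / 15 by rewrite -(ler_pXn2r (n := 2)) ?nnegrE //; lra.
(* The margin is smallest at k = 3, which gets its own rational estimates. The constants used from k
   = 4 on are nearly sharp at sqrt k = 2. *)
move: k2; rewrite leq_eqVlt => /predU1P[<-|k3].
  have h1 : 489 / 100 <= 2 * Num.sqrt (3 * (3 - 1)) :> R.
    rewrite -ler_pdivrMl //; apply: le_sqrtr; lra.
  have h2 : Num.sqrt (6 * 3 + 2) <= 112 / 25 :> R by apply: ge_sqrtr; lra.
  have h3 : Num.sqrt (3 * (3 - 2)) <= 26 / 15 :> R by apply: ge_sqrtr; lra.
  have e : Num.sqrt (3 * (3 - 2)) = Num.sqrt 3 :> R by congr Num.sqrt; lra.
  rewrite e in h3 *; split; last lra.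
  have -> : 2 * 3 * Num.sqrt 3 / (3 - 1) - (3 + Num.sqrt 3) = 2 * Num.sqrt 3 - 3 :> R.
    by rewrite (_ : 3 - 1 = 2 :> R); lra.
  have h4 : 3 / 2 <= Num.sqrt 3 :> R by apply: le_sqrtr; lra.
  set y := Num.sqrt 3 in h3 h4 *; nra.
have k4 : 4 <= k%:R :> R by rewrite ler_nat.
set K : R := k%:R in k4 *.
set y := Num.sqrt K.
have yy : K = y ^+ 2 by rewrite sqr_sqrtr //; lra.
have y2 : 2 <= y by apply: le_sqrtr; lra.
have h1 : y * (y - 27 / 100) <= Num.sqrt (K * (K - 1)).
  by apply: le_sqrtr; rewrite ?yy; nra.
have h2 : Num.sqrt (6 * K + 2) <= 51 / 20 * y by apply: ge_sqrtr; rewrite ?yy; nra.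
have h3 : Num.sqrt (K * (K - 2)) <= K - 1 by apply: ge_sqrtr; nra.
have h4 : 2 * K * Num.sqrt (K * (K - 2)) / (K - 1) <= 2 * K.
  rewrite ler_pdivrMr; last lra.
  by apply: ler_wpM2l => //; lra.
split; last by nra.
apply: (@le_trans _ _ ((K - y) * s)); first by apply: ler_wpM2r => //; lra.
apply: (@le_trans _ _ ((K - y) * (13 / 15))).
  by apply: ler_wpM2l => //; rewrite yy; nra.
rewrite yy in h1 h2 *; nra.
Qed.

(** [s] = sqrt (3/4) is the ratio given by [delta_ln_le]: the logarithmic root [a] is at most
    [s * q], so the surplus coefficient of [a] can be charged to [q]. *)
Lemma budget_le (k : nat) (m delta g v : R) : (2 < k)%N -> 0 < m -> 0 < delta ->
  delta <= 1 -> 0 <= g -> 2 * v <= (6 * k%:R + 2) * (m^-1 + g) ->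
  Num.sqrt (2 * v / delta) +
    k%:R / (k%:R - 1) / m * Num.sqrt (2 * k%:R * (k%:R - 2) * m * ln (2 / delta)) <=
  (k%:R + Num.sqrt k%:R) * Num.sqrt (ln (4 / delta) / (2 * m)) +
    Num.sqrt (k%:R * (k%:R - 1)) * Num.sqrt (4 / delta * (m^-1 + g)).
Proof.
move=> k2 m0 d0 d1 g0 hv; set K : R := k%:R.
have k3 : 3 <= K by rewrite ler_nat.
have m0' : 0 < m^-1 by rewrite invr_gt0.
have d0' : 0 < delta^-1 by rewrite invr_gt0.
pose q := Num.sqrt ((m^-1 + g) / delta).
pose a := Num.sqrt (ln (4 / delta) / (2 * m)).
pose s : R := Num.sqrt (3 / 4).
have q0 : 0 <= q by exact: sqrtr_ge0.
have q2 : q ^+ 2 = (m^-1 + g) / delta.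
  by rewrite sqr_sqrtr // mulr_ge0 ?ltW // ltr_wpDr.
have a0 : 0 <= a by exact: sqrtr_ge0.
have s2 : s ^+ 2 = 3 / 4 by rewrite sqr_sqrtr //; lra.
have s0 : 0 <= s by exact: sqrtr_ge0.
have [c1 c2] : _ /\ _ := coef_le k2 s0 (eq_ind_r (fun z => z <= 3 / 4) (lexx _) s2).
have asq : a <= s * q.
  apply: ge_sqrtr; first exact: mulr_ge0.
  rewrite exprMn s2 q2.
  have h : ln (4 / delta) <= 3 / 2 / delta.
    by rewrite ler_pdivlMr // mulrC delta_ln_le.
  have {}h := ler_wpM2l (ltW m0') h.
  have e : ln (4 / delta) / (2 * m) = 2^-1 * (m^-1 * ln (4 / delta)).
    by field; rewrite gt_eqF.
  rewrite e; have := mulr_ge0 g0 (ltW d0'); lra.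
have t1 : Num.sqrt (2 * v / delta) <= Num.sqrt (6 * K + 2) * q.
  rewrite /q -sqrtrM; last by lra.
  by apply: ler_wsqrtr; rewrite mulrA ler_pM2r.
have t3 : Num.sqrt (4 / delta * (m^-1 + g)) = 2 * q.
  have -> : 4 / delta * (m^-1 + g) = (2 * q) ^+ 2.
    by rewrite exprMn q2; ring.
  by rewrite sqrtr_sqr ger0_norm // mulr_ge0.
have t2 : K / (K - 1) / m * Num.sqrt (2 * K * (K - 2) * m * ln (2 / delta)) <=
    2 * K * Num.sqrt (K * (K - 2)) / (K - 1) * a.
  have -> : 2 * K * (K - 2) * m * ln (2 / delta) =
      K * (K - 2) * (2 * m) ^+ 2 * (ln (2 / delta) / (2 * m)).
    by field; rewrite gt_eqF.
  rewrite sqrtrM; last by rewrite mulr_ge0 ?sqr_ge0 // mulr_ge0 //; lra.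
  rewrite sqrtrM; last by rewrite mulr_ge0 //; lra.
  rewrite sqrtr_sqr ger0_norm; last by lra.
  have -> : K / (K - 1) / m * (Num.sqrt (K * (K - 2)) * (2 * m) * Num.sqrt (ln (2 / delta) / (2 * m)))
    = 2 * K * Num.sqrt (K * (K - 2)) / (K - 1) * Num.sqrt (ln (2 / delta) / (2 * m)).
    by field; rewrite !gt_eqF //; lra.
  apply: ler_wpM2l.
    by apply: divr_ge0; [rewrite !mulr_ge0 ?sqrtr_ge0|]; lra.
  apply: ler_wsqrtr; rewrite ler_pM2r ?invr_gt0 ?mulr_gt0 //.
  by rewrite ler_ln ?posrE ?mulr_gt0 // ler_pM2r //; lra.
rewrite -/a t3; apply: le_trans (lerD t1 t2) _.
set cX := 2 * K * _ / _ in c1 *.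
have h : (cX - (K + Num.sqrt K)) * a <=
    (2 * Num.sqrt (K * (K - 1)) - Num.sqrt (6 * K + 2)) * q.
  have [c0|c0] := leP (cX - (K + Num.sqrt K)) 0.
    by apply: (@le_trans _ _ 0); [rewrite mulr_le0_ge0|rewrite mulr_ge0].
  apply: (@le_trans _ _ ((cX - (K + Num.sqrt K)) * (s * q))).
    by apply: ler_wpM2l => //; exact: ltW.
  by rewrite mulrA ler_wpM2r.
by lra.
Qed.

End Numerics.

(** * Samples with two fresh points *)

(** A uniform vector restricted along an injection is uniform. *)
Lemma avg_ffun_inj (R : realType) (T I : finType) (K : finZmodType) (j : I -> T)
    (h : {ffun I -> K} -> R) : injective j ->
  #|{ffun T -> K}|%:R^-1 * (\sum_(v : {ffun T -> K}) h [ffun i => v (j i)]) =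
  #|{ffun I -> K}|%:R^-1 * \sum_w h w.
Proof.
move=> jI.
pose ext (c : {ffun I -> K}) : {ffun T -> K} :=
  [ffun t => if [pick i | j i == t] is Some i then c i else 0].
have extE c i : ext c (j i) = c i.
  rewrite ffunE; case: pickP => [i' /eqP/jI -> //|/(_ i)].
  by rewrite eqxx.
have e c : \sum_(v : {ffun T -> K}) h [ffun i => v (j i)] =
    \sum_(v : {ffun T -> K}) h ([ffun i => v (j i)] + c).
  rewrite (reindex_inj (addIr (ext c))) /=; apply: eq_bigr => v _.
  by congr h; apply/ffunP => i; rewrite !ffunE -extE ffunE.
have nz (J : finType) : #|{ffun J -> K}|%:R != 0 :> R.
  by rewrite pnatr_eq0 -lt0n; apply/card_gt0P; exists [ffun=> 0].
apply: (mulfI (nz I)); rewrite mulVKf // mulrCA.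
have -> : #|{ffun I -> K}|%:R * (\sum_(v : {ffun T -> K}) h [ffun i => v (j i)]) =
    \sum_(c : {ffun I -> K}) \sum_(v : {ffun T -> K}) h ([ffun i => v (j i)] + c).
  by rewrite mulr_natl -sumr_const; apply: eq_bigr => c _; exact: e.
rewrite exchange_big /=.
rewrite (eq_bigr (fun=> \sum_w h w)) => [|v _]; last first.
  by rewrite [RHS](reindex_inj (addrI [ffun i => v (j i)])).
by rewrite sumr_const -[X in _ * X]mulr_natl mulKf.
Qed.

Section Offsets.
Context dZ (Z : measurableType dZ) (R : realType).
Variables (d k' n m : nat) (lam : R) (feat : Z -> 'rV[R]_d) (lab : Z -> 'I_k'.+1).
Hypothesis lam_ge0 : 0 <= lam.
Hypothesis hfeat : forall j : 'I_d, measurable_fun setT (fun z => feat z 0 j).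
Hypothesis hlab : forall c, measurable (lab @^-1` [set c]).
Local Notation K := 'I_k'.+1.
Local Notation T0 := ('I_n + 'I_m)%type.

(* The sample together with two fresh points, [Some None] and [None]. *)
Definition site : finType := option (option T0).
Local Notation T2 := site.
Implicit Types (v : {ffun T2 -> K}) (z : pvec Z T2) (S : {set T2}).

Definition iota2 (t : T0) : T2 := Some (Some t).
Definition fresh1 : T2 := Some None.
Definition fresh2 : T2 := None.
(** The fresh sites count as random: exchanged into the training set, they bring their own
    offset. *)
Definition rnd : {set T2} := [set t | if t is Some (Some (inl _)) then false else true]%SET.
Definition clean : {set T2} := [set iota2 (inl a) | a : 'I_n]%SET.
Definition sampled : {set T2} := (~: [set fresh1; fresh2])%SET.

Definition offset v t : K := if t \in rnd then v t else 0.

(* The label of a random point is its true label shifted by an offset [v]. *)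
Definition gerr S j v z : R :=
  err01 (learn lam (fun t => feat (z t)) (fun t => lab (z t) + offset v t) S)
    (feat (z j)) (lab (z j)).

Lemma err01_itv (w : 'M[R]_(d, k'.+1)) x c : 0 <= err01 w x c <= 1.
Proof. by rewrite /err01; case: (_ \notin _); rewrite ?lexx ?ler01. Qed.

Lemma gerr01 S j v z : 0 <= gerr S j v z <= 1.
Proof. exact: err01_itv. Qed.

Lemma mmx_coord t : mmx (fun z : pvec Z T2 => feat (z t)).
Proof.
move=> i j; rewrite ord1.
exact: (measurableT_comp (hfeat j) (measurable_coord t)).
Qed.

Lemma measurable_lab_coord t (o c : K) : measurable [set z : pvec Z T2 | lab (z t) + o = c].
Proof.
have -> : [set z : pvec Z T2 | lab (z t) + o = c] =
    (fun z : pvec Z T2 => z t) @^-1` (lab @^-1` [set c - o]).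
  apply/seteqP; split => z /=; first by move=> <-; rewrite addrK.
  by move=> ->; rewrite subrK.
by rewrite -[X in measurable X]setTI; exact: measurable_coord.
Qed.

Lemma bmf_err01 S j v (y : pvec Z T2 -> K) :
  (forall c, measurable [set z | y z = c]) ->
  bmf (fun z : pvec Z T2 => err01 (learn lam (fun t => feat (z t))
    (fun t => lab (z t) + offset v t) S) (feat (z j)) (y z) : R).
Proof.
move=> my; split; last first.
  by exists 1 => z; case/andP: (err01_itv (learn lam (fun t => feat (z t))
    (fun t => lab (z t) + offset v t) S) (feat (z j)) (y z)) => h0 h1; rewrite ger0_norm.
apply: (measurable_err01 lam_ge0 (x := fun (z : pvec Z T2) t => feat (z t))
  (c := fun (z : pvec Z T2) t => lab (z t) + offset v t)) => //.
  exact: mmx_coord.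
by move=> t c; exact: measurable_lab_coord.
Qed.

Lemma gerr_nice S j : nice (gerr S j).
Proof.
move=> v; apply: bmf_err01 => c.
have := measurable_lab_coord j 0 c.
by congr measurable; apply/seteqP; split => z /=; rewrite addr0.
Qed.

Lemma gerr_tperm x y S j v v' z :
  (forall t, offset v' t = offset v (tperm x y t)) ->
  gerr S j v' (fun t => z (tperm x y t)) =
  gerr (tperm x y @: S)%SET (tperm x y j) v z.
Proof.
move=> h; rewrite /gerr.
have -> // : learn lam (fun t => feat (z (tperm x y t)))
    (fun t => lab (z (tperm x y t)) + offset v' t) S =
  learn lam (fun t => feat (z t)) (fun t => lab (z t) + offset v t) (tperm x y @: S)%SET.
rewrite -(learn_inj lam _ _ S (@perm_inj _ (tperm x y))).
by apply: eq_learn => t _ //=; rewrite h.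
Qed.

Lemma gerr_perm x y S j v z : x \in rnd -> y \in rnd ->
  gerr S j [ffun t => v (tperm x y t)] (fun t => z (tperm x y t)) =
  gerr (tperm x y @: S)%SET (tperm x y j) v z.
Proof.
move=> xr yr; apply: gerr_tperm => t; rewrite /offset ffunE.
by congr (if _ then _ else _); case: tpermP => // ->; rewrite ?xr ?yr.
Qed.

Lemma gerr_indep S j q v v' z : q \notin S ->
  (forall t, t != q -> v t = v' t) -> gerr S j v z = gerr S j v' z.
Proof.
move=> qS vv'; rewrite /gerr.
have -> // : learn lam (fun t => feat (z t)) (fun t => lab (z t) + offset v t) S =
  learn lam (fun t => feat (z t)) (fun t => lab (z t) + offset v' t) S.
apply: eq_learn => // t tS.
have -> // : offset v t = offset v' t.
by rewrite /offset; case: ifP => // _; apply: vv'; apply: contraNneq qS => <-.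
Qed.

Lemma fresh1_rnd : fresh1 \in rnd. Proof. by rewrite inE. Qed.
Lemma fresh2_rnd : fresh2 \in rnd. Proof. by rewrite inE. Qed.

Lemma iota2_inj : injective iota2. Proof. by move=> t t' []. Qed.

Lemma random_imset : (rnd :\: [set fresh1; fresh2])%SET = [set iota2 (inr b) | b : 'I_m]%SET.
Proof.
apply/setP => t; apply/idP/imsetP; last by case=> b _ ->; rewrite !inE.
by case: t => [[[a|b]|]|]; rewrite !inE //= => _; exists b.
Qed.

Lemma card_random : #|(rnd :\: [set fresh1; fresh2])%SET| = m.
Proof. by rewrite random_imset card_imset ?card_ord // => b b' /iota2_inj[]. Qed.

Lemma card_clean : #|clean| = n.
Proof. by rewrite card_imset ?card_ord // => b b' /iota2_inj[]. Qed.

Lemma sum_random (F : T2 -> R) :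
  \sum_(p in (rnd :\: [set fresh1; fresh2])%SET) F p = \sum_b F (iota2 (inr b)).
Proof. by rewrite random_imset big_imset //= => b b' _ _ /iota2_inj[]. Qed.

Lemma sum_clean (F : T2 -> R) : \sum_(p in clean) F p = \sum_a F (iota2 (inl a)).
Proof. by rewrite big_imset //= => b b' _ _ /iota2_inj[]. Qed.

Lemma sampled_imset : sampled = (iota2 @: [set: T0])%SET.
Proof.
apply/setP => t; apply/idP/imsetP; last by case=> b _ ->; rewrite !inE.
by case: t => [[t|]|]; rewrite !inE //= => _; exists t; rewrite ?inE.
Qed.

End Offsets.

Lemma bmf_pair1 d0 d1 (X : measurableType d0) (Y : measurableType d1) (R : realType)
  (f : X * Y -> R) y : bmf f -> bmf (fun x => f (x, y)).
Proof.
move=> [mf [M hM]]; split; last by exists M.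
exact: (measurableT_comp mf (pair2_measurable y)).
Qed.

Lemma mean_fst d0 d1 (X : measurableType d0) (Y : measurableType d1) (R : realType)
  (P : probability X R) (D : probability Y R) (f : X -> R) :
  bmf f -> mean (P \x D)%E (fun w => f w.1) = mean P f.
Proof.
move=> hf; rewrite mean_fubini; last exact: (bmf_comp measurable_fst hf).
by congr mean; apply/funext => x; exact: (mean_cst D (f x)).
Qed.

(** * The observed sample, its realized offsets and the final bound *)

Section Sample.
Context dZ (Z : measurableType dZ) (R : realType) (D : probability Z R).
Variables (d k' : nat) (feat : Z -> 'rV[R]_d) (lab : Z -> 'I_k'.+2).
Hypothesis hfeat : forall j : 'I_d, measurable_fun setT (fun z => feat z 0 j).
Hypothesis hlab : forall c, measurable (lab @^-1` [set c]).
Context dO (Om : measurableType dO) (P : probability Om R).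
Variables (n m : nat) (ZS : 'I_n -> Om -> Z) (ZT : 'I_m -> Om -> Z) (U : 'I_m -> Om -> 'I_k'.+2).
Hypothesis hZS : forall a, measurable_fun setT (ZS a).
Hypothesis hZT : forall b, measurable_fun setT (ZT b).
Hypothesis hU : forall b (c : 'I_k'.+2), measurable [set om | U b om = c].
Hypothesis hindep :
  forall (A : 'I_n -> set Z) (A' : 'I_m -> set Z) (B : 'I_m -> {set 'I_k'.+2}),
     (forall a, measurable (A a)) -> (forall b, measurable (A' b)) ->
     P ((\bigcap_a (ZS a @^-1` A a)) `&` (\bigcap_b (ZT b @^-1` A' b))
          `&` (\bigcap_b [set om | U b om \in B b]))
     = ((\prod_(a < n) fine (D (A a))) * (\prod_(b < m) fine (D (A' b)))
          * (\prod_(b < m) (#|B b|%:R / k'.+2%:R)))%:E.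

Local Notation K := 'I_k'.+2.
Local Notation T0 := ('I_n + 'I_m)%type.
Local Notation T2 := (site n m).

Definition data (om : Om) (t : T0) : Z :=
  match t with inl a => ZS a om | inr b => ZT b om end.

Definition ulab (om : Om) : {ffun 'I_m -> K} := [ffun b => U b om].

Lemma data_rect (A : T0 -> set Z) : data @^-1` rect A =
  (\bigcap_a (ZS a @^-1` A (inl a))) `&` (\bigcap_b (ZT b @^-1` A (inr b))).
Proof.
apply/seteqP; split => om /=.
  by move=> h; split => [a _|b _]; [exact: (h (inl a))|exact: (h (inr b))].
by move=> [h1 h2] [a|b]; [exact: (h1 a I)|exact: (h2 b I)].
Qed.

Lemma iid_data : iid D P data.
Proof.
split => [[a|b]|A mA]; [exact: hZS|exact: hZT|].
have := hindep (fun=> [set: K]%SET) (fun a => mA (inl a)) (fun b => mA (inr b)).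
rewrite data_rect (_ : \bigcap_b [set om | U b om \in [set: K]%SET] = setT); last first.
  by apply/seteqP; split => om // _ b _; rewrite /= inE.
rewrite setIT => ->; rewrite big_sumType /= [X in _ * X]big1 ?mulr1 // => b _.
by rewrite cardsT card_ord mulfV // pnatr_eq0.
Qed.

Lemma unif_data : unif_indep P data ulab.
Proof.
have eU (u : {ffun 'I_m -> K}) : ulab @^-1` [set u] =
    \bigcap_b [set om | U b om \in [set u b]%SET].
  apply/seteqP; split => om /=.
    by move=> <- b _; rewrite /= inE ffunE.
  by move=> h; apply/ffunP => b; rewrite ffunE; have := h b I; rewrite /= inE => /eqP.
split => [u|A u mA].
  rewrite eU; apply: fin_bigcap_measurable => // b _.
  rewrite (_ : [set om | _] = [set om | U b om = u b]); first exact: hU.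
  by apply/seteqP; split => om /=; rewrite inE => /eqP.
rewrite (iid_data.2 A mA) eU data_rect.
rewrite (hindep (fun b => [set u b]%SET) (fun a => mA (inl a)) (fun b => mA (inr b))).
rewrite -EFinM big_sumType /= mulrC; congr (_ * _)%:E.
rewrite (eq_bigr (fun=> k'.+2%:R^-1)) => [|b _]; last by rewrite cards1 mul1r.
by rewrite prodr_const card_ffun !card_ord natrX exprVn.
Qed.

Definition data2 := snocv (snocv data).
Definition P2 := ((P \x D) \x D)%E.

Lemma iid_data2 : iid D P2 data2.
Proof. exact: (iid_snoc (iid_snoc iid_data)). Qed.

Lemma unif_data2 : unif_indep P2 data2 (fun w => ulab w.1.1).
Proof. exact: (unif_indep_snoc (iid_snoc iid_data) (unif_indep_snoc iid_data unif_data)). Qed.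

Definition ext (c : {ffun 'I_m -> K}) : {ffun T2 -> K} :=
  [ffun t => if t is Some (Some (inr b)) then c b else 0].

Definition offs (u : {ffun 'I_m -> K}) (z : pvec Z T2) : {ffun 'I_m -> K} :=
  [ffun b => u b - lab (z (iota2 (inr b)))].

(** The offsets realized by the observed labels, padded with 0 at clean and fresh sites, where the
    statistics of interest do not look. *)
Definition hat (w : Om * Z * Z) : {ffun T2 -> K} := ext (offs (ulab w.1.1) (data2 w)).

(** The bridge from the sampling space to [Ex]: uniform labels independent of the points have
    uniform offsets independent of the points. *)
Lemma mean_hat (g : {ffun T2 -> K} -> pvec Z T2 -> R) : nice g ->
  (forall (v v' : {ffun T2 -> K}) z,
    (forall b, v (iota2 (inr b)) = v' (iota2 (inr b))) -> g v z = g v' z) ->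
  bmf (fun w => g (hat w) (data2 w)) /\
  mean P2 (fun w => g (hat w) (data2 w)) = Ex P2 data2 g.
Proof.
move=> hg gdep.
pose G u z := g (ext (offs u z)) z.
have mo u c : measurable [set z : pvec Z T2 | offs u z = c].
  have -> : [set z : pvec Z T2 | offs u z = c] =
      \bigcap_b [set z : pvec Z T2 | lab (z (iota2 (inr b))) + 0 = u b - c b].
    apply/seteqP; split => z /=.
      by move=> <- b _ /=; rewrite ffunE addr0 subKr.
    move=> h; apply/ffunP => b; have := h b I; rewrite /= addr0 ffunE => ->.
    by rewrite subKr.
  by apply: fin_bigcap_measurable => // b _; exact: measurable_lab_coord.
have bG u : bmf (G u).
  have -> : G u = (fun z => \sum_c \1_[set z : pvec Z T2 | offs u z = c] z * g (ext c) z).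
    apply/funext => z; rewrite (bigD1 (offs u z)) //= big1 => [|c /eqP cz].
      by rewrite addr0 indicE mem_set // mul1r.
    by rewrite indicE memNset ?mul0r // => /= /esym.
  by apply: bmf_sum => c; exact: bmfM (bmf_indic R (mo u c)) (hg _).
have [b1 ->] := mean_unif_indep iid_data2 unif_data2 bG.
split => //.
have mV := iid_measurable iid_data2.
rewrite -mean_sum => [|u]; last exact: bmf_comp mV (bG u).
pose h c := mean P2 (fun w => g (ext c) (data2 w)).
pose j (b : 'I_m) : T2 := iota2 (inr b).
have jI : injective j by move=> b b' [].
have -> : Ex P2 data2 g =
    #|{ffun T2 -> K}|%:R^-1 * \sum_(v : {ffun T2 -> K}) h [ffun b => v (j b)].
  congr (_ * _); apply: eq_bigr => v _; congr mean; apply/funext => w.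
  by apply: gdep => b; rewrite !ffunE /= ffunE.
rewrite (avg_ffun_inj h jI); congr (_ * _).
rewrite -mean_sum => [|c]; last exact: bmf_comp mV (hg (ext c)).
congr mean; apply/funext => w.
(* For fixed points, subtracting the true labels permutes the labelings. *)
have inj_o : injective (fun u : {ffun 'I_m -> K} => offs u (data2 w)).
  move=> u u' /ffunP e; apply/ffunP => b.
  by have := e b; rewrite !ffunE => /addIr.
by rewrite [RHS](reindex_inj inj_o).
Qed.

Variable lam : R.
Hypothesis hlam : 0 <= lam.

Definition tlabel (om : Om) (t : T0) : K := lab (data om t).

Definition subw (om : Om) (S : {set T0}) : 'M[R]_(d, k'.+2) :=
  learn lam (fun t => feat (data om t)) (relabel (tlabel om) (ulab om)) S.

Lemma split_imset (S : {set T0}) : (@fintype.split n m @: [set i | fintype.split i \in S] = S)%SET.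
Proof.
apply/setP => t; apply/imsetP/idP => [[i]|tS]; first by rewrite inE => iS ->.
by exists (unsplit t); rewrite ?inE unsplitK.
Qed.

Lemma sfeat_slab om (S : {set T0}) :
  learn lam (fun i => sfeat feat ZS ZT i om) (fun i => slab lab ZS U i om)
    [set i | fintype.split i \in S]%SET = subw om S.
Proof.
rewrite /subw -[in RHS](split_imset S) -learn_inj; last exact: (can_inj (@splitK n m)).
apply: eq_learn => i _; rewrite /sfeat /slab /relabel /tlabel /=; case: (fintype.split i) => // b.
by rewrite ffunE.
Qed.

Lemma What_learn om : What lam feat lab ZS ZT U om = subw om [set: T0]%SET.
Proof.
rewrite /What learn_trainW -sfeat_slab.
have -> // : [set: 'I_(n + m)]%SET = [set i | fintype.split i \in [set: T0]%SET]%SET.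
by apply/setP => i; rewrite !inE.
Qed.

Lemma Wloo_learn om b :
  Wloo lam feat lab ZS ZT U (rshift n b) om = subw om [set~ inr b]%SET.
Proof.
rewrite /Wloo learn_trainW_row' -sfeat_slab.
have -> // : [set~ rshift n b]%SET = [set i | fintype.split i \in [set~ inr b]%SET]%SET.
apply/setP => i; rewrite !inE; congr (~~ _).
by rewrite -(inj_eq (can_inj (@splitK n m))) (unsplitK (inr b : 'I_n + 'I_m)).
Qed.

Local Notation ge := (gerr lam feat lab).

Lemma gerr_hat (S : {set T0}) j w :
  ge (@iota2 n m @: S)%SET j (hat w) (data2 w) =
  err01 (subw w.1.1 S) (feat (data2 w j)) (lab (data2 w j)).
Proof.
rewrite /gerr -learn_inj; last exact: iota2_inj.
have -> // : learn lam ((fun t => feat (data2 w t)) \o @iota2 n m)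
    ((fun t => lab (data2 w t) + offset (hat w) t) \o @iota2 n m) S = subw w.1.1 S.
apply: eq_learn => t _ //=.
rewrite /relabel /tlabel /offset; case: t => [a|b]; rewrite inE /=; first by rewrite addr0.
by rewrite !ffunE /= !ffunE addrC subrK.
Qed.

Lemma sampledE : sampled n m = (@iota2 n m @: [set: T0])%SET.
Proof. exact: sampled_imset. Qed.

Lemma sampledD1 b : (sampled n m :\ iota2 (inr b))%SET = (@iota2 n m @: [set~ inr b])%SET.
Proof.
rewrite sampledE; apply/setP => t; rewrite in_setD1; apply/andP/imsetP.
  move=> [tb /imsetP[s _ ts]]; exists s => //; rewrite !inE.
    by apply: contraNneq tb => <-; rewrite ts.
move=> [s]; rewrite !inE => sb ->; rewrite (inj_eq (@iota2_inj n m)) sb.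
by split => //; apply: imset_f; rewrite inE.
Qed.

Lemma gerr_dep (S : {set T2}) (j : T2) (v v' : {ffun T2 -> K}) (z : pvec Z T2) :
  S \subset sampled n m ->
  (forall b, v (iota2 (inr b)) = v' (iota2 (inr b))) -> ge S j v z = ge S j v' z.
Proof.
move=> /fintype.subsetP SF vv'; rewrite /gerr.
have -> // : learn lam (fun t => feat (z t)) (fun t => lab (z t) + offset v t) S =
  learn lam (fun t => feat (z t)) (fun t => lab (z t) + offset v' t) S.
apply: eq_learn => // t /SF; rewrite sampledE => /imsetP[t0 _ ->].
have -> // : offset v (iota2 t0) = offset v' (iota2 t0).
by rewrite /offset; case: t0 => [a|b]; rewrite inE /= ?vv'.
Qed.

Hypotheses (hm0 : (0 < m)%N) (hmn : (m < n)%N).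
Variable beta : R.
Hypothesis hstab : forall i : 'I_(n + m),
  (\int[P]_om \int[D]_z
    (`| err01 (What lam feat lab ZS ZT U om) (feat z) (lab z)
      - err01 (Wloo lam feat lab ZS ZT U i om) (feat z) (lab z) |)%:E
      <= (beta / (n + m)%:R)%:E)%E.

Local Notation gam := (beta / (n + m)%:R).
Local Notation r := (fresh1 n m).
Local Notation s := (fresh2 n m).
Local Notation F0 := (~: [set r; s])%SET.
Local Notation J0 := (rnd n m :\: [set r; s])%SET.
Local Notation Ex := (@Ex _ Z R _ _ P2 T2 K data2).

Lemma Ex_stab p : p \in J0 ->
  Ex (fun v z => `|ge F0 r v z - ge (F0 :\ p)%SET r v z|) <= gam.
Proof.
rewrite random_imset => /imsetP[b _ ->].
have nG : nice (fun v z => `|ge F0 r v z - ge (F0 :\ iota2 (inr b))%SET r v z|).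
  by apply: nice_norm; apply: niceB; exact: gerr_nice.
have dG (v v' : {ffun T2 -> K}) z :
    (forall b, v (iota2 (inr b)) = v' (iota2 (inr b))) ->
    `|ge F0 r v z - ge (F0 :\ iota2 (inr b))%SET r v z| =
    `|ge F0 r v' z - ge (F0 :\ iota2 (inr b))%SET r v' z|.
  move=> vv'; rewrite (gerr_dep (S := F0) r z _ vv') // (gerr_dep r z _ vv') //.
  exact: finset.subD1set.
have [bG <-] := mean_hat nG dG.
pose f (p : Om * Z) := `|err01 (What lam feat lab ZS ZT U p.1) (feat p.2) (lab p.2)
  - err01 (Wloo lam feat lab ZS ZT U (rshift n b) p.1) (feat p.2) (lab p.2)|.
have eG : (fun w => `|ge F0 r (hat w) (data2 w) - ge (F0 :\ iota2 (inr b))%SET r (hat w) (data2 w)|)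
    = (fun w : Om * Z * Z => f w.1).
  apply/funext => w; rewrite -/(sampled n m) sampledD1 sampledE !gerr_hat.
  by rewrite /f What_learn Wloo_learn.
rewrite eG in bG *.
(* The second fresh coordinate is irrelevant here, so it is frozen at [point] to read off
   measurability. *)
have bf : bmf f := bmf_pair1 point bG.
rewrite (mean_fst _ _ bf) mean_fubini // -lee_fin -mean_EFin; last exact: bmf_mean_pair.
apply: le_trans (hstab (rshift n b)); rewrite le_eqVlt; apply/predU1P; left.
apply: eq_integral => om _; rewrite -mean_EFin //.
exact: bmf_pair2.
Qed.

Definition kratio : R := k'.+2%:R / (k'.+2%:R - 1).

Lemma km1_gt0 : 0 < k'.+2%:R - 1 :> R. Proof. by rewrite subr_gt0 ltr1n. Qed.

Lemma kratio_ge1 : 1 <= kratio.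
Proof. by rewrite /kratio ler_pdivlMr ?km1_gt0 // mul1r gerBl. Qed.

Lemma kratio_le2 : kratio <= 2.
Proof.
rewrite /kratio ler_pdivrMr ?km1_gt0 //.
have : 2 <= k'.+2%:R :> R by rewrite ler_nat.
by lra.
Qed.

Lemma kratio_mean : kratio * (#|K|%:R - 1) = #|K|%:R.
Proof. by rewrite card_ord /kratio divfK // gt_eqF ?km1_gt0. Qed.

Definition wfull (om : Om) := subw om [set: T0]%SET.

(* In the notation of the header, [sbal] is T1 and [poperr - loo] is T3. *)
Definition poperr (om : Om) : R := mean D (fun z => err01 (wfull om) (feat z) (lab z)).

Definition loo (om : Om) : R := m%:R^-1 * \sum_b kratio * (U b om != lab (ZT b om))%:R *
  err01 (subw om [set~ inr b]%SET) (feat (ZT b om)) (lab (ZT b om)).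

Definition sbal (om : Om) : R :=
  n%:R^-1 * (\sum_a (1 - err01 (wfull om) (feat (ZS a om)) (lab (ZS a om)))) -
  k'.+2%:R / m%:R * (\sum_b (U b om == lab (ZT b om))%:R *
     (1 - err01 (wfull om) (feat (ZT b om)) (lab (ZT b om)))).

Lemma hat_random w b :
  hat w (iota2 (inr b)) = U b w.1.1 - lab (ZT b w.1.1).
Proof. by rewrite !ffunE /= !ffunE. Qed.

Lemma loo_hat w : loomean (gerr lam feat lab) (rnd n m) r s kratio (hat w) (data2 w) = loo w.1.1.
Proof.
rewrite /loomean card_random /loo; congr (_ * _).
rewrite (sum_random (fun p => kap kratio p (hat w) * ge (F0 :\ p)%SET p (hat w) (data2 w))).
apply: eq_bigr => b _; rewrite /kap hat_random subr_eq0.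
by rewrite -/(sampled n m) sampledD1 gerr_hat.
Qed.

Lemma dep_loomean (v v' : {ffun T2 -> K}) z :
  (forall b, v (iota2 (inr b)) = v' (iota2 (inr b))) ->
  loomean (gerr lam feat lab) (rnd n m) r s kratio v z =
  loomean (gerr lam feat lab) (rnd n m) r s kratio v' z.
Proof.
move=> vv'; congr (_ * _); apply: eq_bigr => p; rewrite random_imset => /imsetP[b _ ->].
rewrite /kap vv' (gerr_dep _ z _ vv') //.
exact: finset.subD1set.
Qed.

Lemma gerr_full j w : ge F0 j (hat w) (data2 w) =
  err01 (wfull w.1.1) (feat (data2 w j)) (lab (data2 w j)).
Proof. by rewrite -/(sampled n m) sampledE gerr_hat. Qed.

Lemma bmf_full_err : bmf (fun p : Om * Z => err01 (wfull p.1) (feat p.2) (lab p.2)).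
Proof.
have [b1 _] := mean_hat (gerr_nice hlam hfeat hlab F0 r)
  (fun v v' z vv' => gerr_dep r z (fintype.subxx _) vv').
have e : (fun w => ge F0 r (hat w) (data2 w)) =
    (fun w : Om * Z * Z => err01 (wfull w.1.1) (feat w.1.2) (lab w.1.2)).
  by apply/funext => w; rewrite gerr_full.
by rewrite e in b1; exact: bmf_pair1 point b1.
Qed.

Lemma bmf_poperr : bmf poperr.
Proof. have := bmf_mean_pair P D bmf_full_err; exact. Qed.

Lemma bmf_loo : bmf loo.
Proof.
have hn : nice (loomean (gerr lam feat lab) (rnd n m) r s kratio).
  by apply: nice_loomean => S j; exact: gerr_nice.
have [b1 _] := mean_hat hn dep_loomean.
have e : (fun w => loomean (gerr lam feat lab) (rnd n m) r s kratio (hat w) (data2 w)) =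
    (fun w : Om * Z * Z => loo w.1.1).
  by apply/funext => w; rewrite loo_hat.
by rewrite e in b1; have := bmf_pair1 point (bmf_pair1 point b1).
Qed.

Lemma mean_poploo_sqr :
  mean P (fun om => (poperr om - loo om) ^+ 2) <= m%:R^-1 + (2 + 4 * kratio) * gam.
Proof.
pose B := loomean (gerr lam feat lab) (rnd n m) r s kratio.
have hn : nice B by apply: nice_loomean => S j; exact: gerr_nice.
pose H v z := (ge F0 r v z - B v z) * (ge F0 s v z - B v z).
have nH : nice H by apply: niceM; apply: niceB => //; exact: gerr_nice.
have dH (v v' : {ffun T2 -> K}) z :
  (forall b, v (iota2 (inr b)) = v' (iota2 (inr b))) -> H v z = H v' z.
  move=> vv'; rewrite /H /B (dep_loomean z vv').
  by rewrite (gerr_dep r z (fintype.subxx _) vv') (gerr_dep s z (fintype.subxx _) vv').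
have [bH eH] := mean_hat nH dH.
have := Ex_loo_sqr iid_data2 (e := gerr lam feat lab) (@gerr01 _ _ _ _ _ _ _ _ _ _)
  (gerr_nice hlam hfeat hlab) (@gerr_perm _ _ _ _ _ _ _ _ _ _) (@gerr_indep _ _ _ _ _ _ _ _ _ _)
  (fresh1_rnd n m) (fresh2_rnd n m) isT kratio_ge1 kratio_le2 kratio_mean Ex_stab.
rewrite card_random => /(_ hm0); apply: le_trans; rewrite -/H -eH.
pose f (p : Om * Z) := err01 (wfull p.1) (feat p.2) (lab p.2) - loo p.1.
have bf : bmf f by apply: bmfB; [exact: bmf_full_err|exact: bmf_comp measurable_fst bmf_loo].
have fE : (fun w => H (hat w) (data2 w)) = (fun w : Om * Z * Z => f w.1 * f (w.1.1, w.2)).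
  by apply/funext => w; rewrite /H /B loo_hat !gerr_full.
rewrite fE in bH *.
have mf om : mean D (fun z => f (om, z)) = poperr om - loo om.
  rewrite /f /= meanB; [|exact: bmf_pair2 bmf_full_err om|exact: bmf_cst].
  by rewrite mean_cst.
rewrite mean_fubini // le_eqVlt; apply/predU1P; left; apply/esym.
transitivity (mean (P \x D)%E (fun p => (poperr p.1 - loo p.1) * f p)).
  (* The inner integral over the second fresh point is [poperr - loo]; integrating the first one
     then yields the square. *)
  congr mean; apply/funext => p.
  rewrite -mf mulrC -meanZ; last exact: bmf_pair2.
  by [].
rewrite mean_fubini; last first.
  apply: bmfM => //; apply: (bmf_comp (V := fst) (g := fun om => poperr om - loo om)) => //.
  by apply: bmfB; [exact: bmf_poperr|exact: bmf_loo].
congr mean; apply/funext => om.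
by rewrite /= meanZ ?mf ?expr2 //; exact: bmf_pair2.
Qed.

Lemma mean_sbal_sqr : bmf sbal /\
  mean P (fun om => sbal om ^+ 2) <= (3 * k'.+2%:R - 1) / (2 * m%:R).
Proof.
pose f (v : {ffun T2 -> K}) (t : T2) (z : pvec Z T2) : R := 1 - ge F0 t v z.
have f01 v t z : 0 <= f v t z <= 1.
  by rewrite /f; case/andP: (gerr01 lam feat lab F0 t v z) => h0 h1; apply/andP; split; lra.
have f_bmf v t : bmf (f v t).
  by apply: bmfB; [exact: bmf_cst|exact: gerr_nice].
have CJ (t : T2) : t \in clean n m -> t \notin J0.
  by case/imsetP => a _ ->; rewrite !inE.
have C1 : (1 < #|clean n m|)%N by rewrite card_clean (leq_ltn_trans hm0).
have J1 : (0 < #|J0|)%N by rewrite card_random.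
have JC : (#|J0| <= #|clean n m|)%N by rewrite card_random card_clean ltnW.
(* Neutral points are trained with their true labels, so exchanging two of them leaves the labeled
   training set unchanged. *)
have neuF v x : x \in neutral (clean n m) J0 v -> x \in sampled n m /\ offset v x = 0.
  rewrite inE => /orP[/imsetP[a _ ->]|]; first by rewrite /offset !inE.
  rewrite inE random_imset => /andP[/imsetP[b _ ->]] /eqP vb.
  by rewrite /offset vb !inE.
have f_perm v x y t z : x \in neutral (clean n m) J0 v -> y \in neutral (clean n m) J0 v ->
    f v t (fun i => z (tperm x y i)) = f v (tperm x y t) z.
  move=> /neuF[xF ox] /neuF[yF oy]; rewrite /f (@gerr_tperm _ _ _ _ _ _ _ _ _ _ x y F0 t v v z).
    have -> // : (tperm x y @: F0)%SET = F0.
    apply/setP => a; rewrite mem_tperm_imset; case: tpermP => // ->.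
      by rewrite xF yF.
    by rewrite xF yF.
  by move=> i; case: tpermP => // ->; rewrite ox oy.
pose b := balance f (clean n m) J0.
have nb : nice b := nice_balance (clean n m) J0 f_bmf.
have db (v v' : {ffun T2 -> K}) z :
  (forall b, v (iota2 (inr b)) = v' (iota2 (inr b))) -> b v z = b v' z.
  move=> vv'; rewrite /b /balance; congr (_ * _ - _ * _).
    by apply: eq_bigr => t _; rewrite /f (gerr_dep t z (fintype.subxx _) vv').
  apply: eq_bigr => p; rewrite random_imset => /imsetP[b' _ ->].
  by rewrite /f vv' (gerr_dep _ z (fintype.subxx _) vv').
have eb : (fun w => b (hat w) (data2 w)) = (fun w : Om * Z * Z => sbal w.1.1).
  apply/funext => w; rewrite /b /balance card_random card_clean card_ord sum_clean.
  rewrite (sum_random (fun p => (hat w p == 0)%:R * f (hat w) p (data2 w))) /sbal.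
  congr (_ * _ - _ * _); apply: eq_bigr => i _; rewrite /f gerr_full //.
  by rewrite hat_random subr_eq0.
have [bb _] := mean_hat nb db; rewrite eb in bb.
have bs : bmf sbal by have := bmf_pair1 point (bmf_pair1 point bb).
split => //.
have [_ e2] := mean_hat (niceM nb nb)
  (fun v v' z vv' => congr2 *%R (db v v' z vv') (db v v' z vv')).
have := Ex_balance_sqr iid_data2 CJ C1 J1 JC f01 f_bmf f_perm.
rewrite card_ord card_random; apply: le_trans.
have -> : Ex (fun v z => balance f (clean n m) J0 v z ^+ 2) = Ex (fun v z => b v z * b v z).
  by apply: eq_Ex => v z; rewrite expr2.
rewrite -e2 le_eqVlt; apply/predU1P; left.
have -> : (fun w => b (hat w) (data2 w) * b (hat w) (data2 w)) =
    (fun w : Om * Z * Z => sbal w.1.1 ^+ 2).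
  by apply/funext => w; have := congr1 (@^~ w) eb => /= ->; rewrite expr2.
have bs2 : bmf (fun om => sbal om ^+ 2).
  by under eq_fun do rewrite expr2; exact: bmfM.
rewrite (mean_fst (P \x D)%E D (f := fun p : Om * Z => sbal p.1 ^+ 2)); last first.
  exact: (bmf_comp measurable_fst bs2).
by rewrite (mean_fst P D bs2).
Qed.

Definition gexcess (u : {ffun 'I_m -> K}) (z : pvec Z T0) : R :=
  excess (rscore lam (fun t => feat (z t)) (fun t => lab (z t))) (tlab (fun t => lab (z t))) u.

Definition sexcess (om : Om) : R := gexcess (ulab om) (data om).

Lemma bmf_gexcess u : bmf (gexcess u).
Proof.
have mcst (p : Prop) : measurable [set z : pvec Z T0 | p].
  have [h|h] := pselect p.
    by rewrite (_ : [set _ | _] = setT) //; apply/seteqP; split.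
  by rewrite (_ : [set _ | _] = set0) //; apply/seteqP; split.
have mlab t c : measurable [set z : pvec Z T0 | lab (z t) = c].
  by have := measurable_coord t measurableT (hlab c); rewrite setTI.
pose W (z : pvec Z T0) := learn lam (fun t => feat (z t)) (relabel (fun t => lab (z t)) u) [set: T0]%SET.
have be t (y : pvec Z T0 -> K) : (forall c, measurable [set z | y z = c]) ->
    bmf (fun z => err01 (W z) (feat (z t)) (y z)).
  move=> my; split; last first.
    exists 1 => z.
    by case/andP: (err01_itv (W z) (feat (z t)) (y z)) => h0 h1; rewrite ger0_norm.
  apply: (measurable_err01 hlam (x := fun (z : pvec Z T0) t => feat (z t))
    (c := fun (z : pvec Z T0) => relabel (fun t => lab (z t)) u)) => //.
    move=> i a b; rewrite ord1.
    exact: (measurableT_comp (hfeat b) (measurable_coord i)).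
  by case=> [a|b] c; [exact: mlab|exact: (mcst (u b = c))].
have bq b : bmf (fun z : pvec Z T0 => (u b == lab (z (inr b)))%:R).
  split; first exact: measurable_eq_lab.
  by exists 1 => z; case: (_ == _); rewrite ?normr1 ?normr0.
have -> : gexcess u = (fun z => \sum_b (1 - (u b == lab (z (inr b)))%:R) *
    (err01 (W z) (feat (z (inr b))) (u b) * err01 (W z) (feat (z (inr b))) (lab (z (inr b)))
     - (k'.+2 - 2)%N%:R * (1 - err01 (W z) (feat (z (inr b))) (u b)))).
  apply/funext => z; apply: eq_bigr => b _.
  rewrite /wrong2 /rightR /err01 /rscore /score /tlab -/(W z).
  case: (u b == _) => /=; first by rewrite subrr mul0r mulr0 subr0.
  by do 2!case: (_ \in _) => /=; ring.
apply: bmf_sum => b; apply: bmfM; first by apply: bmfB => //; exact: bmf_cst.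
have b1 : bmf (fun z => err01 (W z) (feat (z (inr b))) (u b)).
  by apply: (be (inr b) (fun=> u b)) => c; exact: (mcst (u b = c)).
have b2 := be (inr b) (fun z => lab (z (inr b))) (mlab (inr b)).
apply: bmfB; first exact: bmfM.
apply: bmfM; first exact: bmf_cst.
by apply: bmfB => //; exact: bmf_cst.
Qed.

Lemma bmf_sexcess : bmf sexcess.
Proof. by have [] := mean_unif_indep iid_data unif_data bmf_gexcess. Qed.

(** Given the points, the labels are uniform, so the conditional probability is the proportion
    counted in [card_excess_le]. *)
Lemma sexcess_tail (x : R) : (0 < k')%N -> 0 <= x ->
  (P [set om | x <= sexcess om]%R <=
    (expR (- (x ^+ 2 / (2 * k'.+2%:R * (k'.+2%:R - 2) * m%:R))))%:E)%E.
Proof.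
move=> k0 x0; set q := expR _.
have mA : measurable [set om | x <= sexcess om].
  rewrite -[X in measurable X]setTI; apply: measurable_fun_ler => //.
  by case: bmf_sexcess.
have mE u : measurable [set z : pvec Z T0 | x <= gexcess u z].
  rewrite -[X in measurable X]setTI; apply: measurable_fun_ler => //.
  by case: (bmf_gexcess u).
pose ind u : pvec Z T0 -> R := \1_[set z : pvec Z T0 | x <= gexcess u z].
have bi u : bmf (ind u) by exact: bmf_indic.
have [_ e] := mean_unif_indep iid_data unif_data bi.
rewrite mean_indic // lee_fin.
have -> : mean P \1_[set om | x <= sexcess om] = mean P (fun om => ind (ulab om) (data om)).
  by [].
have mV := iid_measurable iid_data.
rewrite e -mean_sum => [|u]; last exact: bmf_comp mV (bi u).
rewrite -meanZ; last by apply: bmf_sum => u; exact: bmf_comp mV (bi u).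
rewrite -[q](mean_cst P); apply: le_mean; [|exact: bmf_cst|move=> om].
  apply: bmfM; first exact: bmf_cst.
  by apply: bmf_sum => u; exact: bmf_comp mV (bi u).
rewrite card_ffun !card_ord ler_pdivrMl ?ltr0n ?expn_gt0 //.
have := @card_excess_le R k'.+2 'I_m
  (rscore lam (fun t => feat (data om t)) (tlabel om)) (tlab (tlabel om))
  (rscore_mono hlam _ _) (@rscore_class _ _ _ _ _ _ _ _) (@rscore_pair _ _ _ _ _ _ _ _) x.
rewrite ltnS ltnS k0 card_ord hm0 => /(_ isT isT x0); apply: le_trans.
rewrite -sum1_card natr_sum [leRHS]big_mkcond /= le_eqVlt; apply/predU1P; left.
apply: eq_bigr => u _; rewrite /ind indicE inE.
by case: ifP => h; [rewrite mem_set|rewrite memNset //= h].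
Qed.

Lemma sample_bound om :
  poperr om <= errS (wfull om) feat lab ZS om +
    (k'.+2%:R - 1) * (1 - k'.+2%:R / (k'.+2%:R - 1) * errT (wfull om) feat ZT U om) +
    (sbal om + (poperr om - loo om) + kratio / m%:R * sexcess om).
Proof.
have n0 : (0 < n)%N := leq_ltn_trans (leq0n m) hmn.
have := decomposition hlam (poperr om) n0 hm0 (isT : (1 < k'.+2)%N)
  (erefl (learn lam (fun t => feat (data om t)) (relabel (tlabel om) (ulab om)) [set: T0]%SET)).
rewrite -/(subw om [set: T0]%SET) -/(wfull om).
have -> : \sum_(b < m) err01 (wfull om) (feat (data om (inr b))) (ulab om b) =
    \sum_(b < m) err01 (wfull om) (feat (ZT b om)) (U b om).
  by apply: eq_bigr => b _; rewrite ffunE.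
have -> : \sum_(b < m) (ulab om b == tlab (tlabel om) b)%:R *
      (1 - err01 (wfull om) (feat (data om (inr b))) (tlab (tlabel om) b)) =
    \sum_(b < m) (U b om == lab (ZT b om))%:R *
     (1 - err01 (wfull om) (feat (ZT b om)) (lab (ZT b om))).
  by apply: eq_bigr => b _; rewrite ffunE.
have -> : \sum_(b < m) k'.+2%:R / (k'.+2%:R - 1) * (ulab om b != tlab (tlabel om) b)%:R *
      err01 (learn lam (fun t => feat (data om t)) (relabel (tlabel om) (ulab om))
        ([set: T0] :\ inr b)%SET) (feat (data om (inr b))) (tlab (tlabel om) b) =
    \sum_(b < m) kratio * (U b om != lab (ZT b om))%:R *
      err01 (subw om [set~ inr b]%SET) (feat (ZT b om)) (lab (ZT b om)).
  apply: eq_bigr => b _; rewrite ffunE.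
  by have -> // : ([set: T0] :\ inr b)%SET = [set~ inr b]%SET by apply/setP => t; rewrite !inE andbT.
move=> h.
have {}h : poperr om - errS (wfull om) feat lab ZS om +
    k'.+2%:R * errT (wfull om) feat ZT U om - (k'.+2%:R - 1) <=
    sbal om + (poperr om - loo om) + kratio / m%:R * sexcess om := h.
rewrite -/kratio; have e (x : R) : (k'.+2%:R - 1) * (1 - kratio * x) = k'.+2%:R - 1 - k'.+2%:R * x.
  by rewrite /kratio; field; rewrite gt_eqF ?km1_gt0.
by rewrite e; lra.
Qed.

Lemma gam_ge0 : 0 <= gam.
Proof.
have b : 'I_m := Ordinal hm0.
rewrite -lee_fin; apply: le_trans (hstab (rshift n b)).
by apply: integral_ge0 => om _; apply: integral_ge0 => z _; rewrite lee_fin.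
Qed.

Definition dev (om : Om) : R := sbal om + (poperr om - loo om).

(** Twice the sum of the two second-moment bounds, from (a + b)^2 <= 2 a^2 + 2 b^2. *)
Definition vbound : R := (3 * k'.+2%:R + 1) / m%:R + (4 + 8 * kratio) * gam.

Lemma bmf_dev : bmf dev.
Proof.
apply: bmfD; first by case: mean_sbal_sqr.
by apply: bmfB; [exact: bmf_poperr|exact: bmf_loo].
Qed.

Lemma mean_dev_sqr : mean P (fun om => dev om ^+ 2) <= vbound.
Proof.
have [b1 m1] := mean_sbal_sqr.
have b2 : bmf (fun om => poperr om - loo om) := bmfB bmf_poperr bmf_loo.
have sq f : bmf f -> bmf (fun om : Om => f om ^+ 2 : R).
  by move=> hf; under eq_fun do rewrite expr2; exact: bmfM.
have h1 := bmfM (bmf_cst Om (2 : R)) (sq _ b1).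
have h2 := bmfM (bmf_cst Om (2 : R)) (sq _ b2).
apply: (@le_trans _ _ (mean P (fun om => 2 * sbal om ^+ 2 + 2 * (poperr om - loo om) ^+ 2))).
  apply: le_mean; [exact: (sq _ bmf_dev)|exact: bmfD|move=> om].
  by rewrite /dev; have := sqr_ge0 (sbal om - (poperr om - loo om)); nra.
rewrite (meanD P h1 h2) (meanZ P 2 (sq _ b1)) (meanZ P 2 (sq _ b2)).
have m2 := mean_poploo_sqr.
have m0 : 0 < m%:R :> R by rewrite ltr0n.
have e : vbound = 2 * ((3 * k'.+2%:R - 1) / (2 * m%:R)) + 2 * (m%:R^-1 + (2 + 4 * kratio) * gam).
  rewrite /vbound; move: gam kratio (k'.+2%:R : R) => g K0 kk.
  by field; rewrite gt_eqF.
by rewrite e; lra.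
Qed.

Lemma vbound_gt0 : 0 < vbound.
Proof.
have m0 : 0 < m%:R :> R by rewrite ltr0n.
apply: ltr_wpDr; last by rewrite divr_gt0 // ltr_wpDl // mulr_ge0.
by rewrite mulr_ge0 ?gam_ge0 // addr_ge0 // mulr_ge0 // (le_trans ler01 kratio_ge1).
Qed.

Lemma dev_tail (p : R) : 0 < p ->
  measurable [set om | vbound / p <= dev om ^+ 2] /\
  (P [set om | vbound / p <= dev om ^+ 2]%R <= p%:E)%E.
Proof.
move=> p0; have v0 := vbound_gt0.
have sq : bmf (fun om => dev om ^+ 2).
  by under eq_fun do rewrite expr2; exact: bmfM bmf_dev bmf_dev.
split.
  rewrite -[X in measurable X]setTI; apply: measurable_fun_ler => //.
  by case: sq.
have := markov_mean sq (fun om => sqr_ge0 (dev om)) (divr_gt0 v0 p0) mean_dev_sqr.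
by have -> : vbound / (vbound / p) = p by field; rewrite !gt_eqF.
Qed.

Lemma le_dev om (a : R) : ~ (a <= dev om ^+ 2) -> dev om <= Num.sqrt a.
Proof.
move/negP; rewrite -ltNge => /ltW h.
by rewrite (le_trans (ler_norm _)) // -sqrtr_sqr ler_wsqrtr.
Qed.

Local Notation slack delta := (4 / delta * (m%:R^-1 + 3 * beta / (m + n)%:R)).

Lemma slackE delta : slack delta = 4 / delta * (m%:R^-1 + 3 * gam).
Proof. by rewrite (addnC m n) mulrA. Qed.

Lemma event_tail (delta : R) : 0 < delta -> delta < 1 ->
  exists A : set Om, [/\ measurable A, ((1 - delta)%:E <= P A)%E &
    forall om, A om -> dev om + kratio / m%:R * sexcess om <=
      (k'.+2%:R + Num.sqrt k'.+2%:R) * Num.sqrt (ln (4 / delta) / (2 * m%:R)) +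
      Num.sqrt (k'.+2%:R * (k'.+2%:R - 1)) * Num.sqrt (4 / delta * (m%:R^-1 + 3 * gam))].
Proof.
move=> d0 d1; have m0 : 0 < m%:R :> R by rewrite ltr0n.
have g0 := gam_ge0; have K1 := kratio_ge1; have K2 := kratio_le2.
have mV0 : 0 < m%:R^-1 :> R by rewrite invr_gt0.
have compl (B : set Om) : measurable B -> (P B <= delta%:E)%E -> ((1 - delta)%:E <= P (~` B))%E.
  move=> mB PB; rewrite probability_setC // EFinB.
  by apply: leeB.
(* With two classes there is no third label to win, so the excess is nonpositive and all of [delta]
   goes to Chebyshev's inequality. Otherwise each event gets [delta / 2]. *)
have [k0|k0] := posnP k'.
  have [mB PB] := dev_tail d0.
  exists (~` [set om | vbound / delta <= dev om ^+ 2]); split; [exact: measurableC|exact: compl|].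
  move=> om Aom; have h := le_dev Aom.
  have X0 : sexcess om <= 0.
    rewrite /sexcess /gexcess /excess; apply: sumr_le0 => b _.
    have -> : (k'.+2 - 2)%N = 0%N by rewrite k0.
    rewrite mul0r subr0 /wrong2; set u := ulab om b; set t := tlab _ b.
    set F := rscore _ _ _ _ b.
    have [a aF] := argmaxs_neq0 F u.
    have lt2 (c : K) : (c < 2)%N by apply: leq_trans (ltn_ord c) _; rewrite k0.
    have [->//|ut] := eqVneq u t; rewrite /=.
    have : (a == u) || (a == t).
      move: ut (lt2 a) (lt2 u) (lt2 t); rewrite -!val_eqE /=.
      by case: (nat_of_ord a) => [|[|?]]; case: (nat_of_ord u) => [|[|?]]; case: (nat_of_ord t) => [|[|?]].
    by case/orP => /eqP <-; rewrite aF ?andbF.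
  have kk : k'.+2%:R = 2 :> R by rewrite k0.
  have h2 : kratio / m%:R * sexcess om <= 0.
    by rewrite mulr_ge0_le0 // divr_ge0 ?ltW //; lra.
  apply: le_trans (lerD h h2) _; rewrite addr0 kk.
  rewrite -[leLHS]add0r; apply: lerD.
    by rewrite mulr_ge0 ?sqrtr_ge0 // addr_ge0 ?sqrtr_ge0.
  rewrite -sqrtrM; last by lra.
  have hv : vbound <= 8 * (m%:R^-1 + 3 * gam).
    by rewrite /vbound kk; have := ler_wpM2r g0 K2; lra.
  apply: ler_wsqrtr.
  have -> : 2 * (2 - 1) * (4 / delta * (m%:R^-1 + 3 * gam)) = 8 * (m%:R^-1 + 3 * gam) / delta.
    by move: (m%:R^-1 + 3 * gam) => y; field; rewrite gt_eqF.
  by rewrite ler_pM2r ?invr_gt0.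
(* The level at which the tail of the excess equals [delta / 2]. *)
pose x := Num.sqrt (2 * k'.+2%:R * (k'.+2%:R - 2) * m%:R * ln (2 / delta)).
have d2 : 0 < delta / 2 by rewrite divr_gt0.
have [mB PB] := dev_tail d2.
have x0 : 0 <= x by exact: sqrtr_ge0.
have PX := sexcess_tail k0 x0.
have kk : 3 <= k'.+2%:R :> R by rewrite ler_nat.
have x2 : x ^+ 2 / (2 * k'.+2%:R * (k'.+2%:R - 2) * m%:R) = ln (2 / delta).
  rewrite sqr_sqrtr; last first.
    have k20 : 0 <= k'.+2%:R - 2 :> R by lra.
    have l0 : 0 <= ln (2 / delta) by rewrite ln_ge0 // ler_pdivlMr //; lra.
    by rewrite !mulr_ge0.
  by field; rewrite !gt_eqF //; lra.
rewrite x2 in PX.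
have eX : expR (- ln (2 / delta)) = delta / 2.
  by rewrite expRN lnK ?posrE ?divr_gt0 // invf_div.
rewrite eX in PX.
have mX : measurable [set om | x <= sexcess om].
  rewrite -[X in measurable X]setTI; apply: measurable_fun_ler => //.
  by case: bmf_sexcess.
exists (~` ([set om | vbound / (delta / 2) <= dev om ^+ 2] `|` [set om | x <= sexcess om])).
split.
- by apply: measurableC; exact: measurableU.
- apply: compl; first exact: measurableU.
  apply: le_trans (measureU2 P mB mX) _.
  by rewrite {2}(splitr delta) EFinD leeD.
move=> om Aom.
have h1 : ~ (vbound / (delta / 2) <= dev om ^+ 2) by move=> h; apply: Aom; left.
have h2 : sexcess om <= x.
  by rewrite leNgt; apply/negP => /ltW h; apply: Aom; right.
have hv : 2 * vbound <= (6 * k'.+2%:R + 2) * (m%:R^-1 + 3 * gam).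
  rewrite /vbound; have := ler_wpM2r g0 kk; have := ler_wpM2r g0 K2; lra.
have := budget_le (k0 : (2 < k'.+2)%N) m0 d0 (ltW d1) (mulr_ge0 (ler0n R 3) g0) hv.
apply: le_trans; apply: lerD.
  have <- : vbound / (delta / 2) = 2 * vbound / delta by field; rewrite gt_eqF.
  exact: le_dev.
apply: ler_wpM2l => //.
by rewrite divr_ge0 ?ltW // (lt_le_trans ltr01 K1).
Qed.

Lemma generalization (delta : R) : 0 < delta ->
  exists A : set Om, measurable A /\ ((1 - delta)%:E <= P A)%E /\
    forall om, A om ->
      let w := What lam feat lab ZS ZT U om in
      fine (\int[D]_z (err01 w (feat z) (lab z))%:E)
      <= errS w feat lab ZS om
         + (k'.+2%:R - 1) * (1 - k'.+2%:R / (k'.+2%:R - 1) * errT w feat ZT U om)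
         + (k'.+2%:R + Num.sqrt k'.+2%:R + m%:R / (n%:R * Num.sqrt k'.+2%:R))
             * Num.sqrt (ln (4 / delta) / (2 * m%:R))
         + Num.sqrt (k'.+2%:R * (k'.+2%:R - 1)) * Num.sqrt (slack delta).
Proof.
(* For delta >= 1 the required probability is nonpositive and the empty event serves. *)
move=> d0; have [d1|d1] := ltP delta 1; last first.
  exists set0; split; first exact: measurable0.
  by split => //; rewrite measure0 lee_fin subr_le0.
have [A [mA PA hA]] := event_tail d0 d1; exists A; split => //; split => // om Aom.
rewrite What_learn -/(wfull om) slackE.
have := lerD (lexx (errS (wfull om) feat lab ZS om +
    (k'.+2%:R - 1) * (1 - k'.+2%:R / (k'.+2%:R - 1) * errT (wfull om) feat ZT U om)))
  (hA _ Aom).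
move=> /(le_trans (sample_bound om)) h; apply: le_trans h _.
rewrite -[leRHS]addrA lerD2l lerD2r [leRHS]mulrDl lerDl.
by rewrite mulr_ge0 ?sqrtr_ge0 // divr_ge0 // mulr_ge0 ?sqrtr_ge0.
Qed.

End Sample.

Unset Implicit Arguments.

Theorem mainTheorem15 (R : realType)
  (* data space: D is a probability on Z, pushed to X x Y = R^d x {1..k}
     by z |-> (feat z, lab z) *)
  (dZ : measure_display) (Z : measurableType dZ) (D : probability Z R)
  (d k : nat) (feat : Z -> 'rV[R]_d) (lab : Z -> 'I_k)
  (hk : (1 < k)%N)
  (hfeat : forall j : 'I_d, measurable_fun setT (fun z => feat z 0 j))
  (hlab : forall c : 'I_k, measurable (lab @^-1` [set c]))
  (* the sampling probability space *)
  (dO : measure_display) (Om : measurableType dO) (P : probability Om R)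
  (n m : nat) (hm0 : (0 < m)%N) (hmn : (m < n)%N)
  (ZS : 'I_n -> Om -> Z) (ZT : 'I_m -> Om -> Z) (U : 'I_m -> Om -> 'I_k)
  (hZS : forall a, measurable_fun setT (ZS a))
  (hZT : forall b, measurable_fun setT (ZT b))
  (hU : forall b (c : 'I_k), measurable [set om | U b om = c])
  (* S = (feat (ZS a), lab (ZS a))_a iid ~ D ; S~ = (feat (ZT b), U b)_b with
     ZT b ~ D and U b uniform on {1..k}, everything mutually independent *)
  (hindep : forall (A : 'I_n -> set Z) (A' : 'I_m -> set Z) (B : 'I_m -> {set 'I_k}),
     (forall a, measurable (A a)) -> (forall b, measurable (A' b)) ->
     P ((\bigcap_a (ZS a @^-1` A a)) `&` (\bigcap_b (ZT b @^-1` A' b))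
          `&` (\bigcap_b [set om | U b om \in B b]))
     = ((\prod_(a < n) fine (D (A a))) * (\prod_(b < m) fine (D (A' b)))
          * (\prod_(b < m) (#|B b|%:R / k%:R)))%:E)
  (lam : R) (hlam : 0 <= lam)
  (beta : R)
  (* hypothesis stability with constant beta, N = n + m *)
  (hstab : forall i : 'I_(n + m),
     (\int[P]_om \int[D]_z
        (`| err01 (What lam feat lab ZS ZT U om) (feat z) (lab z)
          - err01 (Wloo lam feat lab ZS ZT U i om) (feat z) (lab z) |)%:E
      <= (beta / (n + m)%:R)%:E)%E)
  (delta : R) (hdelta : 0 < delta) :
  exists A : set Om, measurable A /\ ((1 - delta)%:E <= P A)%E /\
    forall om, A om ->
      let w := What lam feat lab ZS ZT U om in
      fine (\int[D]_z (err01 w (feat z) (lab z))%:E)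
      <= errS w feat lab ZS om
         + (k%:R - 1) * (1 - k%:R / (k%:R - 1) * errT w feat ZT U om)
         + (k%:R + Num.sqrt k%:R + m%:R / (n%:R * Num.sqrt k%:R))
             * Num.sqrt (ln (4 / delta) / (2 * m%:R))
         + Num.sqrt (k%:R * (k%:R - 1))
             * Num.sqrt (4 / delta * (m%:R^-1 + 3 * beta / (m + n)%:R)).
Proof.
(* Writing the number of classes as [k'.+2] gives the label type its cyclic group structure, in
   which the offsets live. *)
destruct k as [|[|k']] => //.
exact: (generalization hfeat hlab hZS hZT hU hindep hlam hm0 hmn hstab hdelta).
Qed.
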